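(* Let $q\ge1$. Consider the stochastic regression model $y_t=g_t(\boldsymbol\theta_0)+\varepsilon_t$, $t=1,\dots,n$, where $\{\mathcal G_t\}$ is an increasing sequence of $\sigma$-fields, $\{\varepsilon_t\}$ is a martingale difference sequence with respect to $\{\mathcal G_t\}$ with $\sup_t\mathrm E(\varepsilon_t^2\mid\mathcal G_{t-1})<\infty$ a.s., $\boldsymbol\Theta_1\subset\mathbb R^k$ is compact, $\boldsymbol\theta_0\in\boldsymbol\Theta_1$, and each $g_t(\cdot)$ is a real-valued $\mathcal G_{t-1}$-measurable random function that is continuous on $\boldsymbol\Theta_1$. Let $\hat{\boldsymbol\theta}_n$ be the least squares estimate, i.e. a minimizer of $S_n(\boldsymbol\theta)=\sum_{t=1}^n(y_t-g_t(\boldsymbol\theta))^2$ over $\boldsymbol\Theta_1$. Suppose there exists $\delta_1>0$ such that $B_{\delta_1}(\boldsymbol\theta_0)\subset\boldsymbol\Theta_1$ and the gradient $\nabla g_t$ is continuously differentiable on $B_{\delta_1}(\boldsymbol\theta_0)$. Assume moreover that $\sup_t\mathrm E(|\varepsilon_t|^\gamma\mid\mathcal G_{t-1})<C_5$ a.s. for some $\gamma>\max\{q,2\}$ and some constant $C_5>0$, and that the following conditions hold. (i) The triple consisting of $\boldsymbol\Theta=B_{\delta_1}(\boldsymbol\theta_0)$, $\mathbf f_t(\boldsymbol\theta)=\nabla g_t(\boldsymbol\theta)$ and $\mathcal F_t=\mathcal G_{t-1}$ is regular (in the sense defined in the context). In addition, there exists $q_1>q$ such that $$\max_{1\le i,j\le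 k}\mathrm E\Bigl(\sup_{\boldsymbol\theta\in B_{\delta_1}(\boldsymbol\theta_0)}\Bigl|n^{-1/2}\sum_{t=1}^n\varepsilon_t(\nabla^2g_t(\boldsymbol\theta))_{i,j}\Bigr|^{q_1}\Bigr)=O(1),$$ $$\max_{1\le i,j\le k,\,1\le t\le n}\mathrm E\Bigl(\sup_{\boldsymbol\theta\in B_{\delta_1}(\boldsymbol\theta_0)}|(\nabla^2g_t(\boldsymbol\theta))_{i,j}|^{4q_1}\Bigr)=O(1),$$ $$\max_{1\le t\le n}\mathrm E\Bigl(\sup_{\boldsymbol\theta\in B_{\delta_1}(\boldsymbol\theta_0)}\|\nabla g_t(\boldsymbol\theta)\|^{4q_1}\Bigr)=O(1).$$ (ii) For any $\delta_2>0$ such that $\boldsymbol\Theta_1-B_{\delta_2}(\boldsymbol\theta_0)$ is nonempty, the triple consisting of $\boldsymbol\Theta=\boldsymbol\Theta_1-B_{\delta_2}(\boldsymbol\theta_0)$, $\mathbf f_t(\boldsymbol\theta)=g_t(\boldsymbol\theta)-g_t(\boldsymbol\theta_0)$ (with $r=1$) and $\mathcal F_t=\mathcal G_{t-1}$ is regular. In addition, there exist $0<\nu\le1/2$ and $q_2>q/(2\nu)$ such that $$\mathrm E\Bigl(\sup_{\boldsymbol\theta\in\boldsymbol\Theta_1-B_{\delta_2}(\boldsymbol\theta_0)}\Bigl|n^{-1}\sum_{t=1}^n\varepsilon_t\bigl(g_t(\boldsymbol\theta)-g_t(\boldsymbol\theta_0)\bigr)\Bigr|^{q_2}\Bigr)=O(n^{-\nu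 q_2}).$$ (iii) There exists $\bar M>0$ such that $$P\Bigl(\sup_{\boldsymbol\theta\in B_{\delta_1}(\boldsymbol\theta_0)}\lambda_{\min}^{-1}\Bigl(n^{-1}\sum_{t=1}^n\nabla g_t(\boldsymbol\theta)(\nabla g_t(\boldsymbol\theta))^{\mathrm T}\Bigr)>\bar M\Bigr)=O(n^{-q}),$$ $$P\Bigl(\sup_{\boldsymbol\theta\in B_{\delta_1}(\boldsymbol\theta_0)}n^{-1}\sum_{t=1}^n\|\nabla g_t(\boldsymbol\theta)\|^2>\bar M\Bigr)=O(n^{-q}),$$ $$\max_{1\le i,j\le k}P\Bigl(\sup_{\boldsymbol\theta\in B_{\delta_1}(\boldsymbol\theta_0)}n^{-1}\sum_{t=1}^n(\nabla^2g_t(\boldsymbol\theta))_{i,j}^2>\bar M\Bigr)=O(n^{-q}).$$ Then $$\mathrm E\|n^{1/2}(\hat{\boldsymbol\theta}_n-\boldsymbol\theta_0)\|^q=O(1)\quad\text{as }n\to\infty.$$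
   Context: $\|\cdot\|$ is the Euclidean norm; $\nabla h$ and $\nabla^2h$ are the gradient vector and Hessian matrix of $h$, and $(\cdot)_{i,j}$ denotes the $(i,j)$ entry. $B_\eta(\boldsymbol\theta)=\{\boldsymbol\xi\in\mathbb R^k:\|\boldsymbol\xi-\boldsymbol\theta\|<\eta\}$; $A-B$ for sets denotes set difference. $\lambda_{\min}(L)$ is the minimum eigenvalue of the symmetric matrix $L$ and $\lambda_{\min}^{-1}(L)=1/\lambda_{\min}(L)$ ($=+\infty$ if $\lambda_{\min}(L)=0$). All $O(\cdot)$ statements are as $n\to\infty$. Regular triple: let $\boldsymbol\Theta\subset\mathbb R^k$, let $\{\mathcal F_t\}_{t\ge1}$ be an increasing sequence of $\sigma$-fields and let $\mathbf f_t(\boldsymbol\theta)$, $\boldsymbol\theta\in\boldsymbol\Theta$, $t\ge1$, be $\mathbb R^r$-valued $\mathcal F_t$-measurable random functions. The triple is called regular if all three of the following hold: (a) there exist a positive integer $d$ and positive numbers $\delta,\alpha,M$ such that for any $t>d$, any $0<s_2-s_1\le\delta$, any $\boldsymbol\theta\in\boldsymbol\Theta$ and any $\mathbf a\in\mathbb R^r$ with $\|\mathbf a\|=1$, $P(s_1<\mathbf a^{\mathrm T}\mathbf f_t(\boldsymbol\theta)\le s_2\mid\mathcal F_{t-d})\le M(s_2-s_1)^\alpha$ a.s.; (b) there exist $\tau>0$ and nonnegative random variables $B_t$ with $\sup_{t\ge1}\mathrm E(B_t)\le C_1$ for some $C_1>0$ such that for all $\boldsymbol\xi_1,\boldsymbol\xi_2\in\boldsymbol\Theta$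 with $\|\boldsymbol\xi_1-\boldsymbol\xi_2\|<\tau$, $\|\mathbf f_t(\boldsymbol\xi_1)-\mathbf f_t(\boldsymbol\xi_2)\|\le B_t\|\boldsymbol\xi_1-\boldsymbol\xi_2\|$ a.s.; (c) there exists $C_2>0$ such that $\sup_{t\ge1}\mathrm E(\sup_{\boldsymbol\theta\in\boldsymbol\Theta}\|\mathbf f_t(\boldsymbol\theta)\|^2)\le C_2$. *)

(* Defs.v *)
From HB Require Import structures.
From mathcomp Require Import all_boot all_order all_algebra.
From mathcomp Require Import all_classical all_reals all_analysis.
From mathcomp Require Import measurable_realfun.

Set Implicit Arguments.
Unset Strict Implicit.
Unset Printing Implicit Defensive.

Import Order.TTheory GRing.Theory Num.Theory.
Import numFieldNormedType.Exports.

Local Open Scope classical_set_scope.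
Local Open Scope ring_scope.

(* Vectors of R^k are row vectors.  The library norm on matrices is the sup
   norm (it induces the same topology as the Euclidean norm below). *)
Definition enorm (R : realType) (k : nat) (v : 'rV[R]_k) : R :=
  Num.sqrt (\sum_(i < k) v 0 i ^+ 2).

Definition eball (R : realType) (k : nat) (theta : 'rV[R]_k) (eta : R) :
    set 'rV[R]_k :=
  [set xi | enorm (xi - theta) < eta].

Definition grad (R : realType) (k : nat) (h : 'rV[R]_k -> R)
    (theta : 'rV[R]_k) : 'rV[R]_k :=
  \row_(i < k) 'D_(delta_mx 0 i) h theta.

Definition hess (R : realType) (k : nat) (h : 'rV[R]_k -> R)
    (theta : 'rV[R]_k) : 'M[R]_k :=
  \matrix_(i < k, j < k) 'D_(delta_mx 0 j) (fun x => grad h x 0 i) theta.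

(* For a symmetric matrix of positive size the set of eigenvalues is finite and
   nonempty, so that the infimum is a minimum. *)
Definition lambda_min (R : realType) (k : nat) (L : 'M[R]_k) : R :=
  inf [set a : R | eigenvalue L a].

(* In the extended reals, 0^-1 is +oo. *)
Definition lambda_min_inv (R : realType) (k : nat) (L : 'M[R]_k) : \bar R :=
  ((lambda_min L)%:E^-1)%E.

(* u_n = O(v_n) as n tends to infinity; u may be infinite for finitely many n *)
Definition eO (R : realType) (u : nat -> \bar R) (v : nat -> R) : Prop :=
  exists C : R, \forall n \near \oo, (`|u n| <= (C * v n)%:E)%E.

Definition sub_sigma_field (d : measure_display) (T : measurableType d)
    (F : set (set T)) : Prop :=
  sigma_algebra setT F /\ F `<=` measurable.

Definition increasing_sigma_fields (d : measure_display)
    (T : measurableType d) (G : nat -> set (set T)) : Prop :=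
  (forall t, sub_sigma_field (G t)) /\
  (forall s t, (s <= t)%N -> G s `<=` G t).

Definition measurable_wrt (d d' : measure_display) (T : measurableType d)
    (T' : measurableType d') (F : set (set T)) (f : T -> T') : Prop :=
  forall B, measurable B -> F (f @^-1` B).

(* Y is a version of E(X | F).  When X is nonnegative (possibly with infinite
   mean) Y is almost surely nonnegative, and when X is integrable so is Y. *)
Definition is_condexp (d : measure_display) (T : measurableType d)
    (R : realType) (P : probability T R) (F : set (set T))
    (X Y : T -> \bar R) : Prop :=
  measurable_wrt F Y /\
  forall A, F A -> (\int[P]_(w in A) Y w = \int[P]_(w in A) X w)%E.

Definition is_condprob (d : measure_display) (T : measurableType d)
    (R : realType) (P : probability T R) (F : set (set T))
    (A : set T) (Y : T -> \bar R) : Prop :=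
  is_condexp P F (fun w => (\1_A w)%:E) Y.

Definition martingale_difference (d : measure_display) (T : measurableType d)
    (R : realType) (P : probability T R) (G : nat -> set (set T))
    (eps : nat -> T -> R) : Prop :=
  forall t, (0 < t)%N ->
  [/\ measurable_wrt (G t) (eps t),
      P.-integrable setT (fun w => (eps t w)%:E) &
      is_condexp P (G t.-1) (fun w => (eps t w)%:E) (cst 0%E)].

(* That F is an increasing sequence of sigma-fields to which f theta is adapted
   is a standing assumption on the triple, not repeated here.  Time starts at 1;
   the values of f and F at time 0 are irrelevant.  Conditional probabilities
   are stated through an (almost surely unique) version, and the exceptional
   null set of the Lipschitz bound may depend on the two points. *)
Definition regular (d : measure_display) (T : measurableType d)
    (R : realType) (P : probability T R) (k r : nat) (Theta : set 'rV[R]_k)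
    (f : nat -> 'rV[R]_k -> T -> 'rV[R]_r) (F : nat -> set (set T)) : Prop :=
  [/\ exists (lag : nat) (delta alpha M : R),
        [/\ (0 < lag)%N, 0 < delta, 0 < alpha & 0 < M] /\
        forall (t : nat) (s1 s2 : R) (theta : 'rV[R]_k) (a : 'rV[R]_r),
          (lag < t)%N -> 0 < s2 - s1 <= delta -> Theta theta ->
          enorm a = 1 ->
          exists2 Y : T -> \bar R,
            is_condprob P (F (t - lag)%N)
              [set w | s1 < \sum_(i < r) a 0 i * f t theta w 0 i <= s2] Y &
            {ae P, forall w, (Y w <= (M * (s2 - s1) `^ alpha)%:E)%E},
      exists (tau C1 : R) (B : nat -> {RV P >-> R}),
        [/\ 0 < tau, 0 < C1,
            forall t w, (0 < t)%N -> 0 <= B t w,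
            (ereal_sup [set 'E_P[B t] | t in [set t | (0 < t)%N]] <= C1%:E)%E &
            forall (t : nat) (xi1 xi2 : 'rV[R]_k),
              (0 < t)%N -> Theta xi1 -> Theta xi2 -> enorm (xi1 - xi2) < tau ->
              {ae P, forall w,
                enorm (f t xi1 w - f t xi2 w) <= B t w * enorm (xi1 - xi2)}] &
      exists2 C2 : R, 0 < C2 &
        (ereal_sup
          [set (\int[P]_w
                  ereal_sup [set (enorm (f t theta w) ^+ 2)%:E
                            | theta in Theta])%E
          | t in [set t | (0 < t)%N]] <= C2%:E)%E].

Definition least_squares (T : Type) (R : realType) (k : nat)
    (y : nat -> T -> R) (g : nat -> 'rV[R]_k -> T -> R) (n : nat)
    (theta : 'rV[R]_k) (w : T) : R :=
  \sum_(1 <= t < n.+1) (y t w - g t theta w) ^+ 2.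

(* Main.v *)
Require Import Defs.
From mathcomp Require Import all_boot all_order all_algebra.
From mathcomp Require Import all_classical all_reals all_analysis.
From mathcomp Require Import measurable_realfun.
From mathcomp Require Import ring lra zify.

Set Implicit Arguments.
Unset Strict Implicit.
Unset Printing Implicit Defensive.

Import Order.TTheory GRing.Theory Num.Theory.
Import numFieldNormedType.Exports.

Local Open Scope classical_set_scope.
Local Open Scope ring_scope.

(** Write h for the estimation error thetahat - theta0 and D_t for the
    increment g_t(thetahat) - g_t(theta0). Comparing the residual sums of
    squares at thetahat and at theta0 gives the basic inequality sum D_t^2 <=
    2 sum eps_t D_t, from which everything is derived after splitting
    according to whether thetahat lies in a small ball around theta0.

    Far from theta0 the error is bounded, since Theta1 is compact, so it is
    enough that the probability of being there is O(n^(-q/2)). The mean of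
    (g_t(theta) - g_t(theta0))^2 exceeds a constant c, uniformly in theta off
    the ball, outside an event of probability O(n^(-Q)) for any prescribed Q
    ([regular_mean_square_lower_bound]). At a fixed theta this holds because,
    along times spaced by the lag of the regularity condition, small values of
    the increment are conditionally unlikely given the past; their number is
    then dominated by a binomial variable ([binomial_tail]) and the
    exceptional probability is exponentially small. Uniformity follows from a
    grid of polynomially fine mesh, the Lipschitz bound and the Markov
    inequality for the Lipschitz constants. Off this event the basic
    inequality makes the mean of eps_t D_t at least c/2, which by the Markov
    inequality and the moment assumption has probability O(n^(-q/2))
    ([far_probability]).

    Near theta0, a second-order mean value theorem along the segment from
    theta0 to thetahat is applied to weighted sums of the g_t. On the event
    where the Gram matrix of the gradients at theta0 has smallest eigenvalue
    at least 1/Mbar and the mean squares of the second derivatives are at most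
    Mbar, the mean of D_t^2 is at least |h|^2/(4 Mbar) provided the ball is
    small, while the mean of eps_t D_t is at most n^(-1/2) |h| times the norm
    of the normalized score plus a multiple of the normalized sums of eps_t
    times the second derivatives. Hence n^(1/2) |h| is bounded by these two
    quantities ([least_squares_near]). The second has bounded moments of order
    q1 > q by assumption. The score is a martingale, and its moment of order
    max(q,2) is bounded by a recursion based on the second-order expansion of
    |a+b|^p ([martingale_step], [martingale_moment]). The excluded event has
    probability O(n^(-q)), which beats the crude bound n^(q/2) for the
    normalized error.

    The smallest eigenvalue enters through its variational characterization
    ([lambda_minP]), which also yields the measurability of the excluded
    event; suprema over the parameter are reduced to a dense sequence by
    continuity. *)

(** * Integrals of nonnegative functions *)

Section integral_tools.
Context d (T : measurableType d) (R : realType) (P : probability T R).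

(** Neither function needs to be measurable: the integral of a nonnegative
    function is the supremum of the integrals of the simple functions below it.
    This allows suprema over uncountable parameter sets as integrands. *)
Lemma ge0_le_integral_any (f1 f2 : T -> \bar R) :
  (forall w, 0 <= f1 w)%E -> (forall w, f1 w <= f2 w)%E ->
  (\int[P]_w f1 w <= \int[P]_w f2 w)%E.
Proof.
move=> f10 f12.
have f20 w : (0 <= f2 w)%E by exact: le_trans (f10 w) (f12 w).
rewrite !ge0_integralTE//; apply: ereal_sup_le; apply: image_subset => h hf1 w.
exact: le_trans (hf1 w) (f12 w).
Qed.

(** The Markov inequality for an integrand that need not be measurable. *)
Lemma probability_le_integral (A : set T) (c : R) (f : T -> \bar R) :
  measurable A -> 0 <= c -> (forall w, 0 <= f w)%E ->
  (forall w, A w -> c%:E <= f w)%E ->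
  (c%:E * P A <= \int[P]_w f w)%E.
Proof.
move=> mA c0 f0 cf.
rewrite -(setIT A) -integral_indic// -ge0_integralZl_EFin//; last first.
  exact/measurable_EFinP/measurable_indic.
apply: ge0_le_integral_any => w.
  by rewrite mule_ge0// lee_fin.
rewrite indicE; case: (pselect (A w)) => Aw.
  by rewrite mem_set// mule1 cf.
by rewrite memNset// mule0.
Qed.

Lemma integral_cst_EFin (A : set T) (c : R) :
  measurable A -> (\int[P]_(w in A) c%:E = c%:E * P A)%E.
Proof. by move=> mA; rewrite -(integral_cst P mA). Qed.

Lemma integral_mulr_indic (A : set T) (f : T -> R) :
  (\int[P]_w (f w * \1_A w)%:E = \int[P]_(w in A) (f w)%:E)%E.
Proof.
rewrite [RHS]integral_mkcond; apply: eq_integral => w _.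
rewrite patchE indicE; case: ifPn => _; first by rewrite mulr1.
by rewrite mulr0.
Qed.

Lemma ge0_integralZ_real (c : R) (f : T -> R) : 0 <= c ->
  measurable_fun setT f -> (forall w, 0 <= f w) ->
  (\int[P]_w (c * f w)%:E = c%:E * \int[P]_w (f w)%:E)%E.
Proof.
move=> c0 mf f0; under eq_integral do rewrite EFinM.
apply: ge0_integralZl_EFin => // [w _|]; first by rewrite lee_fin.
exact/measurable_EFinP.
Qed.

Lemma ge0_integralD_real (f g : T -> R) :
  measurable_fun setT f -> (forall w, 0 <= f w) ->
  measurable_fun setT g -> (forall w, 0 <= g w) ->
  (\int[P]_w (f w + g w)%:E = \int[P]_w (f w)%:E + \int[P]_w (g w)%:E)%E.
Proof.
move=> mf f0 mg g0; under eq_integral do rewrite EFinD.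
by apply: ge0_integralD => // [w _||w _|]; rewrite ?lee_fin//;
  exact/measurable_EFinP.
Qed.

(** The sum is h times the number of k < N such that k h < z: a staircase
    function of z with steps of height and width h, truncated at height N h. *)
Lemma staircase_le (h z : R) (N : nat) : 0 < h -> 0 <= z ->
  \sum_(0 <= k < N) h * (k%:R * h < z)%R%:R <= Num.min (N%:R * h) (z + h).
Proof.
move=> h0 z0; elim: N => [|N IH].
  by rewrite big_geq// mul0r le_min lexx/= addr_ge0// ltW.
rewrite big_nat_recr//= -natr1 mulrDl mul1r.
have := IH; rewrite le_min => /andP[IH1 IH2].
rewrite le_min; apply/andP; split.
  by rewrite lerD//; case: (_ < _); rewrite ?mulr1 ?mulr0// ltW.
case: (ltP (N%:R * h) z) => [lt|ge]; last by rewrite mulr0 addr0.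
by rewrite mulr1 lerD2r (le_trans IH1)// ltW.
Qed.

Lemma staircase_ge (h z : R) (N : nat) : 0 < h -> 0 <= z ->
  Num.min (N%:R * h) z <= \sum_(0 <= k < N) h * (k%:R * h < z)%R%:R.
Proof.
move=> h0 z0; elim: N => [|N IH].
  by rewrite big_geq// mul0r ge_min lexx.
rewrite big_nat_recr//= -natr1 mulrDl mul1r.
case: (ltP (N%:R * h) z) => [lt|ge].
  by move: IH; rewrite min_l ?(ltW lt)// mulr1 ge_min => IH; rewrite lerD2r IH.
by move: IH; rewrite min_r// mulr0 addr0 ge_min => ->; rewrite orbT.
Qed.

Lemma measurable_wrt_fun d' (T' : measurableType d') (F : set (set T))
    (Z : T -> T') :
  sub_sigma_field F -> measurable_wrt F Z -> measurable_fun setT Z.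
Proof.
by move=> [_ FM] mZ _ B mB; rewrite setTI; exact/FM/mZ.
Qed.

(** An inequality between the integrals of u1 and u2 over all sets of F
    persists under a nonnegative F-measurable weight Z. With a step h > 0, the
    sum of h 1_(k h < Z) over all k lies between Z and Z + h, so the weighted
    inequality holds up to h times the integral of u2, and h is arbitrary. *)
Lemma le_integral_mul_condexp (F : set (set T)) (Z u1 u2 : T -> R) :
  sub_sigma_field F -> measurable_wrt F Z -> (forall w, 0 <= Z w) ->
  measurable_fun setT u1 -> (forall w, 0 <= u1 w) ->
  measurable_fun setT u2 -> (forall w, 0 <= u2 w) ->
  (\int[P]_w (u2 w)%:E < +oo)%E ->
  (forall A, F A ->
     \int[P]_(w in A) (u1 w)%:E <= \int[P]_(w in A) (u2 w)%:E)%E ->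
  (\int[P]_w (Z w * u1 w)%:E <= \int[P]_w (Z w * u2 w)%:E)%E.
Proof.
move=> sF FZ Z0 mu1 u10 mu2 u20 u2oo u12.
have mZ := measurable_wrt_fun sF FZ.
have key (h : R) : 0 < h ->
  (\int[P]_w (Z w * u1 w)%:E <=
   \int[P]_w (Z w * u2 w)%:E + h%:E * \int[P]_w (u2 w)%:E)%E.
  move=> h0.
  pose A k := [set w | k%:R * h < Z w].
  have FA k : F (A k).
    rewrite (_ : A k = Z @^-1` `]k%:R * h, +oo[%classic); first exact/FZ.
    by apply/seteqP; split=> w /=; rewrite in_itv/= andbT.
  have mA k : measurable (A k) by apply: sF.2.
  have EA k w : \1_(A k) w = (k%:R * h < Z w)%R%:R :> R.
    by rewrite indicE; congr (nat_of_bool _)%:R; apply/idP/idP; rewrite inE.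
  pose st (u : T -> R) k w : \bar R := (h * (u w * \1_(A k) w))%:E.
  have mst (u : T -> R) k : measurable_fun setT u -> measurable_fun setT (st u
      k).
    move=> mu; apply/measurable_EFinP; apply: measurable_funM => //.
    by apply: measurable_funM => //; exact/measurable_indic.
  have st0 (u : T -> R) k w : (forall w, 0 <= u w) -> (0 <= st u k w)%E.
    by move=> u0; rewrite lee_fin !mulr_ge0// ltW.
  have Ist (u : T -> R) k : measurable_fun setT u -> (forall w, 0 <= u w) ->
      (\int[P]_w st u k w = h%:E * \int[P]_(w in A k) (u w)%:E)%E.
    move=> mu u0; rewrite -integral_mulr_indic ge0_integralZ_real//.
    - exact: ltW.
    - by apply: measurable_funM => //; exact/measurable_indic.
    - by move=> w; rewrite mulr_ge0.
  have sumst (u : T -> R) w N : \sum_(0 <= k < N) st u k w =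
      (u w * \sum_(0 <= k < N) h * (k%:R * h < Z w)%R%:R)%:E.
    rewrite sumEFin big_distrr/=; congr (_%:E); apply: eq_bigr => k _.
    by rewrite EA mulrCA.
  apply: (@le_trans _ _ (\int[P]_w \sum_(0 <= k <oo) st u1 k w)%E).
    apply: ge0_le_integral_any => w; first by rewrite lee_fin mulr_ge0.
    have [N hN] : exists N : nat, Z w <= N%:R * h.
      exists (Num.truncn (Z w / h)).+1; rewrite -ler_pdivrMr//.
      by apply/ltW/truncnS_gt.
    apply: le_trans (nneseries_lim_ge N _); last by move=> k _ _; exact: st0.
    rewrite sumst lee_fin mulrC ler_wpM2l//.
    by apply: le_trans (staircase_ge _ h0 (Z0 w)); rewrite min_r.
  rewrite integral_nneseries//; last 2 first.
  - by move=> k; exact: mst.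
  - by move=> k w _; exact: st0.
  apply: (@le_trans _ _ (\sum_(0 <= k <oo) \int[P]_w st u2 k w)%E).
    apply: lee_nneseries => k _.
      by move=> _; apply: integral_ge0 => w _; exact: st0.
    rewrite !Ist//; apply: lee_wpmul2l; first by rewrite lee_fin ltW.
    exact: u12.
  rewrite -integral_nneseries//; last 2 first.
  - by move=> k; exact: mst.
  - by move=> k w _; exact: st0.
  rewrite -(ge0_integralZ_real (ltW h0))// -ge0_integralD_real//; last 4 first.
  - exact: measurable_funM.
  - by move=> w; rewrite mulr_ge0.
  - exact: measurable_funM.
  - by move=> w; rewrite mulr_ge0// ltW.
  apply: ge0_le_integral_any => w.
    by apply: nneseries_ge0 => k _ _; exact: st0.
  apply: lime_le; first by apply: is_cvg_nneseries => k _ _; exact: st0.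
  apply: nearW => N; rewrite sumst lee_fin -mulrDl [leLHS]mulrC.
  rewrite ler_wpM2r//.
  by apply: (le_trans (staircase_le _ h0 (Z0 w))); rewrite ge_min lexx orbT.
apply/lee_addgt0Pr => e e0.
have u2f : (\int[P]_w (u2 w)%:E)%E \is a fin_num.
  by rewrite ge0_fin_numE// integral_ge0// => w _; rewrite lee_fin.
set I := fine (\int[P]_w (u2 w)%:E)%E.
have I0 : 0 <= I by apply/fine_ge0/integral_ge0 => w _; rewrite lee_fin.
apply: (le_trans (key (e / (I + 1)) _)); first by rewrite divr_gt0// ltr_wpDl.
apply: leeD2l; rewrite -(fineK u2f) -/I -EFinM lee_fin.
rewrite -mulrA ler_piMr ?(ltW e0)// mulrC ler_pdivrMr ?mul1r; last lra.
lra.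
Qed.

End integral_tools.

(** * Sub-sigma-fields and inequalities for real powers *)

Section subsigma.
Context d (T : measurableType d).

(** A sigma-field F on T gives rise to a second measurable structure on the
    same carrier; the closure properties of measurable functions are applied to
    that structure. *)
Lemma measurable_wrtP d' (T' : measurableType d') (F : set (set T)) (f : T ->
    T') :
  sub_sigma_field F ->
  measurable_wrt F f <-> measurable_fun (setT : set (g_sigma_algebraType F)) f.
Proof.
move=> [sF _].
have FE : @measurable _ (g_sigma_algebraType F) = F by exact: sigma_algebra_id.
split=> [mf _ B mB|mf B mB].
  by rewrite setTI FE; exact: mf.
by have := mf measurableT B mB; rewrite setTI FE.
Qed.

Lemma measurable_wrtS d' (T' : measurableType d') (F F' : set (set T))
    (f : T -> T') : F `<=` F' -> measurable_wrt F f -> measurable_wrt F' f.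
Proof. by move=> FF' mf B mB; exact/FF'/mf. Qed.

Lemma measurable_sum_nat (R : realType) (h : nat -> T -> R) n :
  (forall t, (0 < t <= n)%N -> measurable_fun setT (h t)) ->
  measurable_fun setT (fun w => \sum_(1 <= t < n.+1) h t w).
Proof.
elim: n => [|n IH] mh.
  by under eq_fun do rewrite big_geq//; exact: measurable_cst.
under eq_fun do rewrite big_nat_recr//=.
apply: measurable_funD; last by apply: mh; rewrite ltnS leqnn.
by apply: IH => t /andP[t0 tn]; apply: mh; rewrite t0 leqW.
Qed.

End subsigma.

Section real_inequalities.
Context (R : realType).
Implicit Types a b p r s x y : R.

Lemma powR_le1D x p r : 0 <= x -> 0 <= p -> p <= r -> x `^ p <= 1 + x `^ r.
Proof.
move=> x0 p0 pr; have [x1|x1] := leP x 1.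
  rewrite -[leLHS]addr0 lerD ?powR_ge0//.
  have -> : 1 = 1 `^ p :> R by rewrite powR1.
  by apply: ge0_ler_powR; rewrite ?nnegrE.
rewrite -[leLHS]add0r lerD//; apply: ler_powR => //; exact: ltW.
Qed.

(** From exp(-y) >= 1 - y and 1/(1 - y) <= 1 + y + 2 y^2. *)
Lemma expR_le_quadratic y : y <= 2^-1 -> expR y <= 1 + y + 2 * y ^+ 2.
Proof.
move=> y2; have := expR_ge1Dx (- y) => h.
have y1 : 0 < 1 - y by lra.
rewrite -[y in expR y]opprK expRN -[leRHS]invrK lef_pV2 ?posrE ?expR_gt0
    ?invr_gt0//; last nra.
apply: le_trans h; rewrite -[leRHS]invrK lef_pV2 ?posrE ?invr_gt0//; last nra.
rewrite -[leLHS]mul1r ler_pdivrMr//; nra.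
Qed.

Lemma powR_1D_le x p : 2 <= p -> `|x| <= (2 * p)^-1 ->
  (1 + x) `^ p <= 1 + p * x + 2 * p ^+ 2 * x ^+ 2.
Proof.
move=> p2 xp.
have px : `|p * x| <= 2^-1.
  rewrite normrM (ger0_norm (le_trans _ p2))//.
  rewrite -ler_pdivlMl; last lra.
  by rewrite -invfM mulrC.
have x1 : 0 < 1 + x.
  have : `|x| <= 4^-1 by rewrite (le_trans xp)// lef_pV2 ?posrE; lra.
  by rewrite ler_norml => /andP[]; lra.
rewrite /powR gt_eqF//.
apply: (@le_trans _ _ (expR (p * x))).
  by rewrite ler_expR ler_pM2l; [apply: le_ln1Dx; lra|lra].
apply: (le_trans (expR_le_quadratic _)); last by rewrite exprMn; lra.
exact: le_trans (ler_norm _) px.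
Qed.

(** The constant of the second-order expansion of |a + b|^p below. *)
Definition powR_add_cst p := 2 * p ^+ 2 + (2 * p + 1) `^ p.

Lemma powR_add_cst_ge0 p : 0 <= powR_add_cst p.
Proof.
by rewrite /powR_add_cst addr_ge0 ?powR_ge0// mulr_ge0// sqr_ge0.
Qed.

Lemma powR_subKr p s : 2 <= p -> 0 <= s -> s `^ (p - 2) * s ^+ 2 = s `^ p.
Proof.
move=> p2 s0; rewrite -(powR_mulrn 2 s0) -powRD ?subrK//.
by apply/implyP => /eqP; lra.
Qed.

(** The first-order expansion of |a + b|^p around a, with a remainder made of a
    quadratic term and a term of order p. For |b| at most |a|/(2 p) it is the
    expansion of (1 + x)^p with x = b/a; otherwise |b|^p dominates. *)
Lemma powR_add_le a b p : 2 <= p ->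
  `|a + b| `^ p <= `|a| `^ p + p * `|a| `^ (p - 2) * a * b
     + powR_add_cst p * (`|a| `^ (p - 2) * b ^+ 2 + `|b| `^ p).
Proof.
move=> p2; rewrite /powR_add_cst.
set A := `|a| `^ (p - 2); have A0 : 0 <= A by exact: powR_ge0.
have Q0 : 0 <= (2 * p + 1) `^ p by exact: powR_ge0.
have bp0 : 0 <= `|b| `^ p by exact: powR_ge0.
have ap0 : 0 <= `|a| `^ p by exact: powR_ge0.
have Ab0 : 0 <= A * b ^+ 2 by rewrite mulr_ge0// sqr_ge0.
have [ba|ab] := leP (2 * p * `|b|) `|a|.
  have [a0|a0] := eqVneq a 0.
    have -> : b = 0.
      apply/eqP; rewrite -normr_le0; move: ba; rewrite a0 normr0 => ba.
      by rewrite -(pmulr_rle0 _ (_ : 0 < 2 * p)) //; lra.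
    have p0 : p != 0 by rewrite gt_eqF//; lra.
    by rewrite a0 addr0 normr0 powR0// !mulr0 expr0n/= !mulr0 !addr0 mulr0.
  have na0 : 0 < `|a| by rewrite normr_gt0.
  have -> : `|a + b| = `|a| * `|1 + b / a|.
    by rewrite -normrM mulrDr mulr1 mulrCA divff// mulr1.
  have xb : `|b / a| <= (2 * p)^-1.
    rewrite normrM normfV ler_pdivrMr// ler_pdivlMl//; lra.
  have H := powR_1D_le p2 xb.
  have x1 : 0 <= 1 + b / a.
    have : `|b / a| <= 1 by rewrite (le_trans xb)// invf_le1; lra.
    by rewrite ler_norml => /andP[]; lra.
  rewrite powRM// (ger0_norm x1).
  have E : `|a| `^ p = A * a ^+ 2 by rewrite -real_normK ?num_real// powR_subKr.
  apply: (le_trans (ler_wpM2l ap0 H)).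
  have -> : `|a| `^ p * (1 + p * (b / a) + 2 * p ^+ 2 * (b / a) ^+ 2) =
     `|a| `^ p + p * A * a * b + 2 * p ^+ 2 * (A * b ^+ 2).
    by rewrite E; field.
  rewrite -addrA; rewrite -[leRHS]addrA lerD2l lerD2l.
  have p20 : 0 <= 2 * p ^+ 2 by rewrite mulr_ge0// sqr_ge0.
  nra.
have nab : `|a + b| <= (2 * p + 1) * `|b|.
  by rewrite (le_trans (ler_normD _ _))// mulrDl mul1r lerD2r ltW.
have H : `|a + b| `^ p <= (2 * p + 1) `^ p * `|b| `^ p.
  rewrite -powRM//; last lra.
  by apply: ge0_ler_powR; rewrite ?nnegrE ?mulr_ge0//; lra.
have H2 : - (2 * p ^+ 2 * (A * b ^+ 2)) <= p * A * a * b.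
  rewrite lerNl; apply: le_trans (ler_norm _) _; rewrite normrN !normrM.
  rewrite (ger0_norm A0) (ger0_norm (_ : 0 <= p)); last lra.
  rewrite -[b ^+ 2]real_normK ?num_real//.
  have -> : 2 * p ^+ 2 * (A * `|b| ^+ 2) = (p * A) * ((2 * p * `|b|) * `|b|) by
      ring.
  rewrite -!(mulrA (p * A)) ler_wpM2l ?mulr_ge0//; first lra.
  by rewrite ler_wpM2r// ltW.
have p20 : 0 <= 2 * p ^+ 2 by rewrite mulr_ge0// sqr_ge0.
nra.
Qed.

(** According as r x <= s or s < r x, one of the two terms on the right is an
    upper bound by itself. *)
Lemma powR_weighted_young r s x p : 2 <= p -> 0 < r -> 0 <= s -> 0 <= x ->
  s `^ (p - 2) * x ^+ 2 <= s `^ p / r ^+ 2 + r `^ (p - 2) * x `^ p.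
Proof.
move=> p2 r0 s0 x0; have [sx|xs] := leP (r * x) s.
  rewrite -[leLHS]addr0 lerD ?mulr_ge0 ?powR_ge0//.
  rewrite ler_pdivlMr ?exprn_gt0// -(powR_subKr p2 s0) -mulrA -exprMn.
  by rewrite ler_wpM2l ?powR_ge0// mulrC lerXn2r ?nnegrE// mulr_ge0// ltW.
rewrite -[leLHS]add0r lerD ?divr_ge0 ?powR_ge0 ?sqr_ge0//.
rewrite -(powR_subKr p2 x0) mulrA -powRM ?(ltW r0)//.
rewrite ler_wpM2r ?sqr_ge0//.
by apply: ge0_ler_powR; rewrite ?nnegrE ?(ltW xs)// ?mulr_ge0 ?(ltW r0)//; lra.
Qed.

Lemma powR_mul_le_add s x p : 2 <= p -> 0 <= s -> 0 <= x ->
  s `^ (p - 2) * s * x <= s `^ p + x `^ p.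
Proof.
move=> p2 s0 x0; have [sx|xs] := leP x s.
  rewrite -[leLHS]addr0 lerD ?powR_ge0//.
  rewrite -(powR_subKr p2 s0) -mulrA ler_wpM2l ?powR_ge0// expr2.
  exact: ler_wpM2l.
rewrite -[leLHS]add0r lerD ?powR_ge0//.
rewrite -(powR_subKr p2 x0) -mulrA expr2.
rewrite ler_pM ?powR_ge0 ?mulr_ge0//.
  by apply: ge0_ler_powR; rewrite ?nnegrE// ?(ltW xs)//; lra.
by apply: ler_wpM2r; rewrite // ltW.
Qed.

End real_inequalities.

(** * One step of the moment recursion for martingales *)

Section martingale_moments.
Context d (T : measurableType d) (R : realType) (P : probability T R).
Implicit Types (F : set (set T)) (S x e : T -> R) (p r gamma : R).

(** If e has conditional mean zero given F, its positive and negative parts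
    have the same integral over each set of F. *)
Lemma condexp_pos_neg F e : sub_sigma_field F ->
  P.-integrable setT (EFin \o e) ->
  (forall A, F A -> \int[P]_(w in A) (e w)%:E = 0)%E ->
  forall A, F A ->
    (\int[P]_(w in A) (Num.max (e w) 0)%:E =
     \int[P]_(w in A) (Num.max (- e w) 0)%:E)%E.
Proof.
move=> [_ FM] ie e0 A FA.
have mA := FM _ FA.
have := e0 _ FA; rewrite integralE.
have ieA : P.-integrable A (EFin \o e) by apply: integrableS ie.
have := integrable_pos_fin_num mA ieA; have := integrable_neg_fin_num mA ieA.
have -> : (\int[P]_(w in A) (EFin \o e)^\+ w = \int[P]_(w in A) (Num.max (e w)
    0)%:E)%E.
  by apply: eq_integral => w _; rewrite funeposE/= -EFin_max.
have -> : (\int[P]_(w in A) (EFin \o e)^\- w = \int[P]_(w in A) (Num.max (- e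
    w) 0)%:E)%E.
  by apply: eq_integral => w _; rewrite funenegE/= -EFin_max.
move=> f1 f2 /eqP; rewrite sube_eq ?add0e; last 2 first.
- by [].
- by rewrite fin_num_adde_defl.
by move/eqP.
Qed.

(** If the conditional moment of |e| of order gamma given F is at most C, the
    factor 1 + |e|^gamma costs a factor 1 + C under the integral, for any
    F-measurable weight. *)
Lemma le_integral_conditional_moment F (Z : T -> R) e gamma (C : R) :
  sub_sigma_field F -> measurable_wrt F Z -> (forall w, 0 <= Z w) ->
  measurable_fun setT e -> 0 <= C ->
  (forall A, F A -> \int[P]_(w in A) (`|e w| `^ gamma)%:E <= C%:E * P A)%E ->
  (\int[P]_w (Z w * (1 + `|e w| `^ gamma))%:E <=
   (1 + C)%:E * \int[P]_w (Z w)%:E)%E.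
Proof.
move=> sF FZ Z0 me C0 eC.
have mZ := measurable_wrt_fun sF FZ.
have mpe : measurable_fun setT (fun w => `|e w| `^ gamma).
  apply: (measurableT_comp (measurable_powR gamma)).
  exact: measurableT_comp.
have H : (\int[P]_w (Z w * `|e w| `^ gamma)%:E <= \int[P]_w (Z w * C)%:E)%E.
  apply: (le_integral_mul_condexp (u2 := fun=> C) sF) => // [|A FA].
  - by rewrite integral_cst_EFin// probability_setT mule1 ltry.
  - by apply: (le_trans (eC _ FA)); rewrite integral_cst_EFin//; exact: sF.2.
under eq_integral do rewrite mulrDr mulr1.
rewrite ge0_integralD_real//; last 2 first.
- exact: measurable_funM.
- by move=> w; rewrite mulr_ge0// powR_ge0.
rewrite EFinD ge0_muleDl ?lee_fin// mul1e leeD2l//.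
apply: (le_trans H); rewrite -ge0_integralZ_real//.
by under eq_integral do rewrite mulrC.
Qed.

(** Adding to S the martingale increment e x changes the moment of order p by
    at most a second-order term: the term of first order in e x integrates to
    zero, and powers of |e| up to gamma are controlled by their conditional
    moments. *)
Lemma martingale_step F S x e p gamma (C : R) : 2 <= p -> p <= gamma ->
  sub_sigma_field F -> measurable_wrt F S -> measurable_wrt F x ->
  P.-integrable setT (EFin \o e) ->
  (forall A, F A -> \int[P]_(w in A) (e w)%:E = 0)%E ->
  0 <= C ->
  (forall A, F A -> \int[P]_(w in A) (`|e w| `^ gamma)%:E <= C%:E * P A)%E ->
  (\int[P]_w (`|S w| `^ p)%:E < +oo)%E ->
  (\int[P]_w (`|x w| `^ p)%:E < +oo)%E ->
  (\int[P]_w (`|S w + e w * x w| `^ p)%:E <=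
   \int[P]_w (`|S w| `^ p)%:E +
   (powR_add_cst p * (1 + C))%:E *
     \int[P]_w (`|S w| `^ (p - 2) * x w ^+ 2 + `|x w| `^ p)%:E)%E.
Proof.
move=> p2 pg sF FS Fx ie e0 C0 eC Soo xoo.
have me : measurable_fun setT e by move/integrableP: ie => [] /measurable_EFinP.
have mS := measurable_wrt_fun sF FS; have mx := measurable_wrt_fun sF Fx.
have mnorm (f : T -> R) r : measurable_fun setT f ->
    measurable_fun setT (fun w => `|f w| `^ r).
  move=> mf; apply: (measurableT_comp (measurable_powR r)).
  exact: measurableT_comp.
pose Z w := p * `|S w| `^ (p - 2) * S w * x w.
have FZ : measurable_wrt F Z.
  apply/(measurable_wrtP _ sF).
  have /(measurable_wrtP _ sF) mS' := FS; have /(measurable_wrtP _ sF) mx' :=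
      Fx.
  apply: measurable_funM => //; apply: measurable_funM => //.
  apply: measurable_funM => //.
  apply: (measurableT_comp (measurable_powR _)).
  exact: measurableT_comp.
pose pos (f : T -> R) w := Num.max (f w) 0.
pose neg (f : T -> R) w := Num.max (- f w) 0.
have pos0 f w : 0 <= pos f w by rewrite le_max lexx orbT.
have neg0 f w : 0 <= neg f w by rewrite le_max lexx orbT.
have mpos f : measurable_fun setT f -> measurable_fun setT (pos f).
  by move=> mf; apply: measurable_maxr.
have mneg f : measurable_fun setT f -> measurable_fun setT (neg f).
  by move=> mf; apply: measurable_maxr => //; exact: measurableT_comp.
have Fpos : measurable_wrt F (pos Z).
  have /(measurable_wrtP _ sF) mZ' := FZ.
  by apply/(measurable_wrtP _ sF); apply: measurable_maxr.
have Fneg : measurable_wrt F (neg Z).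
  have /(measurable_wrtP _ sF) mZ' := FZ.
  by apply/(measurable_wrtP _ sF); apply: measurable_maxr => //; exact:
      measurableT_comp.
have mZ := measurable_wrt_fun sF FZ.
have epn := condexp_pos_neg sF ie e0.
have eoo : (\int[P]_w (pos e w)%:E < +oo)%E /\ (\int[P]_w (neg e w)%:E < +oo)%E.
  move/integrableP: ie => [_ ioo]; split; apply: le_lt_trans ioo;
    apply: ge0_le_integral_any => w; rewrite ?lee_fin//=.
  - by rewrite /pos ge_max ler_norm normr_ge0.
  - by rewrite /neg ge_max -normrN ler_norm normr_ge0.
have cross (Y : T -> R) : measurable_wrt F Y -> (forall w, 0 <= Y w) ->
    (\int[P]_w (Y w * pos e w)%:E = \int[P]_w (Y w * neg e w)%:E)%E.
  move=> FY Y0; apply/eqP; rewrite eq_le; apply/andP; split;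
    apply: (le_integral_mul_condexp sF) => //; rewrite ?(eoo.1, eoo.2)//;
    (try exact: mpos); (try exact: mneg); by move=> A FA; rewrite /pos /neg epn.
pose err w := `|S w| `^ (p - 2) * x w ^+ 2 + `|x w| `^ p.
pose K := powR_add_cst p.
have K0 : 0 <= K by exact: powR_add_cst_ge0.
have err0 w : 0 <= err w by rewrite /err addr_ge0 ?powR_ge0// mulr_ge0
    ?powR_ge0 ?sqr_ge0.
have Ferr : measurable_wrt F err.
  apply/(measurable_wrtP _ sF).
  have /(measurable_wrtP _ sF) mS' := FS; have /(measurable_wrtP _ sF) mx' :=
      Fx.
  apply: measurable_funD.
    apply: measurable_funM; last exact: measurable_funX.
    apply: (measurableT_comp (measurable_powR _)).
    exact: measurableT_comp.
  apply: (measurableT_comp (measurable_powR _)).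
  exact: measurableT_comp.
have merr := measurable_wrt_fun sF Ferr.
pose E w := 1 + `|e w| `^ gamma.
have E0 w : 0 <= E w by rewrite addr_ge0// powR_ge0.
have mE : measurable_fun setT E by apply: measurable_funD => //; exact: mnorm.
pose a w := pos Z w * neg e w + neg Z w * pos e w.
pose b w := pos Z w * pos e w + neg Z w * neg e w.
(* the first-order term b - a is moved to both sides, so that only
   nonnegative functions are integrated *)
have pointwise w : `|S w + e w * x w| `^ p + a w <=
    `|S w| `^ p + (b w + K * (err w * E w)).
  have := powR_add_le (S w) (e w * x w) p2.
  rewrite -/K => H.
  have ab : b w - a w = Z w * e w.
    have split_pn (u : R) : u = Num.max u 0 - Num.max (- u) 0.
      by rewrite /Num.max; case: ifPn; case: ifPn; lra.
    by rewrite [X in _ = X * _]split_pn [X in _ = _ * X]split_pn /a /b /pos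
        /neg; ring.
  have ZE : p * `|S w| `^ (p - 2) * S w * (e w * x w) = b w - a w.
    by rewrite ab /Z; ring.
  rewrite ZE in H.
  have ge1 : e w ^+ 2 <= E w.
    rewrite -real_normK ?num_real// -powR_mulrn// powR_le1D//.
    exact: le_trans pg.
  have gep : `|e w| `^ p <= E w by apply: powR_le1D => //; lra.
  have H2 : `|S w| `^ (p - 2) * (e w * x w) ^+ 2 + `|e w * x w| `^ p <= err w *
      E w.
    rewrite normrM powRM// exprMn mulrDl lerD//.
      by rewrite mulrCA mulrC ler_wpM2l// mulr_ge0 ?powR_ge0 ?sqr_ge0.
    by rewrite mulrC ler_wpM2l// powR_ge0.
  have := ler_wpM2l K0 H2; lra.
have a0 w : 0 <= a w by rewrite addr_ge0 ?mulr_ge0.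
have b0 w : 0 <= b w by rewrite addr_ge0 ?mulr_ge0.
have ma : measurable_fun setT a.
  by apply: measurable_funD; apply: measurable_funM; auto.
have mb : measurable_fun setT b.
  by apply: measurable_funD; apply: measurable_funM; auto.
have Iab : (\int[P]_w (a w)%:E = \int[P]_w (b w)%:E)%E.
  rewrite !ge0_integralD_real//; last 8 first.
  all: try by move=> w; rewrite mulr_ge0.
  all: try by apply: measurable_funM; auto.
  by rewrite (cross _ Fpos (pos0 _)) (cross _ Fneg (neg0 _)).
(* the common value of both integrals has to be finite to be cancelled *)
have aoo : (\int[P]_w (a w)%:E < +oo)%E.
  apply: (@le_lt_trans _ _ (\int[P]_w (p * (`|S w| `^ p + `|x w| `^ p * E
      w))%:E)%E).
    apply: ge0_le_integral_any => w; rewrite lee_fin//.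
    have gep : `|e w| `^ p <= E w by apply: powR_le1D => //; lra.
    apply: (@le_trans _ _ (`|Z w| * `|e w|)).
      have normE (u : R) : `|u| = Num.max u 0 + Num.max (- u) 0.
        rewrite /Num.max; have [u0|] := boolP (0 <= u).
          by rewrite (ger0_norm u0); do 2 case: ifPn; lra.
        rewrite -ltNge => u0.
        by rewrite (ltr0_norm u0); do 2 case: ifPn; lra.
      rewrite (normE (Z w)) (normE (e w)) -/(pos Z w) -/(neg Z w).
      rewrite -/(pos e w) -/(neg e w) /a.
      have := mulr_ge0 (pos0 Z w) (pos0 e w).
      have := mulr_ge0 (neg0 Z w) (neg0 e w); lra.
    rewrite /Z !normrM (ger0_norm (_ : 0 <= p)); last lra.
    rewrite (ger0_norm (powR_ge0 _ _)).
    have -> : p * `|S w| `^ (p - 2) * `|S w| * `|x w| * `|e w| =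
       p * (`|S w| `^ (p - 2) * `|S w| * (`|x w| * `|e w|)) by ring.
    rewrite ler_wpM2l//; first lra.
    apply: (le_trans (powR_mul_le_add p2 _ _)); rewrite ?mulr_ge0// lerD2l.
    by rewrite powRM// ler_wpM2l// powR_ge0.
  rewrite ge0_integralZ_real; last 3 first.
  - by lra.
  - by apply: measurable_funD; [exact: mnorm|apply: measurable_funM => //;
      exact: mnorm].
  - by move=> w; rewrite addr_ge0 ?mulr_ge0 ?powR_ge0.
  rewrite ge0_integralD_real; last 4 first.
  - exact: mnorm.
  - by move=> w; exact: powR_ge0.
  - by apply: measurable_funM => //; exact: mnorm.
  - by move=> w; rewrite ?mulr_ge0 ?powR_ge0.
  have Fxp : measurable_wrt F (fun w => `|x w| `^ p).
    apply/(measurable_wrtP _ sF); have /(measurable_wrtP _ sF) mx' := Fx.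
    apply: (measurableT_comp (measurable_powR _)).
    exact: measurableT_comp.
  have I2 := le_integral_conditional_moment sF Fxp (fun w => powR_ge0 _ _) me
      C0 eC.
  rewrite lte_mul_pinfty ?lee_fin//; first lra.
  rewrite lte_add_pinfty//; apply: (le_lt_trans I2).
  by rewrite lte_mul_pinfty// lee_fin addr_ge0.
have I : (\int[P]_w (`|S w + e w * x w| `^ p)%:E + \int[P]_w (a w)%:E <=
    \int[P]_w (`|S w| `^ p)%:E + (\int[P]_w (b w)%:E +
    K%:E * \int[P]_w (err w * E w)%:E))%E.
  have mSe : measurable_fun setT (fun w => `|S w + e w * x w| `^ p).
    by apply: mnorm; apply: measurable_funD => //; exact: measurable_funM.
  have mEe : measurable_fun setT (fun w => K * (err w * E w)).
    by apply: measurable_funM => //; exact: measurable_funM.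
  rewrite -ge0_integralZ_real//; [|exact: measurable_funM|by move=> w; rewrite
      mulr_ge0].
  rewrite -!ge0_integralD_real//.
  - apply: ge0_le_integral_any => w; rewrite lee_fin ?pointwise//.
    by rewrite addr_ge0// powR_ge0.
  - exact: mnorm.
  - exact: measurable_funD.
  - by move=> w; rewrite addr_ge0// mulr_ge0// mulr_ge0.
  - by move=> w; rewrite mulr_ge0// mulr_ge0.
move: I; rewrite -Iab addeCA [leRHS]addeC leeD2rE; last first.
  by rewrite ge0_fin_numE// integral_ge0// => w _; rewrite lee_fin.
move=> I; apply: (le_trans I); apply: leeD2l.
rewrite EFinM -muleA lee_wpmul2l ?lee_fin//.
exact: (le_integral_conditional_moment sF Ferr err0 me C0 eC).
Qed.

End martingale_moments.

(** * Moments of normalized martingales *)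

Section martingale_moment.
Context d (T : measurableType d) (R : realType) (P : probability T R).

(** The normalization is by the square root of n. The one-step inequality and
    the weighted Young inequality with r^2 = n give, for the moments A_t of the
    partial sums, A_(t+1) <= (1 + c/n) A_t + M with M of order n^(p/2 - 1),
    whence A_n is of order n^(p/2). *)
Lemma martingale_moment (G : nat -> set (set T)) (eps x : nat -> T -> R)
    (p gamma C D : R) :
  2 <= p -> p <= gamma -> increasing_sigma_fields G ->
  martingale_difference P G eps -> 0 <= C ->
  (forall t A, (0 < t)%N -> G t.-1 A ->
     \int[P]_(w in A) (`|eps t w| `^ gamma)%:E <= C%:E * P A)%E ->
  (forall t, (0 < t)%N -> measurable_wrt (G t.-1) (x t)) ->
  (forall t, (0 < t)%N -> \int[P]_w (`|x t w| `^ p)%:E <= D%:E)%E ->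
  exists K : R, forall n, (0 < n)%N ->
    (\int[P]_w (`|(Num.sqrt n%:R)^-1 *
       \sum_(1 <= t < n.+1) eps t w * x t w| `^ p)%:E <= K%:E)%E.
Proof.
move=> p2 pg [sG incG] md C0 epsC xG xD.
pose c := powR_add_cst p * (1 + C).
have c0 : 0 <= c.
  by rewrite mulr_ge0 ?powR_add_cst_ge0// addr_ge0.
have D0 : 0 <= D.
  rewrite -lee_fin; apply: le_trans (xD 1%N isT).
  by apply: integral_ge0 => w _; rewrite lee_fin powR_ge0.
pose S m w := \sum_(1 <= t < m.+1) eps t w * x t w.
have GS m : measurable_wrt (G m) (S m).
  apply/(measurable_wrtP _ (sG m)); apply: measurable_sum_nat => t /andP[t0 tm].
  apply: measurable_funM; apply/(measurable_wrtP _ (sG m)).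
    by have [et _ _] := md t t0; apply: measurable_wrtS et; exact: incG.
  apply: measurable_wrtS (xG t t0); apply: incG.
  exact: leq_trans (leq_pred t) tm.
have mS m : measurable_fun setT (S m) := measurable_wrt_fun (sG m) (GS m).
have mpow (f : T -> R) r : measurable_fun setT f ->
    measurable_fun setT (fun w => `|f w| `^ r).
  move=> mf; apply: (measurableT_comp (measurable_powR r)).
  exact: measurableT_comp.
exists (2 * c * expR c * D) => n n0.
set r := Num.sqrt n%:R.
have nR0 : 0 < n%:R :> R by rewrite ltr0n.
have r0 : 0 < r by rewrite sqrtr_gt0.
have r2 : r ^+ 2 = n%:R by rewrite sqr_sqrtr// ler0n.
have r1 : 1 <= r by rewrite -sqrtr1 ler_sqrt// ler1n.
have rp1 : 1 <= r `^ (p - 2).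
  have p20 : 0 <= p - 2 by rewrite subr_ge0.
  by have := ler_powR r1 p20; rewrite powRr0.
pose M := c * ((r `^ (p - 2) + 1) * D).
have M0 : 0 <= M by rewrite mulr_ge0// mulr_ge0// addr_ge0// powR_ge0.
pose a := 1 + c / n%:R.
have a1 : 1 <= a by rewrite lerDl divr_ge0.
(* m counts the steps; the factor a = 1 + c/n is applied at most n times *)
have bound m : (\int[P]_w (`|S m w| `^ p)%:E <= (m%:R * a ^+ m * M)%:E)%E.
  elim: m => [|m IH].
    rewrite !mul0r integral0_eq// => w _.
    by rewrite /S big_geq// normr0 powR0// gt_eqF//; lra.
  have [em ie [_ e0]] := md m.+1 isT.
  have SE w : S m.+1 w = S m w + eps m.+1 w * x m.+1 w by rewrite /S
      big_nat_recr.
  under eq_integral do rewrite SE.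
  have Soo : (\int[P]_w (`|S m w| `^ p)%:E < +oo)%E by apply: le_lt_trans IH _;
      rewrite ltry.
  have xoo : (\int[P]_w (`|x m.+1 w| `^ p)%:E < +oo)%E.
    by apply: le_lt_trans (xD m.+1 isT) _; rewrite ltry.
  have mx := measurable_wrt_fun (sG m) (xG m.+1 isT).
  have e0' A : G m A -> (\int[P]_(w in A) (eps m.+1 w)%:E = 0)%E.
    by move=> GA; rewrite -(e0 _ GA) integral0.
  apply: (le_trans (martingale_step p2 pg (sG m) (GS m) (xG m.+1 isT) ie e0' C0
    (fun A => epsC m.+1 A isT) Soo xoo)).
  rewrite -/c.
  have I2 : (\int[P]_w (`|S m w| `^ (p - 2) * x m.+1 w ^+ 2 + `|x m.+1 w| `^
      p)%:E
     <= (n%:R^-1)%:E * \int[P]_w (`|S m w| `^ p)%:E +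
        (r `^ (p - 2) + 1)%:E * \int[P]_w (`|x m.+1 w| `^ p)%:E)%E.
    rewrite -!ge0_integralZ_real; try by [].
    - rewrite -ge0_integralD_real.
      + apply: ge0_le_integral_any => w; rewrite lee_fin.
          by rewrite addr_ge0 ?powR_ge0// mulr_ge0 ?powR_ge0// sqr_ge0.
        rewrite mulrDl mul1r addrA lerD2r -[_ ^+ 2]real_normK ?num_real//.
        by rewrite -r2 mulrC [_^-1 * _]mulrC mulrC powR_weighted_young.
      + by apply: measurable_funM => //; exact: mpow.
      + by move=> w; rewrite mulr_ge0 ?powR_ge0// invr_ge0 ltW.
      + by apply: measurable_funM => //; exact: mpow.
      + by move=> w; rewrite mulr_ge0 ?powR_ge0// addr_ge0// powR_ge0.
    all: try exact: mpow.
    all: try by rewrite addr_ge0// powR_ge0.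
  apply: (@le_trans _ _ ((m%:R * a ^+ m * M)%:E + c%:E * ((n%:R^-1)%:E * (m%:R
      * a ^+ m * M)%:E + (r `^ (p - 2) + 1)%:E * D%:E))%E).
    apply: leeD => //; apply: lee_wpmul2l; first by rewrite lee_fin.
    apply: (le_trans I2); apply: leeD; apply: lee_wpmul2l => //.
    - by rewrite lee_fin addr_ge0// powR_ge0.
    - exact: xD.
  rewrite -!EFinM -!EFinD lee_fin.
  have -> : m%:R * a ^+ m * M + c * (n%:R^-1 * (m%:R * a ^+ m * M) + (r `^ (p -
      2) + 1) * D) =
    m%:R * a ^+ m.+1 * M + M by rewrite exprS /a /M; ring.
  rewrite -[in leRHS]natr1 !mulrDl mul1r lerD2l ler_peMl//.
  exact: exprn_ege1.
under eq_integral do rewrite -/(S n _) normrM powRM//.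
rewrite ge0_integralZ_real ?powR_ge0//; last exact: mpow.
apply: (@le_trans _ _ ((`|r^-1| `^ p)%:E * (n%:R * a ^+ n * M)%:E)%E).
  by apply: lee_wpmul2l; [rewrite lee_fin powR_ge0|exact: bound].
rewrite -EFinM lee_fin.
have an : a ^+ n <= expR c.
  have -> : expR c = expR (c / n%:R) ^+ n.
    by rewrite -expRM_natl mulrC divfK// gt_eqF.
  by apply: lerXn2r; rewrite ?nnegrE ?expR_ge0 ?expR_ge1Dx//; lra.
have Mle : M <= 2 * c * r `^ (p - 2) * D.
  have -> : 2 * c * r `^ (p - 2) * D = c * (2 * r `^ (p - 2) * D) by ring.
  rewrite /M ler_wpM2l// ler_wpM2r//.
  by rewrite -[2]/(1 + 1) mulrDl mul1r lerD2l.
apply: (@le_trans _ _ (`|r^-1| `^ p * (n%:R * expR c * (2 * c * r `^ (p - 2) *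
    D)))).
  apply: ler_wpM2l; first exact: powR_ge0.
  apply: ler_pM => //; first by rewrite mulr_ge0// exprn_ge0//; lra.
  by rewrite ler_wpM2l.
have -> : n%:R * expR c * (2 * c * r `^ (p - 2) * D) = r `^ p * (2 * c * expR c
    * D).
  by rewrite -(powR_subKr p2 (ltW r0)) r2; ring.
rewrite mulrA -powRM ?normr_ge0 ?(ltW r0)// ger0_norm ?invr_ge0 ?(ltW r0)//.
by rewrite mulVf ?gt_eqF// powR1 mul1r.
Qed.

End martingale_moment.

(** * Tail of the number of conditionally rare events *)

Section conditional_tail.
Context d (T : measurableType d) (R : realType) (P : probability T R).

(** A version of a conditional expectation that is almost surely at most c
    bounds the integral over each set of the sigma-field. *)
Lemma condexp_le (F : set (set T)) (X Y : T -> \bar R) (c : R) :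
  sub_sigma_field F -> is_condexp P F X Y -> 0 <= c ->
  {ae P, forall w, (Y w <= c%:E)%E} ->
  forall A, F A -> (\int[P]_(w in A) X w <= c%:E * P A)%E.
Proof.
move=> sF [FY XY] c0 Yc A FA; have mA := sF.2 _ FA.
have mY := measurable_wrt_fun sF FY.
rewrite -(XY _ FA) integralE.
have h : (\int[P]_(w in A) (Y^\+)%E w <= c%:E * P A)%E.
  rewrite -(integral_cst_EFin P c mA); apply: ae_ge0_le_integral => //.
  - apply: measurable_funTS; exact: measurable_funepos.
  - apply: filterS Yc => w Yw _; rewrite funeposE ge_max Yw lee_fin//.
apply: le_trans h; apply: geeDl; rewrite leeNl oppe0; apply: integral_ge0 => w
    _.
exact: funeneg_ge0.
Qed.

Lemma measurable_nat_sum_indic (C : nat -> set T) (m : nat) (r : R) :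
  (forall j, (j < m)%N -> measurable (C j)) ->
  measurable [set w | r <= (\sum_(0 <= j < m) (w \in C j))%N%:R].
Proof.
move=> mC.
have mN : measurable_fun setT (fun w => \sum_(0 <= j < m) \1_(C j) w : R).
  elim: m mC => [|m IH] mC.
    by under eq_fun do rewrite big_geq//; exact: measurable_cst.
  under eq_fun do rewrite big_nat_recr//=.
  apply: measurable_funD; last by apply: measurable_indic; apply: mC.
  by apply: IH => j jm; apply: mC; exact: ltnW.
have := mN measurableT _ (measurable_itv `[r, +oo[); rewrite setTI.
congr measurable; apply/seteqP; split=> w /=; rewrite in_itv/= andbT natr_sum//.
Qed.

(** If, given the past, each of m successive events has conditional probability
    at most 1/15, then at least half of them occur with probability at most
    2^(-m). Indeed 16^N, where N is the number of events that occur, has mean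
    at most 2^m. *)
Lemma binomial_tail (F : nat -> set (set T)) (C : nat -> set T) (m : nat) :
  (forall j, sub_sigma_field (F j)) ->
  (forall i j, (i <= j)%N -> F i `<=` F j) ->
  (forall j, (j < m)%N -> F j.+1 (C j)) ->
  (forall j A, (j < m)%N -> F j A ->
     \int[P]_(w in A) (\1_(C j) w)%:E <= (15^-1)%:E * P A)%E ->
  (P [set w | (m%:R <= 2 * (\sum_(0 <= j < m) (w \in C j))%N%:R :> R)%R] <=
   (2^-1 ^+ m)%:E)%E.
Proof.
move=> sF incF FC CF.
have mC j : (j < m)%N -> measurable (C j) by move=> jm; apply: (sF j.+1).2;
    exact: FC.
pose N l w : nat := (\sum_(0 <= j < l) (w \in C j))%N.
pose W l w : R := 16 ^+ N l w.
have W1 l w : W l.+1 w = W l w + 15 * (W l w * \1_(C l) w).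
  rewrite /W /N big_nat_recr//= exprD indicE.
  by case: (w \in C l) => /=; rewrite ?expr1 ?expr0; ring.
have W0 l w : 0 <= W l w by rewrite exprn_ge0.
have FW l : (l <= m)%N -> measurable_wrt (F l) (W l).
  elim: l => [_|l IH lm].
    apply/(measurable_wrtP _ (sF 0%N)).
    rewrite (_ : W 0%N = cst 1); first exact: measurable_cst.
    by apply/funext => w; rewrite /W /N big_geq.
  apply/(measurable_wrtP _ (sF l.+1)).
  have mW : measurable_fun (setT : set (g_sigma_algebraType (F l.+1))) (W l).
    apply/(measurable_wrtP _ (sF l.+1)).
    by apply: measurable_wrtS (IH (ltnW lm)); exact: incF.
  rewrite (_ : W l.+1 = fun w => W l w + 15 * (W l w * \1_(C l) w)); last first.
    by apply/funext => w; exact: W1.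
  apply: measurable_funD => //; apply: measurable_funM => //.
  apply: measurable_funM => //; apply: measurable_indic.
  by apply: sub_gen_smallest; exact: FC.
have EW l : (l <= m)%N -> (\int[P]_w (W l w)%:E <= (2 ^+ l)%:E)%E.
  elim: l => [_|l IH lm].
    rewrite (_ : W 0%N = cst 1); last first.
      by apply/funext => w; rewrite /W /N big_geq.
    by rewrite (integral_cst_EFin P 1 measurableT) probability_setT mule1 expr0.
  have mW := measurable_wrt_fun (sF l) (FW l (ltnW lm)).
  have mI : measurable_fun setT (\1_(C l) : T -> R).
    by apply: measurable_indic; exact: mC.
  under eq_integral do rewrite W1.
  rewrite ge0_integralD_real//; last 2 first.
  - by apply: measurable_funM => //; exact: measurable_funM.
  - by move=> w; rewrite !mulr_ge0.
  rewrite ge0_integralZ_real//; last 2 first.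
  - exact: measurable_funM.
  - by move=> w; rewrite mulr_ge0.
  have H : (\int[P]_w (W l w * \1_(C l) w)%:E <= \int[P]_w (W l w *
      15^-1)%:E)%E.
    apply: (le_integral_mul_condexp (u2 := fun=> 15^-1) (sF l)) => //.
    - exact: FW (ltnW lm).
    - by rewrite integral_cst_EFin// probability_setT mule1 ltry.
    - move=> A FA; rewrite integral_cst_EFin//; last exact: (sF l).2.
      exact: CF.
  have H2 : (\int[P]_w (W l w * 15^-1)%:E = (15^-1)%:E * \int[P]_w (W l
      w)%:E)%E.
    by rewrite -ge0_integralZ_real//; under eq_integral do rewrite mulrC.
  apply: (@le_trans _ _ (\int[P]_w (W l w)%:E + \int[P]_w (W l w)%:E)%E).
    apply: leeD2l; apply: (@le_trans _ _ (15%:E * ((15^-1)%:E * \int[P]_w (W l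
        w)%:E))%E).
      by apply: lee_wpmul2l; rewrite ?lee_fin// -H2.
    by rewrite muleA -EFinM divff// mul1e.
  apply: (@le_trans _ _ ((2 ^+ l)%:E + (2 ^+ l)%:E)%E).
    by apply: leeD; exact: IH (ltnW lm).
  by rewrite -EFinD lee_fin exprS; lra.
set A := [set w | _].
have mA : measurable A.
  rewrite (_ : A = [set w | m%:R / 2 <= (N m w)%:R :> R]); last first.
    by apply/seteqP; split=> w /=; rewrite ler_pdivrMr// mulrC.
  exact: measurable_nat_sum_indic.
have H : ((4 ^+ m)%:E * P A <= (2 ^+ m)%:E)%E.
  apply: le_trans (EW m (leqnn m)).
  apply: probability_le_integral => // w; first by rewrite lee_fin.
  rewrite /A/= -natrM ler_nat lee_fin => mN.
  rewrite /W (_ : 16 = 4 ^+ 2 :> R); last by ring.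
  by rewrite -exprM ler_eXn2l//; lra.
have : ((4^-1 ^+ m)%:E * ((4 ^+ m)%:E * P A) <= (4^-1 ^+ m)%:E * (2 ^+ m)%:E)%E.
  by apply: lee_wpmul2l => //; rewrite lee_fin exprn_ge0.
rewrite muleA -!EFinM -!exprMn mulVf// expr1n mul1e (_ : 4^-1 * 2 = 2^-1)//.
by field.
Qed.

Lemma probability_finite_union (I : eqType) (s : seq I) (A : I -> set T) (r :
    R) :
  (forall i, i \in s -> measurable (A i)) ->
  (forall i, i \in s -> (P (A i) <= r%:E)%E) ->
  measurable [set w | exists2 i, i \in s & A i w] /\
  (P [set w | exists2 i, i \in s & A i w] <= ((size s)%:R * r)%:E)%E.
Proof.
elim: s => [|i s IH] mA PA.
  rewrite (_ : mkset _ = set0); last by rewrite -subset0 => w [].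
  by rewrite measure0 mul0r.
have [mU PU] : measurable [set w | exists2 i, i \in s & A i w] /\
  (P [set w | exists2 i, i \in s & A i w] <= ((size s)%:R * r)%:E)%E.
  by apply: IH => j js; [apply: mA|apply: PA]; rewrite inE js orbT.
rewrite (_ : mkset _ = A i `|` [set w | exists2 i, i \in s & A i w]); last
    first.
  apply/seteqP; split=> w /=.
    by move=> [j]; rewrite inE => /orP[/eqP->|js] Aj; [left|right; exists j].
  by move=> [Ai|[j js Aj]]; [exists i|exists j] => //; rewrite inE ?eqxx ?js
      ?orbT.
have mAi : measurable (A i) by apply: mA; rewrite inE eqxx.
split; first exact: measurableU.
apply: (le_trans (measureU2 P mAi mU)).
rewrite -natr1 mulrDl mul1r addrC EFinD; apply: leeD => //.
by apply: PA; rewrite inE eqxx.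
Qed.

End conditional_tail.

Section nat_growth.

Lemma expn_le_exp2 (a : nat) : exists C : nat, forall m, (m ^ a <= C * 2 ^ m)%N.
Proof.
case: a => [|a]; first by exists 1%N => m; rewrite expn0 mul1n expn_gt0.
exists (a.+1 ^ a.+1)%N => m.
have h : (m <= a.+1 * 2 ^ (m %/ a.+1))%N.
  apply: leq_trans (ltnW (ltn_ceil m (ltn0Sn a))) _.
  by rewrite mulnC leq_mul2l /=; exact: ltn_expl.
apply: (@leq_trans ((a.+1 * 2 ^ (m %/ a.+1)) ^ a.+1)); first by rewrite
    leq_exp2r.
rewrite expnMn leq_mul2l -expnM leq_exp2l// leq_trunc_div orbT//.
Qed.

End nat_growth.

(** * Euclidean norm, dense sequences and smallest eigenvalue *)

Section euclidean.
Context (R : realType) (k : nat).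
Implicit Types (v u theta : 'rV[R]_k).

Lemma enorm_ge0 v : 0 <= enorm v.
Proof. exact: sqrtr_ge0. Qed.

Lemma sqr_enorm v : enorm v ^+ 2 = \sum_(i < k) v 0 i ^+ 2.
Proof. by rewrite sqr_sqrtr// sumr_ge0// => i _; exact: sqr_ge0. Qed.

Lemma enorm0 : enorm (0 : 'rV[R]_k) = 0.
Proof. by rewrite /enorm big1 ?sqrtr0// => i _; rewrite mxE expr0n. Qed.

Lemma enormZ (a : R) v : enorm (a *: v) = `|a| * enorm v.
Proof.
rewrite /enorm -sqrtr_sqr -sqrtrM ?sqr_ge0// big_distrr/=; congr Num.sqrt.
by apply: eq_bigr => i _; rewrite mxE exprMn.
Qed.

Lemma coord_le_enorm v i : `|v 0 i| <= enorm v.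
Proof.
rewrite -sqrtr_sqr ler_wsqrtr// (bigD1 i)//= lerDl sumr_ge0// => j _.
exact: sqr_ge0.
Qed.

Lemma enorm_le_sum v : enorm v <= \sum_(i < k) `|v 0 i|.
Proof.
have s0 : 0 <= \sum_(i < k) `|v 0 i| by apply: sumr_ge0.
rewrite -(ger0_norm s0) -sqrtr_sqr ler_wsqrtr// expr2 mulr_suml.
apply: ler_sum => i _; rewrite -real_normK ?num_real// expr2 ler_wpM2l//.
by rewrite (bigD1 i)//= lerDl sumr_ge0.
Qed.

Lemma enorm_gt0 v : v != 0 -> 0 < enorm v.
Proof.
move=> v0; rewrite lt0r enorm_ge0 andbT; apply: contra v0 => /eqP e0.
apply/eqP/rowP => i; rewrite mxE; apply/eqP; rewrite -normr_le0 -e0.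
exact: coord_le_enorm.
Qed.

Lemma cvg_big_sum (U : Type) (F : set_system U) {FF : Filter F} (I : eqType)
    (s : seq I) (f : I -> U -> R) (l : I -> R) :
  (forall i, i \in s -> f i y @[y --> F] --> l i) ->
  \sum_(i <- s) f i y @[y --> F] --> \sum_(i <- s) l i.
Proof.
elim: s => [|i s IH] fl.
  rewrite big_nil (_ : (fun _ => _) = cst 0); first exact: cvg_cst.
  by apply/funext => y; rewrite big_nil.
rewrite big_cons (_ : (fun _ => _) = fun y => f i y + \sum_(j <- s) f j y);
    last first.
  by apply/funext => y; rewrite big_cons.
apply: cvgD; first by apply: fl; rewrite inE eqxx.
by apply: IH => j js; apply: fl; rewrite inE js orbT.
Qed.

Lemma continuous_enorm : continuous (@enorm R k).
Proof.
move=> v; apply: (@continuous_comp _ _ _ (fun u : 'rV[R]_k => \sum_(i < k) u 0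
    i ^+ 2)
  (@Num.sqrt R)); last exact: sqrt_continuous.
apply: (@cvg_big_sum _ _ (nbhs_filter v)) => i _.
have c : (fun x : 'rV[R]_k => x 0 i) @ v --> v 0 i by exact: coord_continuous.
exact: (cvgM c c).
Qed.

Lemma nbhs_eball theta (eta : R) v : eball theta eta v -> nbhs v (eball theta
    eta).
Proof.
move=> /= vt.
have c : continuous (fun u : 'rV[R]_k => enorm (u - theta)).
  move=> u.
  have uc : (fun x => x - theta) @ u --> u - theta.
    by apply: (@cvgB _ _ _ _ (nbhs_filter u) id (cst theta)); [exact:
        cvg_id|exact: cvg_cst].
  exact: (cvg_comp _ _ uc (@continuous_enorm (u - theta))).
have := c v _ (lt_nbhsl vt); exact.
Qed.

Lemma eball_ray theta (eta s : R) v : 0 <= s -> s <= 1 -> enorm v < eta ->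
  eball theta eta (theta + s *: v).
Proof.
move=> s0 s1 ve; rewrite /eball/= addrC addKr enormZ ger0_norm//.
by apply: le_lt_trans ve; rewrite ler_piMl// enorm_ge0.
Qed.

(** Every nonempty subset D of R^k contains a sequence that is dense in D: pick
    a point of D in each cube with rational centre and side 2/(m+1) that meets
    D. *)
Lemma dense_sequence (D : set 'rV[R]_k) : D !=set0 ->
  exists x : nat -> 'rV[R]_k, (forall j, D (x j)) /\
    (forall theta U, D theta -> nbhs theta U -> exists j, U (x j)).
Proof.
move=> [x0 Dx0].
pose A (c : 'rV[rat]_k) (m : nat) := D `&`
  [set x | forall i, `|ratr (c 0 i) - x 0 i| < m.+1%:R^-1].
pose x (n : nat) : 'rV[R]_k :=
  if unpickle n is Some cm then xget x0 (A cm.1 cm.2) else x0.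
exists x; split=> [j|theta U Dt /nbhs_ballP[e e0 eU]].
  by rewrite /x; case: unpickle => // -[c m] /=; case: xgetP => // y _ [].
have [m hm] : exists m : nat, m.+1%:R^-1 < e / 2.
  exists (Num.truncn (e / 2)^-1); rewrite -[ltRHS]invrK ltf_pV2 ?posrE ?ltr0n//.
    exact: truncnS_gt.
  by rewrite invr_gt0 divr_gt0.
have cex i : exists c : rat, `|ratr c - theta 0 i| < m.+1%:R^-1.
  have m0 : 0 < m.+1%:R^-1 :> R by rewrite invr_gt0.
  set a := m.+1%:R^-1 in m0 *.
  have lt_aa : theta 0 i - a < theta 0 i + a by lra.
  have [c] := rat_in_itvoo lt_aa.
  by rewrite in_itv/= => /andP[c1 c2]; exists c; rewrite ltr_norml; lra.
pose c : 'rV[rat]_k := \row_i projT1 (cid (cex i)).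
have At : A c m theta.
  by split=> // i; rewrite mxE; case: cid.
exists (pickle (c, m)); apply: eU; rewrite /x pickleK/=.
case: xgetP => [y _ [_ yc]|]; last by move/(_ theta).
split=> // i j; rewrite ord1 /ball/=.
have yj := yc j; have tj := At.2 j; rewrite !ltr_norml in yj tj *.
case/andP: yj => y1 y2; case/andP: tj => t1 t2.
set a := m.+1%:R^-1 in hm y1 y2 t1 t2; apply/andP.
by split; lra.
Qed.

(** The supremum over an arbitrary set D of a family that is lower
    semicontinuous on D in the parameter is measurable, as it equals the
    supremum over a dense sequence of D. *)
Lemma measurable_ereal_sup d (T : measurableType d) (D : set 'rV[R]_k)
    (F : 'rV[R]_k -> T -> R) :
  (forall theta, D theta -> measurable_fun setT (F theta)) ->
  (forall w theta r, D theta -> r < F theta w ->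
     nbhs theta [set x | D x -> r < F x w]) ->
  measurable_fun setT (fun w => ereal_sup [set (F theta w)%:E | theta in D]).
Proof.
move=> mF cF; have [D0|D0] := pselect (D !=set0); last first.
  rewrite (_ : D = set0); last by rewrite -subset0 => t Dt; apply: D0; exists t.
  by under eq_fun do rewrite image_set0; exact: measurable_cst.
have [x [Dx xd]] := dense_sequence D0.
rewrite (_ : (fun _ => _) = fun w => esups (fun j => (F (x j) w)%:E) 0%N); last
    first.
  apply/funext => w; apply/eqP; rewrite eq_le; apply/andP; split; last first.
    by apply: ereal_sup_le => _ [j _ <-]; exists (x j).
  apply: ge_ereal_sup => _ [t Dt <-].
  have ub j : ((F (x j) w)%:E <= esups (fun j => (F (x j) w)%:E) 0%N)%E.
    by apply: ereal_sup_ubound; exists j.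
  rewrite leNgt; apply/negP; case: esups ub => [r| |] ub.
  - rewrite lte_fin => rt.
    have [j jr] := xd _ _ Dt (cF w t r Dt rt).
    have := ub j; rewrite lee_fin leNgt => /negP; apply.
    exact: (jr (Dx j)).
  - by rewrite ltNge leey.
  - by have := ub 0%N; rewrite leeNy_eq.
by apply: measurable_fun_esups => j; apply/measurable_EFinP; exact: mF.
Qed.

End euclidean.

Section smallest_eigenvalue.
Context (R : realType) (k : nat).
Implicit Types (L : 'M[R]_k) (v u : 'rV[R]_k).

(** The quadratic form v L v^T on row vectors. *)
Definition quad_form L v := (v *m L *m v^T) 0 0.

Lemma quad_formE L v : quad_form L v = \sum_i \sum_j v 0 i * L i j * v 0 j.
Proof.
rewrite /quad_form !mxE exchange_big/=; apply: eq_bigr => j _.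
by rewrite !mxE big_distrl.
Qed.

Lemma continuous_quad_form L : continuous (quad_form L).
Proof.
rewrite (_ : quad_form L = fun v => \sum_i \sum_j v 0 i * L i j * v 0 j); last
    first.
  by apply/funext => v; exact: quad_formE.
move=> v; apply: (@cvg_big_sum _ _ _ (nbhs_filter v)) => i _.
apply: (@cvg_big_sum _ _ _ (nbhs_filter v)) => j _.
have c l : (fun x : 'rV[R]_k => x 0 l) @ v --> v 0 l by exact: coord_continuous.
exact: (cvgM (cvgM (c i) (cvg_cst (L i j))) (c j)).
Qed.

Lemma quad_formZ L (a : R) v : quad_form L (a *: v) = a ^+ 2 * quad_form L v.
Proof.
by rewrite /quad_form linearZ/= -scalemxAr -!scalemxAl !mxE mulrA.
Qed.

Lemma mulmx_tr_sqr v : (v *m v^T) 0 0 = \sum_i v 0 i ^+ 2.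
Proof. by rewrite !mxE; apply: eq_bigr => i _; rewrite mxE expr2. Qed.

(** A minimizer v of the quadratic form over the unit sphere is an eigenvector:
    with mu the minimum, the form of N = L - mu is nonnegative and vanishes at
    v, so its first variation in the direction v N vanishes. *)
Lemma exists_min_eigenvector L : (0 < k)%N -> L^T = L ->
  exists v (mu : R), [/\ v != 0, v *m L = mu *: v &
    forall u, mu * enorm u ^+ 2 <= quad_form L u].
Proof.
move=> k0 symL.
pose S := [set v : 'rV[R]_k | enorm v = 1].
have cS : compact S.
  apply: bounded_closed_compact.
    exists 1; split=> // M M1 v vS; apply: ltW; apply: le_lt_trans M1.
    rewrite -[`|v|]/(mx_norm v) mx_normrE; apply/bigmax_leP; split=> // -[i j]
        _ /=.
    by rewrite ord1 -vS; exact: coord_le_enorm.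
  rewrite (_ : S = @enorm R k @^-1` [set 1])//.
  apply: closed_comp => [v _|]; [exact: continuous_enorm|exact: closed_eq].
have S0 : S !=set0.
  exists (delta_mx 0 (Ordinal k0)); rewrite /S/= /enorm (bigD1 (Ordinal k0))//=.
  rewrite big1 ?addr0; last by move=> i ne; rewrite mxE (negbTE ne) andbF
      expr0n.
  by rewrite mxE !eqxx expr1n sqrtr1.
have [v vS vmin] := compact_EVT_min S0 cS
  (continuous_subspaceT (@continuous_quad_form L)).
have v1 : enorm v = 1 by move: vS; rewrite inE.
pose mu : R := quad_form L v; exists v, mu.
have v0 : v != 0 by apply/eqP => v0; move: v1; rewrite v0 enorm0 => /esym/eqP;
    rewrite oner_eq0.
have mumin u : mu * enorm u ^+ 2 <= quad_form L u.
  have [->|u0] := eqVneq u 0.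
    rewrite enorm0 expr0n/= mulr0 /quad_form mul0mx mul0mx mxE//.
  have ug := enorm_gt0 u0.
  have -> : quad_form L u = enorm u ^+ 2 * quad_form L ((enorm u)^-1 *: u).
    by rewrite quad_formZ mulrA -exprMn divff ?gt_eqF// expr1n mul1r.
  rewrite mulrC ler_wpM2l ?sqr_ge0// vmin// inE /S/= enormZ ger0_norm ?invr_ge0
      ?enorm_ge0//.
  by rewrite mulVf// gt_eqF.
split=> //.
have [N defN] : exists N, N = L - mu%:M by exists (L - mu%:M).
have symN : N^T = N by rewrite defN linearB/= tr_scalar_mx symL.
have qN u : quad_form N u = quad_form L u - mu * enorm u ^+ 2.
  by rewrite /quad_form defN mulmxBr mulmxBl mul_mx_scalar -scalemxAl !mxE
      sqr_enorm -mulmx_tr_sqr mxE.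
have qN0 u : 0 <= quad_form N u by rewrite qN subr_ge0.
have qNv : quad_form N v = 0 by rewrite qN v1 expr1n mulr1 subrr.
pose z := v *m N; pose c : R := quad_form N z; pose e : R := enorm z ^+ 2.
(* expansion of the form of N at v + s z, with z = v N *)
have quad s : 0 <= 2 * s * e + s ^+ 2 * c.
  have zv : z *m N *m v^T = z *m z^T.
    by rewrite /z trmx_mul symN mulmxA.
  have -> : 2 * s * e + s ^+ 2 * c = quad_form N (v + s *: z); last exact: qN0.
  have eE : e = (z *m z^T) 0 0 by rewrite mulmx_tr_sqr /e sqr_enorm.
  have trE : (v + s *: z)^T = v^T + s *: z^T by rewrite linearD/= linearZ.
  have vv : (z *m v^T) 0 0 = 0 by rewrite -[RHS]qNv.
  rewrite eE /c /quad_form trE !(mulmxDl, mulmxDr) -!(scalemxAl, scalemxAr) -/z.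
  rewrite zv.
  move: vv; move: (z *m v^T) (z *m z^T) (z *m N *m z^T) => A B C A0.
  by rewrite ![in RHS]mxE A0; ring.
have e0 : 0 <= e by exact: sqr_ge0.
have : e = 0.
  apply/eqP; rewrite eq_le e0 andbT leNgt; apply/negP => e_gt0.
  have cg : 0 <= c by exact: qN0.
  have c1 : 0 < 1 + c by rewrite ltr_wpDr.
  have := quad (- (e / (1 + c))).
  have -> : 2 * - (e / (1 + c)) * e + (- (e / (1 + c))) ^+ 2 * c
     = - ((e ^+ 2 / (1 + c) ^+ 2) * (2 + c)) by field; rewrite gt_eqF.
  have pos2 : 0 < e ^+ 2 / (1 + c) ^+ 2 * (2 + c).
    have c2 : 0 < 2 + c by rewrite ltr_wpDr.
    by apply: mulr_gt0 => //; apply: divr_gt0; exact: exprn_gt0.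
  by rewrite oppr_ge0 leNgt pos2.
rewrite /e => /eqP; rewrite sqrf_eq0 => /eqP z0.
have : z = 0 by apply/eqP; apply/negPn/negP => /enorm_gt0; rewrite z0 ltxx.
rewrite /z defN mulmxBr mul_mx_scalar => /eqP; rewrite subr_eq0 => /eqP//.
Qed.

(** The infimum of the spectrum of a symmetric matrix is the minimum of its
    Rayleigh quotient. *)
Lemma lambda_minP L : (0 < k)%N -> L^T = L ->
  (forall u, lambda_min L * enorm u ^+ 2 <= quad_form L u) /\
  (exists2 v, v != 0 & quad_form L v = lambda_min L * enorm v ^+ 2).
Proof.
move=> k0 symL; have [v [mu [v0 vL mumin]]] := exists_min_eigenvector k0 symL.
have Lmu : eigenvalue L mu by apply/eigenvalueP; exists v.
have vq u a : u *m L = a *: u -> quad_form L u = a * enorm u ^+ 2.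
  by move=> uL; rewrite /quad_form uL -scalemxAl mxE mulmx_tr_sqr sqr_enorm.
have lb a : eigenvalue L a -> mu <= a.
  move=> /eigenvalueP[u uL u0]; have := mumin u; rewrite (vq _ _ uL).
  by rewrite ler_pM2r// exprn_gt0// enorm_gt0.
suff -> : lambda_min L = mu by split=> //; exists v => //; exact: vq.
apply/eqP; rewrite eq_le; apply/andP; split.
  by apply: ge_inf => //; exists mu => a; exact: lb.
by apply: lb_le_inf; [exists mu|move=> a; exact: lb].
Qed.

End smallest_eigenvalue.

(** * Almost sure Lipschitz bounds, rare small values and grids *)

Section uniform_lower_bound.
Context d (T : measurableType d) (R : realType) (P : probability T R) (k : nat).
Implicit Types (xi x y : 'rV[R]_k) (Theta : set 'rV[R]_k).

(** A Lipschitz bound with respect to a fixed point y extends by continuity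
    from a dense sequence of Theta to Theta. *)
Lemma lipschitz_dense Theta (z : nat -> 'rV[R]_k) (g : 'rV[R]_k -> R) y
    (c B tau : R) :
  (forall j, Theta (z j)) ->
  (forall xi U, Theta xi -> nbhs xi U -> exists j, U (z j)) ->
  (forall xi, Theta xi -> g x @[x --> within Theta (nbhs xi)] --> g xi) ->
  (forall j, enorm (z j - y) < tau -> `|g (z j) - c| <= B * enorm (z j - y)) ->
  forall xi, Theta xi -> enorm (xi - y) < tau ->
    `|g xi - c| <= B * enorm (xi - y).
Proof.
move=> Tz zd cg gz xi Txi xit; rewrite leNgt; apply/negP => bad.
have ce : (fun x => enorm (x - y)) @ xi --> enorm (xi - y).
  have uc : (fun x => x - y) @ xi --> xi - y.
    by apply: (@cvgB _ _ _ _ (nbhs_filter xi) id (cst y)); [exact: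
        cvg_id|exact: cvg_cst].
  exact: (cvg_comp _ _ uc (@continuous_enorm R k (xi - y))).
have ce' : enorm (x - y) @[x --> within Theta (nbhs xi)] --> enorm (xi - y).
  exact: cvg_within_filter.
have n1 : nbhs xi [set x | enorm (x - y) < tau] := ce _ (lt_nbhsl xit).
have ch : `|g x - c| - B * enorm (x - y) @[x --> within Theta (nbhs xi)] -->
    `|g xi - c| - B * enorm (xi - y).
  apply: (@cvgB _ _ _ _ _ (fun x => `|g x - c|) (fun x => B * enorm (x - y))).
    apply: cvg_norm; apply: (@cvgB _ _ _ _ _ g (cst c)); first exact: cg.
    exact: cvg_cst.
  by apply: (@cvgM _ _ _ _ (cst B) (fun x => enorm (x - y))) => //; exact:
      cvg_cst.
have pos : 0 < `|g xi - c| - B * enorm (xi - y) by rewrite subr_gt0.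
have n2 : nbhs xi [set x | Theta x -> 0 < `|g x - c| - B * enorm (x - y)] :=
  ch _ (lt_nbhsr pos).
have [j [j1 j2]] := zd _ _ Txi (filterI n1 n2).
have := gz j j1; rewrite leNgt => /negP; apply.
by rewrite -subr_gt0; exact: (j2 (Tz j)).
Qed.

(** The exceptional null sets of the Lipschitz bounds for the pairs of
    parameters are merged into one by restricting to pairs taken from a dense
    sequence. *)
Lemma ae_lipschitz Theta (f : nat -> 'rV[R]_k -> T -> R) (B : nat -> T -> R)
    (tau : R) :
  (forall t w xi, (0 < t)%N -> Theta xi ->
     f t x w @[x --> within Theta (nbhs xi)] --> f t xi w) ->
  (forall t x y, (0 < t)%N -> Theta x -> Theta y -> enorm (x - y) < tau ->
     {ae P, forall w, `|f t x w - f t y w| <= B t w * enorm (x - y)}) ->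
  {ae P, forall w, forall t x y, (0 < t)%N -> Theta x -> Theta y ->
     enorm (x - y) < tau -> `|f t x w - f t y w| <= B t w * enorm (x - y)}.
Proof.
move=> cf lf; have [T0|T0] := pselect (Theta !=set0); last first.
  by apply: aeW => w t x y _ Tx; exfalso; apply: T0; exists x.
have [z [Tz zd]] := dense_sequence T0.
have H : {ae P, forall w, forall t i j, (0 < t)%N -> enorm (z i - z j) < tau ->
    `|f t (z i) w - f t (z j) w| <= B t w * enorm (z i - z j)}.
  apply: ae_foralln => t; apply: ae_foralln => i; apply: ae_foralln => j.
  have [t0|t0] := ltnP 0 t; last exact: aeW.
  have [ij|ij] := ltP (enorm (z i - z j)) tau; last exact: aeW.
  by apply: filterS (lf t _ _ t0 (Tz i) (Tz j) ij) => w h _ _.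
apply: filterS H => w H t x y t0 Tx Ty.
have enormB (u v : 'rV[R]_k) : enorm (u - v) = enorm (v - u).
  by rewrite -opprB -scaleN1r enormZ normrN1 mul1r.
apply: (lipschitz_dense (g := f t ^~ w) Tz zd _ _ Tx) => [xi Txi|i]; first
    exact: cf.
rewrite enormB distrC.
apply: (lipschitz_dense (g := f t ^~ w) Tz zd _ _ Ty) => [xi Txi|j]; first
    exact: cf.
by rewrite enormB distrC; exact: H.
Qed.

(** Along the times (j+1) lag + 1, which are separated by lag, the events that
    h_t lies in ]-s, s] have conditional probability at most 1/15 given the
    previous ones. *)
Lemma small_value_tail (G : nat -> set (set T)) (h : nat -> T -> R)
    (lag m : nat) (s : R) :
  increasing_sigma_fields G -> (0 < lag)%N ->
  (forall t, (0 < t)%N -> measurable_wrt (G t.-1) (h t)) ->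
  (forall t, (lag < t)%N -> exists2 Y : T -> \bar R,
     is_condprob P (G (t - lag).-1) [set w | - s < h t w <= s] Y &
     {ae P, forall w, (Y w <= (15^-1)%:E)%E}) ->
  (P [set w | (m%:R <= 2 * (\sum_(0 <= j < m)
       (w \in [set w | (- s < h (j.+1 * lag).+1 w <= s)%R]))%N%:R :> R)%R] <=
   (2^-1 ^+ m)%:E)%E.
Proof.
move=> [sG incG] lag0 mh hY.
apply: (@binomial_tail _ _ _ _ (fun j => G (j * lag)%N)) => //.
- by move=> i j ij; apply: incG; rewrite leq_mul2r ij orbT.
- move=> j jm; rewrite (_ : mkset _ = h (j.+1 * lag).+1 @^-1` `]- s,
    s]%classic).
    exact: (mh (j.+1 * lag).+1 isT _ (measurable_itv _)).
  by apply/seteqP; split=> w /=; rewrite in_itv.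
- move=> j A jm GA.
  have [|Y hYc Y15] := hY (j.+1 * lag).+1.
    by rewrite ltnS mulSn leq_addr.
  apply: (condexp_le _ hYc) => //.
  by rewrite mulSn -addnS addKn.
Qed.

Lemma subsequence_sum_le (a : nat -> R) (lag m n : nat) :
  (forall t, 0 <= a t) -> (0 < lag)%N -> (m * lag < n)%N ->
  \sum_(0 <= j < m) a (j.+1 * lag).+1 <= \sum_(1 <= t < n.+1) a t.
Proof.
move=> a0 lag0; elim: m n => [|m IH] n mn.
  by rewrite big_geq// sumr_ge0.
rewrite big_nat_recr//=.
have mn' : (m * lag < (m.+1 * lag))%N by rewrite ltn_mul2r lag0/=.
rewrite (@big_cat_nat _ _ _ (m.+1 * lag).+1 1 n.+1)//=; last exact: leqW.
apply: lerD; first exact: IH.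
by rewrite big_ltn// lerDl sumr_ge0.
Qed.

(** A subset of the cube of side 2 b is covered by (2 b N + 1)^k balls of
    radius k/N centred in the subset: choose a point in each cell of side 1/N
    that meets it. *)
Lemma exists_cell_cover Theta (b N : nat) :
  (forall xi i, Theta xi -> `|xi 0 i| <= b%:R) -> (0 < N)%N -> Theta !=set0 ->
  exists s : seq 'rV[R]_k, [/\ size s = ((2 * b * N).+1 ^ k)%N,
    forall x, x \in s -> Theta x &
    forall xi, Theta xi -> exists2 x, x \in s & enorm (xi - x) <= k%:R / N%:R].
Proof.
move=> Tb N0 [x0 Tx0].
have NR : 0 < N%:R :> R by rewrite ltr0n.
pose cell (x : 'rV[R]_k) i := Num.truncn ((x 0 i + b%:R) * N%:R).
pose rep (c : {ffun 'I_k -> 'I_(2 * b * N).+1}) : 'rV[R]_k :=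
  xget x0 (Theta `&` [set x | forall i, cell x i = c i]).
exists [seq rep c | c <- enum {: {ffun 'I_k -> 'I_(2 * b * N).+1}}]; split.
- by rewrite size_map -cardE card_ffun !card_ord.
- by move=> x /mapP[c _ ->]; rewrite /rep; case: xgetP => // y _ [].
move=> xi Txi.
have pos x i : Theta x -> 0 <= (x 0 i + b%:R) * N%:R.
  move=> Tx; rewrite mulr_ge0 ?ler0n//.
  by have := Tb _ i Tx; rewrite ler_norml => /andP[]; lra.
have cellP x i : Theta x ->
    (cell x i)%:R <= (x 0 i + b%:R) * N%:R < (cell x i).+1%:R.
  by move=> Tx; exact: truncn_itv (pos _ _ Tx).
have cb x i : Theta x -> (cell x i < (2 * b * N).+1)%N.
  move=> Tx; rewrite ltnS -(ler_nat R).
  have /andP[+ _] := cellP x i Tx; move=> /le_trans; apply.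
  rewrite !natrM ler_wpM2r ?ler0n//.
  by have := Tb _ i Tx; rewrite ler_norml => /andP[]; lra.
pose c : {ffun 'I_k -> 'I_(2 * b * N).+1} := [ffun i => inord (cell xi i)].
exists (rep c); first by apply/mapP; exists c => //; rewrite mem_enum.
have cE i : cell xi i = c i by rewrite ffunE inordK// cb.
rewrite /rep; case: xgetP => [x _ [Tx xc]|nx]; last by case: (nx xi); split=>
    // i; exact: cE.
apply: (le_trans (enorm_le_sum _)).
apply: (@le_trans _ _ (\sum_(i < k) N%:R^-1)); last first.
  by rewrite sumr_const card_ord -[leLHS]mulr_natl lexx.
apply: ler_sum => i _; rewrite !mxE.
have e : cell xi i = cell x i by rewrite cE xc.
have /andP[h1 h2] := cellP xi i Txi; have /andP[h3 h4] := cellP x i Tx.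
rewrite e in h1 h2.
rewrite -natr1 in h2 h4.
rewrite -[leRHS]mul1r ler_pdivlMr// -[X in _ * X](ger0_norm (ltW NR)) -normrM.
rewrite ler_norml; apply/andP; nra.
Qed.

End uniform_lower_bound.

(** * Uniform lower bound for the mean square of a regular triple *)

Section regular_lower_bound.
Context d (T : measurableType d) (R : realType) (P : probability T R) (k : nat).

Lemma enorm_const1 (x : R) : enorm (const_mx x : 'rV[R]_1) = `|x|.
Proof. by rewrite /enorm big_ord1 mxE sqrtr_sqr. Qed.

(** The number of times spaced by lag is at least n/(2 lag). *)
Lemma leq_double_div (lag n : nat) : (0 < lag)%N -> (lag < n)%N ->
  (n <= 2 * lag * (n.-1 %/ lag))%N.
Proof.
move=> lag0 ln; have m1 : (0 < n.-1 %/ lag)%N by rewrite divn_gt0//; lia.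
have := ltn_ceil n.-1 lag0; nia.
Qed.

Lemma sqr_ge_quarter (s u v : R) : 0 < s -> v <= - s \/ s <= v ->
  - (s / 2) <= u - v -> u - v <= s / 2 -> s ^+ 2 / 4 <= u ^+ 2.
Proof. by move=> s0 [h|h] d1 d2; nra. Qed.

Lemma half_count_le (c m N : R) : 0 <= c -> N * 2 <= m ->
  c / 8 * m <= c / 4 * (m - N).
Proof. by move=> c0 Nm; have := ler_wpM2l c0 Nm; lra. Qed.

Lemma le_quarter_level (c n lag m : R) : 0 <= c -> n <= 2 * lag * m ->
  c * n <= c / 8 * m * (16 * lag).
Proof. by move=> c0 nm; have := ler_wpM2l c0 nm; lra. Qed.

(** Exponential decay beats any power of n. *)
Lemma expn_half_decay (lag a : nat) : (0 < lag)%N ->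
  exists C : R, 0 <= C /\ forall n, (lag < n)%N ->
    n%:R ^+ a * 2^-1 ^+ (n.-1 %/ lag) <= C.
Proof.
move=> lag0; have [C hC] := expn_le_exp2 a.
exists ((2 * lag) ^ a * C)%N%:R; split=> // n ln.
set m := (n.-1 %/ lag)%N.
have nm : (n <= 2 * lag * m)%N by exact: leq_double_div.
rewrite exprVn ler_pdivrMr ?exprn_gt0// -!natrX -natrM ler_nat.
apply: (@leq_trans ((2 * lag * m) ^ a)); last first.
  by rewrite expnMn -mulnA leq_mul2l hC orbT.
by have [->//|a0] := posnP a; rewrite leq_exp2r.
Qed.

(** For a regular triple of scalar functions on a bounded set, the mean square
    is bounded below by a constant, uniformly in the parameter, outside an
    event of probability O(n^(-Q)), for any prescribed Q. *)
Lemma regular_mean_square_lower_bound (G : nat -> set (set T))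
    (f : nat -> 'rV[R]_k -> T -> R) (Theta : set 'rV[R]_k) (b Q : nat) :
  increasing_sigma_fields G ->
  (forall t xi, (0 < t)%N -> Theta xi -> measurable_wrt (G t.-1) (f t xi)) ->
  (forall t w xi, (0 < t)%N -> Theta xi ->
     f t x w @[x --> within Theta (nbhs xi)] --> f t xi w) ->
  (forall xi i, Theta xi -> `|xi 0 i| <= b%:R) ->
  regular P Theta (fun t theta w => const_mx (f t theta w) : 'rV[R]_1)
    (fun t => G t.-1) ->
  exists c C : R, 0 < c /\ exists n0, forall n, (n0 <= n)%N ->
    exists E, [/\ measurable E, (P E <= (C / n%:R ^+ Q)%:E)%E &
      forall w xi, ~ E w -> Theta xi ->
        c <= n%:R^-1 * \sum_(1 <= t < n.+1) f t xi w ^+ 2].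
Proof.
move=> Ginc Gf cf Tb [[lag [delta [alpha [M [[lag0 delta0 alpha0 M0] small]]]]]
  [tau [C1 [B [tau0 C10 B0 EB lip]]]] _].
have [T0|T0] := pselect (Theta !=set0); last first.
  exists 1, 0; split=> //; exists 0%N => n _; exists set0; split=> //.
    by rewrite measure0 mul0r.
  by move=> w xi _ Txi; exfalso; apply: T0; exists xi.
have [sG incG] := Ginc.
(* values of f in ]-s, s] count as small; s is such that they have conditional
   probability at most 1/15 *)
pose kap := (15 * M)^-1.
have kap0 : 0 < kap by rewrite invr_gt0 mulr_gt0.
pose s := Num.min delta (kap `^ (alpha^-1)) / 2.
have s0 : 0 < s by rewrite divr_gt0// lt_min delta0 powR_gt0.
have s2 : s - - s = Num.min delta (kap `^ alpha^-1) by rewrite /s; lra.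
have Ms : M * (s - - s) `^ alpha <= 15^-1.
  apply: (@le_trans _ _ (M * kap)); last by rewrite /kap invfM mulrCA divff
      ?gt_eqF ?mulr1.
  rewrite ler_wpM2l ?(ltW M0)//.
  have -> : kap = (kap `^ alpha^-1) `^ alpha.
    by rewrite -powRrM mulVf ?gt_eqF// powRr1// ltW.
  apply: ge0_ler_powR; rewrite ?nnegrE ?powR_ge0 ?(ltW alpha0)//.
    by rewrite s2 le_min (ltW delta0) powR_ge0.
  by rewrite s2 ge_min lexx orbT.
clearbody s.
have tail xi m : Theta xi -> (P [set w | (m%:R <= 2 * (\sum_(0 <= j < m)
       (w \in [set w | (- s < f (j.+1 * lag).+1 xi w <= s)%R]))%N%:R :> R)%R] <=
   (2^-1 ^+ m)%:E)%E.
  move=> Txi; apply: (small_value_tail (h := fun t => f t xi) _ Ginc lag0).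
    by move=> t t0; exact: Gf.
  move=> t lt; have [] := small t (- s) s xi (const_mx 1) lt _ Txi.
  - by rewrite s2 lt_min delta0 powR_gt0//= ge_min lexx.
  - by rewrite enorm_const1 normr1.
  move=> Y; rewrite (_ : mkset _ = [set w | - s < f t xi w <= s]); last first.
    by apply/seteqP; split=> w /=; rewrite big_ord1 !mxE mul1r.
  move=> YC Yle; exists Y => //; apply: filterS Yle => w /le_trans; apply.
  by rewrite lee_fin.
have mtail xi m : Theta xi -> measurable [set w | (m%:R <= 2 * (\sum_(0 <= j <
    m)
       (w \in [set w | (- s < f (j.+1 * lag).+1 xi w <= s)%R]))%N%:R :> R)%R].
  move=> Txi; rewrite (_ : mkset _ = [set w | m%:R / 2 <= (\sum_(0 <= j < m)
       (w \in [set w | (- s < f (j.+1 * lag).+1 xi w <= s)%R]))%N%:R :> R]);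
           last first.
    by apply/seteqP; split=> w /=; rewrite ler_pdivrMr// mulrC.
  apply: measurable_nat_sum_indic => j _.
  rewrite (_ : mkset _ = f (j.+1 * lag).+1 xi @^-1` `]- s, s]%classic).
    by apply: (sG _).2; exact: (Gf (j.+1 * lag).+1 xi isT Txi).
  by apply/seteqP; split=> w /=; rewrite in_itv.
have [N0 [mN0 PN0 Nlip]] : {ae P, forall w, forall t x y, (0 < t)%N -> Theta x
    -> Theta y ->
     enorm (x - y) < tau -> `|f t x w - f t y w| <= B t w * enorm (x - y)}.
  apply: (ae_lipschitz (B := fun t => B t)) => // t x y t0 Tx Ty xy.
  apply: filterS (lip t x y t0 Tx Ty xy) => w.
  by rewrite (_ : _ - _ = const_mx (f t x w - f t y w)) ?enorm_const1//;
    apply/rowP => i; rewrite !mxE.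
(* the mesh is n^(-L); the loss of one power comes from the n Lipschitz
   constants up to time n *)
pose L := Q.+1.
pose eta : R := s / (2 * k.+1%:R).
have eta0 : 0 < eta by rewrite divr_gt0// mulr_gt0.
have etaE : eta = s / (2 * k.+1%:R) by [].
clearbody eta.
have [C2 [C20 decay]] := expn_half_decay (L * k + Q) lag0.
pose C3 : R := (2 * b).+1%:R ^+ k * C2 + C1 / eta.
have lagR : 0 < lag%:R :> R by rewrite ltr0n.
exists (s ^+ 2 / (16 * lag%:R)), C3; split.
  by rewrite divr_gt0 ?exprn_gt0// mulr_gt0.
pose n1 := (Num.truncn (k.+1%:R / tau)).+1.
(* n is large enough for the mesh to be below tau and to exceed the lag *)
exists (maxn n1 lag.+1) => n; rewrite geq_max => /andP[n1n lagn].
have n0 : (0 < n)%N by exact: leq_trans lagn.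
have nR : 0 < n%:R :> R by rewrite ltr0n.
have nLR : 0 < n%:R ^+ L :> R by rewrite exprn_gt0.
have nL0 : (0 < n ^ L)%N by rewrite expn_gt0 n0.
have [cells [sz cellT cellC]] := exists_cell_cover Tb nL0 T0.
have knL : k%:R / (n ^ L)%N%:R < tau.
  rewrite ltr_pdivrMr; last by rewrite ltr0n.
  have : k.+1%:R / tau < n%:R.
    by apply: (lt_le_trans (truncnS_gt _)); rewrite ler_nat.
  rewrite ltr_pdivrMr// mulrC => h.
  apply: lt_le_trans (le_lt_trans _ h) _; first by rewrite ler_nat.
  by rewrite ler_wpM2l ?(ltW tau0)// ler_nat -[X in (X <= _)%N]expn1 leq_pexp2l.
pose m := (n.-1 %/ lag)%N.
(* A1: at some point of the grid, at least half of the values are small *)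
pose A1 := [set w | exists2 x, x \in cells & [set w | (m%:R <= 2 * (\sum_(0 <=
    j < m)
       (w \in [set w | (- s < f (j.+1 * lag).+1 x w <= s)%R]))%N%:R :> R)%R] w].
pose SB w := \sum_(1 <= t < n.+1) B t w.
have mSB : measurable_fun setT SB by apply: measurable_sum_nat => t _.
(* A2: the sum of the Lipschitz constants is too large for the mesh *)
pose A2 := [set w | eta * n%:R ^+ L <= SB w].
have mA2 : measurable A2.
  have := mSB measurableT _ (measurable_itv `[eta * n%:R ^+ L, +oo[); rewrite
      setTI.
  by congr measurable; apply/seteqP; split=> w /=; rewrite in_itv/= andbT.
have [mA1 PA1] : measurable A1 /\ (P A1 <= ((size cells)%:R * 2^-1 ^+ m)%:E)%E.
  apply: probability_finite_union => x xc; first by apply: mtail; exact: cellT.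
  by apply: tail; exact: cellT.
have SB0 w : 0 <= SB w.
  by rewrite /SB big_nat_cond sumr_ge0// => t /andP[/andP[t0 _] _]; exact: B0.
have ESB : (\int[P]_w (SB w)%:E <= (n%:R * C1)%:E)%E.
  rewrite /SB; under eq_integral do rewrite -sumEFin.
  elim: n {n1n lagn n0 nR nLR nL0 cells sz cellT cellC knL m A1 SB mSB A2 mA2
      mA1 PA1 SB0} => [|n IH].
    by under eq_integral do rewrite big_geq//; rewrite integral0 mul0r.
  under eq_integral do rewrite big_nat_recr//=.
  rewrite ge0_integralD//; last 4 first.
  - move=> w _; rewrite sumEFin lee_fin big_nat_cond sumr_ge0// => t.
    by move=> /andP[/andP[t0 _] _]; exact: B0.
  - under eq_fun do rewrite sumEFin; apply/measurable_EFinP.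
    by apply: measurable_sum_nat => t _.
  - by move=> w _; rewrite lee_fin B0.
  - exact/measurable_EFinP.
  rewrite -natr1 mulrDl mul1r EFinD; apply: leeD => //.
  apply: le_trans EB; apply: ereal_sup_ubound; exists n.+1 => //.
  by rewrite unlock.
have PA2 : (P A2 <= (C1 / eta / n%:R ^+ Q)%:E)%E.
  have H : ((eta * n%:R ^+ L)%:E * P A2 <= (n%:R * C1)%:E)%E.
    apply: le_trans ESB; apply: probability_le_integral => //.
    by rewrite mulr_ge0 ?ltW.
  rewrite -(@lee_pmul2l _ (eta * n%:R ^+ L)%:E) ?lte_fin ?mulr_gt0//.
  rewrite (le_trans H)// -EFinM lee_fin /L exprS.
  rewrite le_eqVlt; apply/orP; left; apply/eqP; field.
  by rewrite !gt_eqF ?exprn_gt0.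
exists (N0 `|` (A1 `|` A2)); split.
- by apply: measurableU => //; exact: measurableU.
- apply: (@le_trans _ _ (P N0 + P (A1 `|` A2))%E).
    exact: (measureU2 P mN0 (measurableU _ _ mA1 mA2)).
  rewrite PN0 add0e; apply: (le_trans (measureU2 P mA1 mA2)).
  rewrite /C3 mulrDl EFinD; apply: leeD => //.
  apply: (le_trans PA1); rewrite lee_fin sz.
  rewrite ler_pdivlMr ?exprn_gt0//.
  apply: (@le_trans _ _ (((2 * b).+1%:R * n%:R ^+ L) ^+ k * 2^-1 ^+ m * n%:R ^+
      Q)).
    rewrite ler_wpM2r ?exprn_ge0// ler_wpM2r ?exprn_ge0// natrX lerXn2r ?nnegrE
        ?mulr_ge0//.
    by rewrite -natrX -natrM ler_nat mulSn -[X in (X <= _)%N]add1n leq_add2r.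
  have -> : ((2 * b).+1%:R * n%:R ^+ L) ^+ k * 2^-1 ^+ m * n%:R ^+ Q =
    (2 * b).+1%:R ^+ k * (n%:R ^+ (L * k + Q) * 2^-1 ^+ m) :> R.
    by rewrite exprMn exprD exprM; ring.
  by rewrite ler_wpM2l ?exprn_ge0//; exact: decay.
move=> w xi /not_orP[nN /not_orP[nA1 nA2]] Txi.
have [x xc xix] := cellC _ Txi.
have Tx := cellT _ xc.
have lipw : forall t x y, (0 < t)%N -> Theta x -> Theta y ->
     enorm (x - y) < tau -> `|f t x w - f t y w| <= B t w * enorm (x - y).
  by apply: contrapT => nl; apply: nN; exact: Nlip.
have dev t : (0 < t <= n)%N -> `|f t xi w - f t x w| <= s / 2.
  move=> /andP[t0 tn]; apply: (le_trans (lipw t _ _ t0 Txi Tx (le_lt_trans xix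
      knL))).
  have BS : B t w <= eta * n%:R ^+ L.
    apply: (@le_trans _ _ (SB w)); last by move/negP : nA2; rewrite -ltNge =>
        /ltW.
    rewrite /SB (@big_cat_nat _ _ _ t 1 n.+1)//=; last exact: leqW.
    rewrite [X in _ + X]big_ltn//.
    rewrite addrCA lerDl addr_ge0// big_nat_cond sumr_ge0// => t'.
      by move=> /andP[/andP[t0' _] _]; exact: B0.
    by move=> /andP[/andP[t0' _] _]; apply: B0; exact: leq_trans t0'.
  apply: (le_trans (ler_pM (B0 t w t0) (enorm_ge0 _) BS xix)).
  rewrite natrX (_ : eta * _ * _ = s / 2 * (k%:R / k.+1%:R)); last first.
    by rewrite etaE; field; rewrite ?gt_eqF.
  rewrite ler_piMr ?divr_ge0 ?(ltW s0)// ler_pdivrMr// mul1r ler_nat//.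
have mlag : (m * lag < n)%N.
  by rewrite (leq_ltn_trans (leq_trunc_div _ _))// ltn_predL.
have big j : (j < m)%N -> s ^+ 2 / 4 * (1 - (w \in [set w | (- s < f (j.+1 *
    lag).+1 x w <= s)%R])%:R)
    <= f (j.+1 * lag).+1 xi w ^+ 2.
  move=> jm; case: (boolP (w \in _)) => [_|].
    by rewrite subrr mulr0 sqr_ge0.
  rewrite subr0 mulr1 notin_setE/= => /negP nf.
  have tj : (0 < (j.+1 * lag).+1 <= n)%N.
    by apply: leq_ltn_trans mlag; rewrite leq_mul2r jm orbT.
  have := dev _ tj; rewrite ler_norml => /andP[d1 d2].
  apply: (sqr_ge_quarter s0 _ d1 d2); move: nf; rewrite negb_and -leNgt -ltNge.
  by move=> /orP[|/ltW]; [left|right].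
have nAm : (\sum_(0 <= j < m) (w \in [set w | (- s < f (j.+1 * lag).+1 x w <=
    s)%R]))%N%:R * 2 <= m%:R :> R.
  rewrite leNgt; apply/negP => h; apply: nA1; exists x => //=.
  by rewrite mulrC ltW.
have H : s ^+ 2 / 8 * m%:R <= \sum_(1 <= t < n.+1) f t xi w ^+ 2.
  apply: le_trans (subsequence_sum_le (a := fun t => f t xi w ^+ 2) _ lag0
      mlag); last first.
    by move=> t; exact: sqr_ge0.
  apply: (@le_trans _ _ (\sum_(0 <= j < m) (s ^+ 2 / 4 * (1 - (w \in [set w |
      (- s < f (j.+1 * lag).+1 x w <= s)%R])%:R)))).
    rewrite -mulr_sumr sumrB sumr_const_nat subn0 -natr_sum.
    exact: half_count_le (sqr_ge0 s) nAm.
  rewrite big_nat_cond [leRHS]big_nat_cond; apply: ler_sum => j /andP[/andP[_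
      jm] _].
  exact: big.
have nm : n%:R <= 2 * lag%:R * m%:R :> R.
  by rewrite -!natrM ler_nat leq_double_div.
rewrite ler_pdivlMl// mulrC; apply: le_trans H.
rewrite mulrAC ler_pdivrMr ?mulr_gt0//.
exact: le_quarter_level (sqr_ge0 s) nm.
Qed.

End regular_lower_bound.

(** * Probability that the estimate is far from the true parameter *)

Section far_probability.
Context d (T : measurableType d) (R : realType) (P : probability T R) (k : nat).

Lemma within_subset (U : topologicalType) (V : Type) (A B : set U)
    (f : U -> V) (x : U) (G : set_system V) : B `<=` A ->
  f y @[y --> within A (nbhs x)] --> G -> f y @[y --> within B (nbhs x)] --> G.
Proof.
move=> BA fG S GS; have h : nbhs x [set y | A y -> S (f y)] := fG _ GS.
have h' : nbhs x [set y | B y -> S (f y)].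
  by apply: filterS h => y h By; exact/h/BA.
exact: h'.
Qed.

Lemma compact_coord_bound (A : set 'rV[R]_k) : compact A ->
  exists b : nat, forall x i, A x -> `|x 0 i| <= b%:R.
Proof.
move=> /compact_bounded[M [_ HM]].
exists (Num.truncn (Num.max M 0)).+1 => x i Ax.
have Mlt : M < (Num.truncn (Num.max M 0)).+1%:R.
  by apply: le_lt_trans (truncnS_gt _); rewrite le_max lexx.
have h : mx_norm x <= (Num.truncn (Num.max M 0)).+1%:R := HM _ Mlt x Ax.
rewrite mx_normrE in h.
by apply: le_trans h; apply: (@le_bigmax _ _ _ 0 (fun i : 'I_1 * 'I_k => `|x
    i.1 i.2|) (0, i)).
Qed.

Lemma invn_powR_le (n Q : nat) (r : R) : (0 < n)%N -> r <= Q%:R ->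
  (n%:R ^+ Q)^-1 <= n%:R `^ (- r) :> R.
Proof.
move=> n0 rQ; rewrite -powR_mulrn// -powRN ler_powR ?ler1n// lerN2//.
Qed.

(** The least squares estimate enters only through the inequality between sums
    that it satisfies. *)
Lemma far_probability (G : nat -> set (set T)) (eps : nat -> T -> R)
    (Theta1 : set 'rV[R]_k) (theta0 : 'rV[R]_k)
    (g : nat -> 'rV[R]_k -> T -> R) (thetahat : nat -> T -> 'rV[R]_k)
    (delta q : R) :
  0 < q -> 0 < delta ->
  increasing_sigma_fields G -> compact Theta1 -> Theta1 theta0 ->
  (forall t theta, (0 < t)%N -> Theta1 theta -> measurable_wrt (G t.-1) (g t
      theta)) ->
  (forall t w, (0 < t)%N -> {within Theta1, continuous (g t ^~ w)}) ->
  (forall n, (0 < n)%N ->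
     measurable [set w | ~ eball theta0 delta (thetahat n w)]) ->
  (forall n w, (0 < n)%N -> Theta1 (thetahat n w)) ->
  (forall n w, (0 < n)%N ->
     \sum_(1 <= t < n.+1) (g t (thetahat n w) w - g t theta0 w) ^+ 2 <=
     2 * \sum_(1 <= t < n.+1) eps t w * (g t (thetahat n w) w - g t theta0 w))
         ->
  (Theta1 `\` eball theta0 delta !=set0 ->
     regular P (Theta1 `\` eball theta0 delta)
       (fun t theta w => const_mx (g t theta w - g t theta0 w) : 'rV[R]_1)
       (fun t => G t.-1) /\
     exists nu q2 : R,
       [/\ 0 < nu, nu <= 2^-1, q / (2 * nu) < q2 &
           eO (fun n => \int[P]_w ereal_sup
                [set (`|n%:R^-1 *
                        \sum_(1 <= t < n.+1)
                          eps t w * (g t theta w - g t theta0 w)| `^ q2)%:E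
                | theta in Theta1 `\` eball theta0 delta])%E
              (fun n => n%:R `^ (- (nu * q2)))]) ->
  exists C : R, 0 <= C /\ \forall n \near \oo,
    (P [set w | ~ eball theta0 delta (thetahat n w)] <=
      (C * n%:R `^ (- (q / 2)))%:E)%E.
Proof.
move=> q0 delta0 Ginc cT T0 gm gc mfar that ls cond.
have [sG incG] := Ginc.
have [ne|e] := pselect (Theta1 `\` eball theta0 delta !=set0); last first.
  exists 0; split=> //; exists 1%N => // n /= n0.
  rewrite (_ : mkset _ = set0) ?measure0 ?mul0r//.
  by rewrite -subset0 => w nb; apply: e; exists (thetahat n w); split=> //;
      exact: that.
have [reg [nu [q2 [nu0 nu2 qq2 [C2 hC2]]]]] := cond ne.
set Th := Theta1 `\` eball theta0 delta in ne reg hC2 *.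
have ThS : Th `<=` Theta1 by move=> x [].
have [b Tb] := compact_coord_bound cT.
pose Q := (Num.truncn (q / 2)).+1.
have qQ : q / 2 <= Q%:R by apply/ltW/truncnS_gt.
have Dm t xi : (0 < t)%N -> Th xi ->
    measurable_wrt (G t.-1) (fun w => g t xi w - g t theta0 w).
  move=> t0 xiT; apply/(measurable_wrtP _ (sG t.-1)).
  by apply: measurable_funB; apply/(measurable_wrtP _ (sG t.-1)); apply: gm =>
      //; exact: ThS.
have Dc t w xi : (0 < t)%N -> Th xi ->
    g t x w - g t theta0 w @[x --> within Th (nbhs xi)] --> g t xi w - g t
        theta0 w.
  move=> t0 xiT; apply: (@cvgB _ _ _ _ _ (g t ^~ w) (cst (g t theta0 w))); last
      exact: cvg_cst.
  have := gc t w t0; move/subspace_continuousP => /(_ xi (ThS _ xiT)) h.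
  exact: (within_subset ThS h).
have [c [C1 [c0 [n1 Hn1]]]] := regular_mean_square_lower_bound (f := fun t
    theta w => g t theta w - g t theta0 w)
  Q Ginc Dm Dc (fun x i Tx => Tb x i (ThS _ Tx)) reg.
have c2 : 0 < c / 2 by rewrite divr_gt0.
pose K := (c / 2) `^ q2; have K0 : 0 < K by rewrite powR_gt0.
exists (`|C1| + `|C2| / K); split; first by rewrite addr_ge0// divr_ge0// ltW.
near=> n.
have n0 : (0 < n)%N by near: n; exists 1%N.
have n1n : (n1 <= n)%N by near: n; exists n1.
have nR1 : 1 <= n%:R :> R by rewrite ler1n.
have [E [mE PE HE]] := Hn1 n n1n.
set far := [set w | ~ _].
have mf : measurable far by exact: mfar.
(* on A the mean of eps_t D_t is at least c/2 in absolute value *)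
pose A := far `\` E.
have mA : measurable A by exact: measurableD.
have PA : (K%:E * P A <= (C2 * n%:R `^ (- (nu * q2)))%:E)%E.
  have hn : (`|\int[P]_w ereal_sup
       [set (`|n%:R^-1 * \sum_(1 <= t < n.+1)
               eps t w * (g t theta w - g t theta0 w)| `^ q2)%:E
        | theta in Th]| <= (C2 * n%:R `^ (- (nu * q2)))%:E)%E by near: n.
  apply: le_trans hn; apply: le_trans (lee_abs _).
  apply: probability_le_integral => // [|w|w [fw nE]].
  - exact: ltW.
  - have [x Tx] := ne; apply: le_trans (_ : ((`|n%:R^-1 * \sum_(1 <= t < n.+1)
               eps t w * (g t x w - g t theta0 w)| `^ q2)%:E <= _)%E).
      by rewrite lee_fin powR_ge0.
    by apply: ereal_sup_ubound; exists x.
  have Tw : Th (thetahat n w) by split=> //; exact: that.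
  have h1 := HE w _ nE Tw.
  apply: le_trans (_ : ((`|n%:R^-1 * \sum_(1 <= t < n.+1)
       eps t w * (g t (thetahat n w) w - g t theta0 w)| `^ q2)%:E <= _)%E);
           last first.
    by apply: ereal_sup_ubound; exists (thetahat n w).
  rewrite lee_fin /K; apply: ge0_ler_powR; rewrite ?nnegrE ?normr_ge0 ?(ltW
      c2)//.
    apply: ltW; apply: lt_trans qq2; rewrite divr_gt0// mulr_gt0//.
  apply: le_trans (ler_norm _); rewrite ler_pdivrMr// mulrC mulrCA.
  by apply: (le_trans h1); rewrite ler_wpM2l// ?invr_ge0// ls.
have PA' : (P A <= (`|C2| / K * n%:R `^ (- (q / 2)))%:E)%E.
  rewrite -(@lee_pmul2l _ K%:E) ?lte_fin//; apply: (le_trans PA).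
  rewrite -EFinM lee_fin mulrA mulrCA divff ?gt_eqF// mulr1.
  apply: (@le_trans _ _ (`|C2| * n%:R `^ (- (nu * q2)))).
    by rewrite ler_wpM2r ?powR_ge0// ler_norm.
  rewrite ler_wpM2l// ler_powR// lerN2.
  move: qq2; rewrite ltr_pdivrMr ?mulr_gt0// => qq2.
  rewrite ler_pdivrMr//; apply: ltW; apply: (lt_le_trans qq2).
  by rewrite mulrCA mulrC (mulrC q2).
apply: (@le_trans _ _ (P (E `|` A))).
  apply: le_measure; rewrite ?inE//; first exact: measurableU.
  by move=> w fw; have [?|?] := pselect (E w); [left|right].
apply: (le_trans (measureU2 P mE mA)).
rewrite mulrDl EFinD; apply: leeD => //; apply: (le_trans PE).
rewrite lee_fin; apply: (@le_trans _ _ (`|C1| / n%:R ^+ Q)).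
  by rewrite ler_wpM2r ?invr_ge0 ?exprn_ge0// ler_norm.
by rewrite ler_wpM2l// invn_powR_le.
Unshelve. all: by end_near. 
Qed.

End far_probability.

(** * Directional derivatives and the second-order mean value theorem *)

Section directional_derivatives.
Context (R : realType) (k : nat).
Implicit Types (h x theta : 'rV[R]_k).

(** A directional derivative depending on a point of the probability space is
    the limit of difference quotients along the increments 1/(n + N + 1), which
    are measurable once N is so large that the increments stay in D. *)
Lemma measurable_derive d (T : measurableType d) (D : set 'rV[R]_k)
    (f : 'rV[R]_k -> T -> R) theta h :
  nbhs theta D -> (forall x, D x -> measurable_fun setT (f x)) ->
  (forall w, derivable (f ^~ w) theta h) ->
  measurable_fun setT (fun w => 'D_h (f ^~ w) theta).
Proof.
move=> nD mf df.
have ch0 : (fun s : R => s *: h) @ (0 : R) --> (0 : R) *: h.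
  by apply: (@cvgZr_tmp _ _ _ _ (nbhs_filter (0 : R))); exact: cvg_id.
have ch : (fun s : R => s *: h + theta) @ (0 : R) --> theta.
  have := @cvgD _ _ _ _ (nbhs_filter (0 : R)) _ (cst theta) _ theta ch0
      (cvg_cst theta).
  by rewrite scale0r add0r; exact.
have h0 : (fun n => n.+1%:R^-1 : R) @ \oo --> (0 : R) by exact: cvg_harmonic.
have [N _ HN] : \forall n \near \oo, D (n.+1%:R^-1 *: h + theta).
  exact: (cvg_comp _ _ h0 ch _ nD).
pose u n : R := (n + N).+1%:R^-1.
have u0 : (forall n, u n != 0) /\ u @ \oo --> (0 : R).
  split=> [n|]; first by rewrite invr_eq0 pnatr_eq0.
  by rewrite /u; exact: (cvg_comp _ _ (cvg_addnr N) h0).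
apply: (@measurable_fun_cvg _ _ _ _ (fun n w => (u n)^-1 *: (f (u n *: h +
    theta) w - f theta w))).
  move=> n; apply: measurable_funM => //; apply: measurable_funB; apply: mf.
    by apply: HN => /=; rewrite leq_addl.
  exact: nbhs_singleton nD.
move=> w _; have := df w; rewrite /derivable => /cvgr_dnbhsP/(_ u u0).
exact.
Qed.

Lemma derive_row_sum (f : 'rV[R]_k -> R) x h : differentiable f x ->
  'D_h f x = \sum_(i < k) h 0 i * grad f x 0 i.
Proof.
move=> df; rewrite deriveE// [in LHS](row_sum_delta h) linear_sum.
by apply: eq_bigr => i _; rewrite linearZ/= mxE deriveE.
Qed.

Lemma is_derive_line (f : 'rV[R]_k -> R) x h (s : R) :
  differentiable f (x + s *: h) ->
  is_derive s 1 (fun r : R => f (x + r *: h))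
    (\sum_(i < k) h 0 i * grad f (x + s *: h) 0 i).
Proof.
move=> df; rewrite -derive_row_sum//.
have dl : is_diff s (fun r : R => x + r *: h) (fun r : R => r *: h).
  rewrite -[X in is_diff _ _ X]add0r.
  exact: is_diffD.
have dl1 : differentiable (fun r : R => x + r *: h) s by case: dl.
have dl2 : 'd (fun r : R => x + r *: h) s = (fun r : R => r *: h) :> (R -> _).
  by case: dl.
have dc : differentiable (f \o (fun r : R => x + r *: h)) s.
  exact: differentiable_comp.
apply: DeriveDef; first exact: diff_derivable.
rewrite (@deriveE _ _ _ (f \o (fun r : R => x + r *: h)))//.
by rewrite diff_comp//= dl2 scale1r deriveE.
Qed.

Lemma is_derive_sum_nat (u : nat -> R) (f df : nat -> R -> R) n (s : R) :
  (forall t, (0 < t)%N -> is_derive s 1 (f t) (df t s)) ->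
  is_derive s 1 (fun r => \sum_(1 <= t < n.+1) u t * f t r)
    (\sum_(1 <= t < n.+1) u t * df t s).
Proof.
move=> dfs; elim: n => [|n IH].
  rewrite big_geq// (_ : (fun _ => _) = cst 0); first exact: is_derive_cst.
  by apply/funext => r; rewrite big_geq.
rewrite big_nat_recr//= (_ : (fun _ => _) = (fun r => \sum_(1 <= t < n.+1) u t
    * f t r)
   + u n.+1 \*: f n.+1); last first.
  by apply/funext => r; rewrite big_nat_recr.
apply: is_deriveD; apply: is_deriveZ; exact: dfs.
Qed.

(** Two applications of the mean value theorem to the weighted sum as a
    function of the position s in [0, 1] on the segment from x to x + h. The
    point y is the same for all t, which is why weighted sums are considered.
    *)
Lemma mean_value_second_order (f : nat -> 'rV[R]_k -> R) (u : nat -> R) n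
    x h (eta : R) :
  enorm h < eta ->
  (forall t y, (0 < t)%N -> eball x eta y ->
     differentiable (f t) y /\ differentiable (grad (f t)) y) ->
  exists s y, [/\ 0 <= s <= 1, eball x eta y &
    \sum_(1 <= t < n.+1) u t *
       (f t (x + h) - f t x - \sum_(i < k) h 0 i * grad (f t) x 0 i) =
    s * \sum_(1 <= t < n.+1) u t *
      \sum_(i < k) \sum_(j < k) h 0 i * h 0 j * hess (f t) y i j].
Proof.
move=> hn df.
have seg (s : R) : 0 <= s <= 1 -> eball x eta (x + s *: h).
  by move=> /andP[s0 s1]; exact: eball_ray.
pose phi s := \sum_(1 <= t < n.+1) u t * f t (x + s *: h).
pose dphi s := \sum_(1 <= t < n.+1) u t *
  \sum_(i < k) h 0 i * grad (f t) (x + s *: h) 0 i.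
pose ddphi s := \sum_(1 <= t < n.+1) u t *
  \sum_(i < k) \sum_(j < k) h 0 i * h 0 j * hess (f t) (x + s *: h) i j.
have d1 (s : R) : 0 <= s <= 1 -> is_derive s 1 phi (dphi s).
  move=> s01; apply: (@is_derive_sum_nat u (fun t r => f t (x + r *: h))
    (fun t r => \sum_(i < k) h 0 i * grad (f t) (x + r *: h) 0 i)) => t t0.
  by apply: is_derive_line; have [] := df t _ t0 (seg s s01).
have d2 (s : R) : 0 <= s <= 1 -> is_derive s 1 dphi (ddphi s).
  move=> s01; apply: (@is_derive_sum_nat u
    (fun t r => \sum_(i < k) h 0 i * grad (f t) (x + r *: h) 0 i)
    (fun t r => \sum_(i < k) \sum_(j < k) h 0 i * h 0 j * hess (f t) (x + r *:
        h) i j)) => t t0.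
  rewrite (_ : (fun _ => _) = \sum_(i < k) (h 0 i \*: (fun r => grad (f t) (x +
      r *: h) 0 i))); last first.
    by apply/funext => r; rewrite fct_sumE.
  apply: is_derive_sum => i.
  under eq_bigr do rewrite -mulrA.
  rewrite -mulr_sumr; apply: is_deriveZ.
  have dg : differentiable (fun y => grad (f t) y 0 i) (x + s *: h).
    apply: (@differentiable_comp _ _ _ _ (grad (f t)) (fun v : 'rV[R]_k => v 0
        i)).
      by have [] := df t _ t0 (seg s s01).
    exact: differentiable_coord.
  have := is_derive_line dg.
  by under eq_bigr do rewrite /grad mxE; under [in X in _ -> X]eq_bigr do
      rewrite mxE.
have mvt (F dF : R -> R) (b : R) : 0 <= b <= 1 ->
    (forall s : R, 0 <= s <= 1 -> is_derive s 1 F (dF s)) ->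
    exists2 s, 0 <= s <= b & F b - F 0 = dF s * b.
  move=> /andP[b0 b1] dF'.
  have [||s] := @MVT_segment R F dF 0 b b0.
  - move=> s; rewrite in_itv/= => /andP[s0 sb]; apply: dF'.
    by rewrite (ltW s0)/= (le_trans (ltW sb)).
  - apply: derivable_within_continuous => s; rewrite in_itv/= => /andP[s0 sb].
    by apply: ex_derive; apply: dF'; rewrite s0 (le_trans sb).
  by rewrite in_itv/= subr0 => s0b E; exists s.
have i01 : 0 <= (1 : R) <= 1 by rewrite ler01 lexx.
have [s1 /andP[s10 s11] E1] := mvt phi dphi 1 i01 d1.
have s1b : 0 <= s1 <= 1 by rewrite s10.
have [s2 /andP[s20 s21] E2] := mvt dphi ddphi s1 s1b d2.
have s2b : 0 <= s2 <= 1 by rewrite s20 (le_trans s21).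
exists s1, (x + s2 *: h); split=> //; first exact: seg.
rewrite mulr1 in E1; rewrite -/(ddphi s2) mulrC -E2 -E1.
rewrite /phi /dphi scale1r scale0r addr0 -!sumrB; apply: eq_bigr => t _.
by rewrite !mulrBr.
Qed.

End directional_derivatives.

(** * The event that the Gram matrix is nearly singular *)

Section minimal_eigenvalue_event.
Context (R : realType) (k : nat).

(** For a positive semidefinite matrix, the inverse of the smallest eigenvalue
    exceeds M exactly when the Rayleigh quotient takes a value below 1/M; a
    zero eigenvalue corresponds to the value +oo of the inverse. *)
Lemma lambda_min_inv_gtP (L : 'M[R]_k) (M : R) : (0 < k)%N -> 0 < M ->
  L^T = L -> (forall u, 0 <= quad_form L u) ->
  (M%:E < lambda_min_inv L)%E <->
  exists u, 0 < M^-1 * enorm u ^+ 2 - quad_form L u.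
Proof.
move=> k0 M0 symL psd; have [lb [v v0 vE]] := lambda_minP k0 symL.
have l0 : 0 <= lambda_min L.
  by have := psd v; rewrite vE pmulr_lge0// exprn_gt0// enorm_gt0.
rewrite /lambda_min_inv inver; case: ifPn => [/eqP l00|ln0].
  split=> _; last exact: ltry.
  by exists v; rewrite vE l00 mul0r subr0 mulr_gt0 ?invr_gt0// exprn_gt0//
      enorm_gt0.
have lg : 0 < lambda_min L by rewrite lt0r ln0.
have ME : (M%:E < ((lambda_min L)^-1)%:E)%E = (lambda_min L < M^-1).
  by rewrite lte_fin -[M in LHS]invrK ltf_pV2 ?posrE ?invr_gt0.
rewrite ME; split=> [lM|[u]].
  by exists v; rewrite vE -mulrBl mulr_gt0 ?subr_gt0// exprn_gt0// enorm_gt0.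
rewrite subr_gt0 => h.
have u0 : enorm u ^+ 2 != 0.
  apply/eqP => u0; move: h; rewrite u0 mulr0 ltNge psd//.
have ug : 0 < enorm u ^+ 2 by rewrite lt0r u0 sqr_ge0.
by rewrite -(ltr_pM2r ug); exact: le_lt_trans (lb u) h.
Qed.

(** The normalized Gram matrix of the row vectors v 1, ..., v n. *)
Definition gram (n : nat) (v : nat -> 'rV[R]_k) : 'M[R]_k :=
  n%:R^-1 *: \sum_(1 <= t < n.+1) (v t)^T *m v t.

Lemma tr_gram n v : (gram n v)^T = gram n v.
Proof.
rewrite /gram linearZ/= linear_sum/=; congr (_ *: _); apply: eq_bigr => t _.
by rewrite trmx_mul trmxK.
Qed.

Lemma quad_form_gram n v u : quad_form (gram n v) u =
  n%:R^-1 * \sum_(1 <= t < n.+1) (\sum_(i < k) u 0 i * v t 0 i) ^+ 2.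
Proof.
rewrite /quad_form /gram -scalemxAr -scalemxAl mxE; congr (_ * _).
rewrite mulmx_sumr mulmx_suml summxE; apply: eq_bigr => t _.
rewrite (mulmxA u) -(mulmxA (u *m (v t)^T)) mxE big_ord1 !mxE expr2; congr (_ *
    _).
  by apply: eq_bigr => i _; rewrite mxE.
by apply: eq_bigr => i _; rewrite mxE mulrC.
Qed.

Lemma quad_form_gram_ge0 n v u : 0 <= quad_form (gram n v) u.
Proof.
rewrite quad_form_gram mulr_ge0// ?invr_ge0//.
by apply: sumr_ge0 => t _; exact: sqr_ge0.
Qed.

Lemma gt_sup_lambda_min_invP (D : set 'rV[R]_k) n (v : 'rV[R]_k -> nat ->
    'rV[R]_k)
    (M : R) : (0 < k)%N -> 0 < M ->
  (M%:E < ereal_sup [set lambda_min_inv (gram n (v theta)) | theta in D])%E <->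
  exists u theta, D theta /\
    0 < M^-1 * enorm u ^+ 2 - quad_form (gram n (v theta)) u.
Proof.
move=> k0 M0; have P theta := lambda_min_inv_gtP k0 M0 (tr_gram n (v theta))
  (quad_form_gram_ge0 n (v theta)).
split=> [/ereal_sup_gt[_ [t Dt <-]] /P[u h]|[u [t [Dt h]]]]; first by exists u,
    t.
have /P : exists u, 0 < M^-1 * enorm u ^+ 2 - quad_form (gram n (v t)) u by
    exists u.
by move=> /lt_le_trans; apply; apply: ereal_sup_ubound; exists t.
Qed.

Lemma measurable_gt_sup_lambda_min_inv d (T : measurableType d) (D : set
    'rV[R]_k)
    n (v : T -> 'rV[R]_k -> nat -> 'rV[R]_k) (M : R) : (0 < k)%N -> 0 < M ->
  (forall theta t i, (0 < t)%N -> D theta ->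
     measurable_fun setT (fun w => v w theta t 0 i)) ->
  (forall theta t i w, (0 < t)%N -> D theta ->
     v w x t 0 i @[x --> nbhs theta] --> v w theta t 0 i) ->
  measurable [set w | (M%:E <
    ereal_sup [set lambda_min_inv (gram n (v w theta)) | theta in D])%E].
Proof.
move=> k0 M0 mv cv.
have [z [_ zd]] : exists z : nat -> 'rV[R]_k, (forall j, setT (z j)) /\
    (forall theta U, [set: 'rV[R]_k] theta -> nbhs theta U -> exists j, U (z
        j)).
  by apply: dense_sequence; exists 0.
pose F u theta w := M^-1 * enorm u ^+ 2 - quad_form (gram n (v w theta)) u.
have FE u theta w : F u theta w = M^-1 * enorm u ^+ 2 -
    n%:R^-1 * \sum_(1 <= t < n.+1) (\sum_(i < k) u 0 i * v w theta t 0 i) ^+ 2.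
  by rewrite /F quad_form_gram.
rewrite (_ : mkset _ = \bigcup_j [set w | (0 < ereal_sup
    [set (F (z j) theta w)%:E | theta in D])%E]).
  apply: bigcup_measurable => j _.
  have := @emeasurable_fun_o_infty _ T R setT (fun w => ereal_sup
    [set (F (z j) theta w)%:E | theta in D]) measurableT.
  move=> /(_ _ 0%E); rewrite setTI; apply.
  apply: measurable_ereal_sup => [theta Dt|w theta r Dt rF].
    rewrite (_ : F _ _ = fun w => M^-1 * enorm (z j) ^+ 2 -
      n%:R^-1 * \sum_(1 <= t < n.+1) (\sum_(i < k) z j 0 i * v w theta t 0 i)
          ^+ 2); last first.
      by apply/funext => w; rewrite FE.
    apply: measurable_funB => //; apply: measurable_funM => //.
    apply: measurable_sum_nat => t /andP[t0 _]; apply: measurable_funX.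
    apply: measurable_sum => i; apply: measurable_funM => //; exact: mv.
  suff c : F (z j) x w @[x --> nbhs theta] --> F (z j) theta w.
    exact: (cvg_within_filter D c) (lt_nbhsr rF).
  rewrite FE (_ : (fun x => F (z j) x w) = fun x => M^-1 * enorm (z j) ^+ 2 -
      n%:R^-1 * \sum_(1 <= t < n.+1) (\sum_(i < k) z j 0 i * v w x t 0 i) ^+
          2); last first.
    by apply/funext => x; rewrite FE.
  apply: (@cvgB _ _ _ _ (nbhs_filter theta) (cst _)); first exact: cvg_cst.
  apply: (@cvgM _ _ _ (nbhs_filter theta) (cst _)); first exact: cvg_cst.
  apply: (@cvg_big_sum _ _ _ (nbhs_filter theta)) => t; rewrite mem_index_iota
      => /andP[t0 _].
  have c : \sum_(i < k) z j 0 i * v w x t 0 i @[x --> nbhs theta] -->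
      \sum_(i < k) z j 0 i * v w theta t 0 i.
    apply: (@cvg_big_sum _ _ _ (nbhs_filter theta)) => i _.
    by apply: (@cvgM _ _ _ (nbhs_filter theta) (cst _)); [exact: cvg_cst|exact:
        cv].
  exact: (cvgM c c).
apply/seteqP; split=> w /=.
  move=> /(gt_sup_lambda_min_invP D n (v w) k0 M0)[u [theta [Dt h]]].
  have c : (fun u => F u theta w) @ u --> F u theta w.
    apply: (@cvgB _ _ _ _ (nbhs_filter u) (fun u => M^-1 * enorm u ^+ 2)); last
        first.
      exact: continuous_quad_form.
    apply: (@cvgM _ _ _ (nbhs_filter u) (cst _)); first exact: cvg_cst.
    have e := @continuous_enorm R k u.
    exact: (cvgM e e).
  have [j jh] := zd _ _ I (c _ (lt_nbhsr h)).
  exists j => //=; apply: (@lt_le_trans _ _ (F (z j) theta w)%:E).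
    by rewrite lte_fin; exact: jh.
  by apply: ereal_sup_ubound; exists theta.
move=> [j _ /ereal_sup_gt[_ [theta Dt <-]]]; rewrite lte_fin => h.
by apply/(gt_sup_lambda_min_invP D n (v w) k0 M0); exists (z j), theta.
Qed.

End minimal_eigenvalue_event.

(** * The least squares estimate near the true parameter *)

Section least_squares_near.
Context (R : realType) (k : nat).

(** The Cauchy-Schwarz inequality against the constant 1. *)
Lemma sqr_sum_le n (a : 'I_n -> R) :
  (\sum_(i < n) a i) ^+ 2 <= n%:R * \sum_(i < n) a i ^+ 2.
Proof.
rewrite expr2 mulr_suml.
under eq_bigr do rewrite mulr_sumr.
apply: (@le_trans _ _ (\sum_(i < n) \sum_(j < n) (a i ^+ 2 / 2 + a j ^+ 2 /
    2))).
  apply: ler_sum => i _; apply: ler_sum => j _.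
  by have := sqr_ge0 (a i - a j); nra.
set S := \sum_(i < n) a i ^+ 2.
have E i : \sum_(j < n) (a i ^+ 2 / 2 + a j ^+ 2 / 2) = n%:R * (a i ^+ 2 / 2) +
    S / 2.
  by rewrite big_split/= sumr_const card_ord mulr_natl -mulr_suml.
under eq_bigr do rewrite E.
rewrite big_split/= sumr_const card_ord -mulr_sumr -mulr_suml -/S.
by rewrite -[X in _ + X]mulr_natl; lra.
Qed.

Lemma mul_le_half_sqr (s u v : R) : 0 <= s -> s <= 1 ->
  s * (u * v) <= 2^-1 * u ^+ 2 + 2^-1 * v ^+ 2.
Proof.
move=> s0 s1; rewrite -subr_ge0.
have -> : 2^-1 * u ^+ 2 + 2^-1 * v ^+ 2 - s * (u * v) =
    s * (2^-1 * (u - v) ^+ 2) + (1 - s) * (2^-1 * (u ^+ 2 + v ^+ 2)) by field.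
by apply: addr_ge0; rewrite mulr_ge0 ?subr_ge0// mulr_ge0 ?addr_ge0 ?sqr_ge0.
Qed.

Lemma le_of_half_le (A B C : R) : A = B -> B <= 2^-1 * A + 2^-1 * C -> A <= C.
Proof. by lra. Qed.

Lemma sqr_sub_ge (u v : R) : 2^-1 * v ^+ 2 - (u - v) ^+ 2 <= u ^+ 2.
Proof. by have := sqr_ge0 (2 * u - v); lra. Qed.

Lemma le_combine_lower (Mb A B C D Z : R) :
  Mb * (2^-1 * A - B) <= Mb * C -> D <= Mb * A -> Mb * B <= Mb * Z ->
  Mb * Z <= 4^-1 * D -> D <= 4 * Mb * C.
Proof. by lra. Qed.

Lemma le_combine_upper (Mb A B Z u : R) :
  Mb * A <= Mb * (2 * B) -> Mb * B <= Mb * (u * Z) ->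
  4 * Mb * A <= (8 * Mb * Z) * u.
Proof. by lra. Qed.

(** A deterministic bound for h = thetahat - x, under the basic inequality of
    least squares, a lower bound 1/Mb for the normalized Gram matrix of the
    gradients in the direction h, and bounds for the mean squares of the second
    derivatives on a small ball. *)
Lemma least_squares_near (g : nat -> 'rV[R]_k -> R) (eps : nat -> R)
    (x h : 'rV[R]_k) (n : nat) (delta Mb : R) :
  (0 < n)%N -> 0 < Mb -> enorm h < delta ->
  k%:R ^+ 4 * delta ^+ 2 * Mb ^+ 2 <= 4^-1 ->
  (forall t y, (0 < t)%N -> eball x delta y ->
     differentiable (g t) y /\ differentiable (grad (g t)) y) ->
  \sum_(1 <= t < n.+1) (g t (x + h) - g t x) ^+ 2 <=
    2 * \sum_(1 <= t < n.+1) eps t * (g t (x + h) - g t x) ->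
  enorm h ^+ 2 <= Mb * (n%:R^-1 *
    \sum_(1 <= t < n.+1) (\sum_(i < k) h 0 i * grad (g t) x 0 i) ^+ 2) ->
  (forall y i j, eball x delta y ->
     n%:R^-1 * \sum_(1 <= t < n.+1) hess (g t) y i j ^+ 2 <= Mb) ->
  exists2 y, eball x delta y &
    Num.sqrt n%:R * enorm h <= 8 * Mb *
     (\sum_(i < k) `|(Num.sqrt n%:R)^-1 *
         \sum_(1 <= t < n.+1) eps t * grad (g t) x 0 i| +
      delta * \sum_(i < k) \sum_(j < k) `|(Num.sqrt n%:R)^-1 *
         \sum_(1 <= t < n.+1) eps t * hess (g t) y i j|).
Proof.
move=> n0 Mb0 hd small dg ineq eig hessb.
have nR : 0 < n%:R :> R by rewrite ltr0n.
set r := Num.sqrt n%:R; have r0 : 0 < r by rewrite sqrtr_gt0.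
have r2 : r ^+ 2 = n%:R by rewrite sqr_sqrtr// ltW.
pose e := enorm h; have e0 : 0 <= e by exact: enorm_ge0.
have d0 : 0 < delta by exact: le_lt_trans hd.
pose D t := g t (x + h) - g t x.
pose a t := \sum_(i < k) h 0 i * grad (g t) x 0 i.
pose rem t := D t - a t.
pose b y t := \sum_(i < k) \sum_(j < k) h 0 i * h 0 j * hess (g t) y i j.
have [s1 [y1 [/andP[s10 s11] y1b E1]]] := mean_value_second_order rem n hd dg.
have [s2 [y2 [/andP[s20 s21] y2b E2]]] := mean_value_second_order eps n hd dg.
(* the remainder is used as the weight in the mean value theorem *)
have rem_le : \sum_(1 <= t < n.+1) rem t ^+ 2 <= \sum_(1 <= t < n.+1) b y1 t ^+
    2.
  have : \sum_(1 <= t < n.+1) rem t ^+ 2 =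
      s1 * \sum_(1 <= t < n.+1) rem t * b y1 t by rewrite -E1.
  have : s1 * \sum_(1 <= t < n.+1) rem t * b y1 t <=
      \sum_(1 <= t < n.+1) (2^-1 * rem t ^+ 2 + 2^-1 * b y1 t ^+ 2).
    rewrite mulr_sumr; apply: ler_sum => t _.
    exact: mul_le_half_sqr.
  rewrite big_split/= -!mulr_sumr => le1 eq1.
  exact: (le_of_half_le eq1 le1).
have b_le : \sum_(1 <= t < n.+1) b y1 t ^+ 2 <= k%:R ^+ 4 * e ^+ 4 * Mb * n%:R.
  have pt t : b y1 t ^+ 2 <= \sum_(i < k) \sum_(j < k)
      k%:R ^+ 2 * e ^+ 4 * hess (g t) y1 i j ^+ 2.
    apply: (le_trans (sqr_sum_le _)); rewrite mulr_sumr; apply: ler_sum => i _.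
    apply: (@le_trans _ _ (k%:R * (k%:R * \sum_(j < k) (h 0 i * h 0 j * hess (g
        t) y1 i j) ^+ 2))).
      by rewrite ler_wpM2l// sqr_sum_le.
    rewrite mulrA -expr2 mulr_sumr; apply: ler_sum => j _.
    rewrite -[leRHS]mulrA ler_wpM2l ?exprn_ge0//.
    rewrite exprMn ler_wpM2r ?sqr_ge0// exprMn (_ : e ^+ 4 = e ^+ 2 * e ^+ 2);
        last by ring.
    by apply: ler_pM; rewrite ?sqr_ge0// -real_normK ?num_real//
      lerXn2r ?nnegrE// coord_le_enorm.
  apply: (le_trans (ler_sum _ (fun t _ => pt t))).
  rewrite exchange_big/=; under eq_bigr do rewrite exchange_big/=.
  apply: (@le_trans _ _ (\sum_(i < k) \sum_(j < k) k%:R ^+ 2 * e ^+ 4 * (Mb *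
      n%:R))).
    apply: ler_sum => i _; apply: ler_sum => j _.
    rewrite -mulr_sumr ler_wpM2l ?mulr_ge0 ?exprn_ge0//.
    have := hessb y1 i j y1b; rewrite ler_pdivrMl// mulrC //.
  rewrite !sumr_const !card_ord -mulrnA -[leLHS]mulr_natl natrM.
  by rewrite le_eqVlt; apply/orP; left; apply/eqP; ring.
(* a lower bound for the sum of squared increments, through
   D^2 >= a^2/2 - (D - a)^2 *)
have lower : n%:R * e ^+ 2 <= 4 * Mb * \sum_(1 <= t < n.+1) D t ^+ 2.
  have H1 : 2^-1 * \sum_(1 <= t < n.+1) a t ^+ 2 - \sum_(1 <= t < n.+1) rem t
      ^+ 2
      <= \sum_(1 <= t < n.+1) D t ^+ 2.
    rewrite mulr_sumr -sumrB; apply: ler_sum => t _.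
    exact: sqr_sub_ge.
  have H2 : n%:R * e ^+ 2 <= Mb * \sum_(1 <= t < n.+1) a t ^+ 2.
    by move: eig; rewrite mulrCA ler_pdivlMl.
  have H3 : Mb * (k%:R ^+ 4 * e ^+ 4 * Mb * n%:R) <= 4^-1 * (n%:R * e ^+ 2).
    have -> : Mb * (k%:R ^+ 4 * e ^+ 4 * Mb * n%:R) =
      (k%:R ^+ 4 * e ^+ 2 * Mb ^+ 2) * (n%:R * e ^+ 2) by ring.
    rewrite ler_wpM2r ?mulr_ge0 ?exprn_ge0// ?(ltW nR)//.
    apply: le_trans small; rewrite ler_wpM2r ?exprn_ge0 ?(ltW Mb0)//.
    rewrite ler_wpM2l ?exprn_ge0// lerXn2r ?nnegrE// ?(ltW d0)// ltW//.
  have H4 := ler_wpM2l (ltW Mb0) H1.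
  have H5 := ler_wpM2l (ltW Mb0) (le_trans rem_le b_le).
  exact: (le_combine_lower H4 H2 H5 H3).
pose W i := r^-1 * \sum_(1 <= t < n.+1) eps t * grad (g t) x 0 i.
pose H i j := r^-1 * \sum_(1 <= t < n.+1) eps t * hess (g t) y2 i j.
exists y2 => //; rewrite -/e.
set X := (_ + _ in leRHS).
have upper : \sum_(1 <= t < n.+1) eps t * D t <= r * e * X.
  have -> : \sum_(1 <= t < n.+1) eps t * D t =
     r * (\sum_(i < k) h 0 i * W i) + s2 * (r * \sum_(i < k) \sum_(j < k) h 0 i
         * h 0 j * H i j).
    have EW : r * (\sum_(i < k) h 0 i * W i) = \sum_(1 <= t < n.+1) eps t * a t.
      rewrite mulr_sumr /a; under [RHS]eq_bigr do rewrite mulr_sumr.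
      rewrite exchange_big/=; apply: eq_bigr => i _.
      rewrite /W mulrCA mulVKf ?gt_eqF// mulr_sumr; apply: eq_bigr => t _; ring.
    have EH : r * (\sum_(i < k) \sum_(j < k) h 0 i * h 0 j * H i j) =
        \sum_(1 <= t < n.+1) eps t * b y2 t.
      rewrite mulr_sumr /b; under [RHS]eq_bigr do rewrite mulr_sumr.
      rewrite exchange_big/=; apply: eq_bigr => i _.
      rewrite mulr_sumr; under [RHS]eq_bigr do rewrite mulr_sumr.
      rewrite exchange_big/=; apply: eq_bigr => j _.
      rewrite /H mulrCA mulVKf ?gt_eqF// mulr_sumr; apply: eq_bigr => t _; ring.
    rewrite EW EH -E2 -big_split/=; apply: eq_bigr => t _.
    by rewrite -/(D t) -/(a t); ring.
  have leW : \sum_(i < k) h 0 i * W i <= e * \sum_(i < k) `|W i|.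
    rewrite mulr_sumr; apply: ler_sum => i _; apply: (le_trans (ler_norm _)).
    by rewrite normrM ler_wpM2r// coord_le_enorm.
  have leH : s2 * \sum_(i < k) \sum_(j < k) h 0 i * h 0 j * H i j <=
      e * (delta * \sum_(i < k) \sum_(j < k) `|H i j|).
    apply: (@le_trans _ _ (\sum_(i < k) \sum_(j < k) `|h 0 i * h 0 j * H i j|)).
      apply: (@le_trans _ _ (s2 * \sum_(i < k) \sum_(j < k) `|h 0 i * h 0 j * H
          i j|)).
        by rewrite ler_wpM2l//; apply: ler_sum => i _; apply: ler_sum => j _;
            exact: ler_norm.
      by rewrite ler_piMl//; apply: sumr_ge0 => i _; apply: sumr_ge0.
    rewrite mulrA mulr_sumr; apply: ler_sum => i _; rewrite mulr_sumr; apply: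
        ler_sum => j _.
    rewrite !normrM ler_wpM2r// ler_pM// ?coord_le_enorm//.
    by rewrite (le_trans (coord_le_enorm _ _))// ltW.
  rewrite mulrCA -mulrDr -mulrA ler_wpM2l ?(ltW r0)// /X -/W mulrDr.
  exact: lerD.
have fin : r ^+ 2 * e ^+ 2 <= (8 * Mb * X) * (r * e).
  rewrite r2; apply: (le_trans lower).
  exact: (le_combine_upper (ler_wpM2l (ltW Mb0) ineq) (ler_wpM2l (ltW Mb0)
      upper)).
have [->|en] := eqVneq e 0.
  rewrite mulr0 mulr_ge0//; first by rewrite mulr_ge0// ltW.
  rewrite /X addr_ge0 ?sumr_ge0// mulr_ge0 ?(ltW d0)//.
  by apply: sumr_ge0 => i _; apply: sumr_ge0.
have re0 : 0 < r * e by rewrite mulr_gt0// lt0r en.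
by rewrite -(ler_pM2r re0) -expr2 exprMn.
Qed.

End least_squares_near.

(** * Splitting the moment of the normalized error *)

Section moment_splitting.
Context d (T : measurableType d) (R : realType) (P : probability T R).

Lemma powR_sum_le n (a : 'I_n -> R) (q : R) : 0 < q -> (forall i, 0 <= a i) ->
  (\sum_(i < n) a i) `^ q <= n%:R `^ q * \sum_(i < n) a i `^ q.
Proof.
case: n a => [|n] a q0 a0; first by rewrite !big_ord0 powR0 ?gt_eqF// mulr0.
have [i0 _ mx] := @Order.TotalTheory.arg_maxP _ _ _ ord0 predT a isT.
apply: (@le_trans _ _ ((n.+1%:R * a i0) `^ q)).
  apply: ge0_ler_powR; rewrite ?nnegrE ?mulr_ge0 ?sumr_ge0 ?(ltW q0)//.
  apply: (@le_trans _ _ (\sum_(i < n.+1) a i0)).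
    by apply: ler_sum => i _; exact: mx.
  by rewrite sumr_const card_ord mulr_natl.
rewrite powRM// ler_wpM2l ?powR_ge0// (bigD1 i0)//= lerDl.
by apply: sumr_ge0 => i _; exact: powR_ge0.
Qed.

Lemma powR_add2_le (a b q : R) : 0 < q -> 0 <= a -> 0 <= b ->
  (a + b) `^ q <= 2 `^ q * (a `^ q + b `^ q).
Proof.
move=> q0 a0 b0.
have := @powR_sum_le 2 (fun i => if i == ord0 then a else b) q q0.
by rewrite !big_ord_recl !big_ord0/= !addr0; apply => i; case: ifP.
Qed.

(** The integral of u is split over B, where u is at most a, and the complement
    of B, where u is bounded by integrable quantities. *)
Lemma integral_split_bound k (u : T -> R) (B : set T) (a kap wb sb pb : R)
    (W : 'I_k -> T -> R) (S : 'I_k -> 'I_k -> T -> \bar R) :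
  measurable B -> (forall w, 0 <= u w) -> 0 <= a -> 0 <= kap ->
  (forall i, measurable_fun setT (W i)) -> (forall i w, 0 <= W i w) ->
  (forall i j, measurable_fun setT (S i j)) -> (forall i j w, 0 <= S i j w)%E ->
  (forall w, B w -> u w <= a) ->
  (forall w, ~ B w -> ((u w)%:E <= kap%:E *
     (\sum_(i < k) (1 + W i w)%:E + \sum_(i < k) \sum_(j < k) (1 + S i j
         w)))%E) ->
  (forall i, \int[P]_w (W i w)%:E <= wb%:E)%E ->
  (forall i j, \int[P]_w S i j w <= sb%:E)%E ->
  (P B <= pb%:E)%E ->
  (\int[P]_w (u w)%:E <=
    (a * pb + kap * (k%:R * (1 + wb) + k%:R * (k%:R * (1 + sb))))%:E)%E.
Proof.
move=> mB u0 a0 kap0 mW W0 mS S0 uB uC IW IS PB.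
have mI : measurable_fun setT (\1_B : T -> R) by exact: measurable_indic.
have m1W i : measurable_fun setT (fun w => (1 + W i w)%:E).
  by apply/measurable_EFinP; apply: measurable_funD.
have m1S i j : measurable_fun setT (fun w => 1 + S i j w)%E.
  by apply: emeasurable_funD.
have W10 i w : (0 <= (1 + W i w)%:E)%E by rewrite lee_fin addr_ge0.
have S10 i j w : (0 <= 1 + S i j w)%E by rewrite adde_ge0.
have mSW : measurable_fun setT (fun w => \sum_(i < k) (1 + W i w)%:E)%E.
  exact: emeasurable_sum.
have mSi i : measurable_fun setT (fun w => \sum_(j < k) (1 + S i j w))%E.
  exact: emeasurable_sum.
have mSS : measurable_fun setT (fun w => \sum_(i < k) \sum_(j < k) (1 + S i j
    w))%E.
  exact: emeasurable_sum.
have SW0 w : (0 <= \sum_(i < k) (1 + W i w)%:E)%E by apply: sume_ge0.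
have Si0 i w : (0 <= \sum_(j < k) (1 + S i j w))%E by apply: sume_ge0.
have SS0 w : (0 <= \sum_(i < k) \sum_(j < k) (1 + S i j w))%E by apply:
    sume_ge0.
pose V w : \bar R := ((a * \1_B w)%:E + kap%:E *
     (\sum_(i < k) (1 + W i w)%:E + \sum_(i < k) \sum_(j < k) (1 + S i j w)))%E.
apply: (@le_trans _ _ (\int[P]_w V w)%E).
  apply: ge0_le_integral_any => w; first by rewrite lee_fin.
  rewrite /V indicE; have [Bw|nBw] := pselect (B w).
    rewrite mem_set// mulr1 -[leLHS]adde0 leeD ?lee_fin ?uB//.
    by rewrite mule_ge0 ?lee_fin// adde_ge0.
  by rewrite memNset// mulr0 add0e uC.
rewrite /V ge0_integralD//; last 4 first.
- by move=> w _; rewrite lee_fin mulr_ge0.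
- by apply/measurable_EFinP; exact: measurable_funM.
- by move=> w _; rewrite mule_ge0 ?lee_fin// adde_ge0.
- by apply: emeasurable_funM => //; exact: emeasurable_funD.
rewrite EFinD; apply: leeD.
  rewrite ge0_integralZ_real// integral_indic// setIT EFinM lee_wpmul2l//.
rewrite ge0_integralZl//; last 2 first.
- exact: emeasurable_funD.
- by move=> w _; rewrite adde_ge0.
rewrite EFinM lee_wpmul2l//.
have c1 : (\int[P]_w (1 : R)%:E = 1)%E.
  by rewrite integral_cst_EFin// probability_setT mule1.
rewrite ge0_integralD// EFinD; apply: leeD.
  rewrite ge0_integral_sum//.
  apply: (@le_trans _ _ (\sum_(i < k) (1 + wb)%:E)%E).
    apply: lee_sum => i _; rewrite ge0_integralD_real// c1 EFinD leeD2l//.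
  by rewrite sumEFin sumr_const card_ord mulr_natl.
rewrite ge0_integral_sum//.
apply: (@le_trans _ _ (\sum_(i < k) (k%:R * (1 + sb))%:E)%E).
  apply: lee_sum => i _; rewrite ge0_integral_sum//.
  apply: (@le_trans _ _ (\sum_(j < k) (1 + sb)%:E)%E).
    apply: lee_sum => j _; rewrite ge0_integralD// c1 EFinD leeD2l//.
  by rewrite sumEFin sumr_const card_ord mulr_natl.
by rewrite sumEFin sumr_const card_ord [in leRHS]mulr_natl.
Qed.

End moment_splitting.

Section derivative_measurability.
Context d (T : measurableType d) (R : realType) (k : nat).

Lemma measurable_grad (g : 'rV[R]_k -> T -> R) x0 eta :
  (forall x, eball x0 eta x -> measurable_fun setT (g x)) ->
  (forall w x, eball x0 eta x -> differentiable (g ^~ w) x) ->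
  forall x i, eball x0 eta x -> measurable_fun setT (fun w => grad (g ^~ w) x 0
      i).
Proof.
move=> mg dg x i xb.
rewrite (_ : (fun _ => _) = fun w => 'D_(delta_mx 0 i) (g ^~ w) x); last first.
  by apply/funext => w; rewrite /grad mxE.
apply: (@measurable_derive _ _ _ _ (eball x0 eta)) => // [|w].
  exact: nbhs_eball.
by apply: diff_derivable; exact: dg.
Qed.

Lemma measurable_hess (g : 'rV[R]_k -> T -> R) x0 eta :
  (forall x, eball x0 eta x -> measurable_fun setT (g x)) ->
  (forall w x, eball x0 eta x -> differentiable (g ^~ w) x) ->
  (forall w x, eball x0 eta x -> differentiable (grad (g ^~ w)) x) ->
  forall x i j, eball x0 eta x -> measurable_fun setT (fun w => hess (g ^~ w) x
      i j).
Proof.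
move=> mg dg ddg x i j xb.
rewrite (_ : (fun _ => _) = fun w => 'D_(delta_mx 0 j)
    ((fun y w => grad (g ^~ w) y 0 i) ^~ w) x); last first.
  by apply/funext => w; rewrite /hess mxE.
apply: (@measurable_derive _ _ _ _ (eball x0 eta)) => [|y yb|w].
- exact: nbhs_eball.
- exact: (measurable_grad mg dg).
apply: diff_derivable.
apply: (@differentiable_comp _ _ _ _ (grad (g ^~ w)) (fun v : 'rV[R]_k => v 0
    i)).
  exact: ddg.
exact: differentiable_coord.
Qed.

End derivative_measurability.

(** * Choice of the radius and bounds for powers *)

Section assembly_tools.
Context (R : realType) (k : nat).

Lemma near_power_bound (W : 'I_k -> R) (H : 'I_k -> 'I_k -> R)
    (x c delta q p q1 : R) : (0 < k)%N -> 0 < q -> q <= p -> q <= q1 ->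
  0 <= c -> 0 <= x -> 0 <= delta -> delta <= 1 ->
  x <= c * (\sum_(i < k) `|W i| + delta * \sum_(i < k) \sum_(j < k) `|H i j|) ->
  x `^ q <= c `^ q * 2 `^ q * (k%:R `^ q * k%:R `^ q) *
    (\sum_(i < k) (1 + `|W i| `^ p) +
     \sum_(i < k) \sum_(j < k) (1 + `|H i j| `^ q1)).
Proof.
move=> k0 q0 qp qq1 c0 x0 d0 d1 xle.
set A := \sum_(i < k) `|W i| in xle *; set B := \sum_(i < k) _ in xle.
have A0 : 0 <= A by exact: sumr_ge0.
have B0 : 0 <= B by apply: sumr_ge0 => i _; exact: sumr_ge0.
have kq1 : 1 <= k%:R `^ q :> R.
  have k1 : 1 <= k%:R :> R by rewrite ler1n.
  by have := ler_powR k1 (ltW q0); rewrite powRr0.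
have Aq : A `^ q <= k%:R `^ q * k%:R `^ q * \sum_(i < k) (1 + `|W i| `^ p).
  apply: (@le_trans _ _ (k%:R `^ q * \sum_(i < k) `|W i| `^ q)); first exact:
      powR_sum_le.
  rewrite -mulrA ler_wpM2l ?powR_ge0//.
  apply: (@le_trans _ _ (\sum_(i < k) (1 + `|W i| `^ p))).
    by apply: ler_sum => i _; apply: powR_le1D => //; exact: ltW.
  by rewrite ler_peMl// sumr_ge0// => i _; rewrite addr_ge0// powR_ge0.
have Bq : B `^ q <= k%:R `^ q * k%:R `^ q * \sum_(i < k) \sum_(j < k) (1 + `|H
    i j| `^ q1).
  apply: (@le_trans _ _ (k%:R `^ q * \sum_(i < k) (\sum_(j < k) `|H i j|) `^
      q)).
    by apply: powR_sum_le => // i; exact: sumr_ge0.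
  rewrite -mulrA ler_wpM2l ?powR_ge0// mulr_sumr; apply: ler_sum => i _.
  apply: (@le_trans _ _ (k%:R `^ q * \sum_(j < k) `|H i j| `^ q)); first exact:
      powR_sum_le.
  rewrite ler_wpM2l ?powR_ge0//; apply: ler_sum => j _.
  by apply: powR_le1D => //; exact: ltW.
apply: (@le_trans _ _ ((c * (A + B)) `^ q)).
  apply: ge0_ler_powR; rewrite ?nnegrE ?mulr_ge0 ?addr_ge0 ?(ltW q0)//.
  by apply: (le_trans xle); rewrite ler_wpM2l// lerD2l ler_piMl.
rewrite powRM ?addr_ge0// -!mulrA ler_wpM2l ?powR_ge0//.
apply: (le_trans (powR_add2_le q0 A0 B0)); rewrite ler_wpM2l ?powR_ge0//.
by rewrite mulrA mulrDr; exact: lerD.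
Qed.

(** The radius is the minimum of delta1, 1 and 1/(2 k^2 Mb). *)
Lemma exists_radius (delta1 Mb : R) : (0 < k)%N -> 0 < delta1 -> 0 < Mb ->
  exists delta, [/\ 0 < delta, delta <= delta1, delta <= 1 &
    k%:R ^+ 4 * delta ^+ 2 * Mb ^+ 2 <= 4^-1].
Proof.
move=> k0 d10 Mb0; have kR : 0 < k%:R :> R by rewrite ltr0n.
pose s : R := (2 * k%:R ^+ 2 * Mb)^-1.
have s0 : 0 < s by rewrite invr_gt0 !mulr_gt0// exprn_gt0.
exists (Num.min delta1 (Num.min 1 s)); split.
- by rewrite !lt_min d10 ltr01 s0.
- by rewrite ge_min lexx.
- by rewrite !ge_min lexx orbT.
have sE : k%:R ^+ 4 * s ^+ 2 * Mb ^+ 2 = 4^-1.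
  by rewrite /s; field; rewrite !gt_eqF.
rewrite -sE ler_wpM2r ?sqr_ge0// ler_wpM2l ?exprn_ge0//.
rewrite lerXn2r ?nnegrE ?(ltW s0)//.
  by rewrite !le_min (ltW d10) ler01 (ltW s0).
by rewrite !ge_min lexx !orbT.
Qed.

(** Only lower semicontinuity is needed for the measurability of suprema. *)
Lemma lower_semicontinuous_powR_norm (U : topologicalType) (F : U -> R) (q : R)
    (x : U) (r : R) : 0 < q -> {for x, continuous F} -> r < `|F x| `^ q ->
  nbhs x [set y | r < `|F y| `^ q].
Proof.
move=> q0 cF rF; have [r0|r0] := ltP r 0.
  by apply: filterS filterT => y _ /=; apply: lt_le_trans r0 _; exact: powR_ge0.
have rq : (r `^ q^-1) `^ q = r by rewrite -powRrM mulVf ?gt_eqF// powRr1.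
have lt1 : r `^ q^-1 < `|F x|.
  rewrite ltNge; apply/negP => h; move: rF; rewrite ltNge => /negP; apply.
  by rewrite -[leRHS]rq; apply: ge0_ler_powR; rewrite ?nnegrE ?powR_ge0 ?(ltW
      q0).
have c : `|F y| @[y --> x] --> `|F x| by apply: cvg_norm; exact: cF.
have h : nbhs x [set y | r `^ q^-1 < `|F y|] := c _ (lt_nbhsr lt1).
apply: filterS h => y /= h; rewrite -rq.
by apply: gt0_ltr_powR; rewrite ?nnegrE ?powR_ge0.
Qed.

Lemma ler_mul_norm (c a b : R) : 0 <= a -> a <= b -> c * a <= `|c| * b.
Proof.
move=> a0 ab; apply: (@le_trans _ _ (`|c| * a)); first by rewrite ler_wpM2r//
    ler_norm.
by rewrite ler_wpM2l.
Qed.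

Lemma eball_center (x : 'rV[R]_k) (delta : R) : 0 < delta -> eball x delta x.
Proof. by move=> d0; rewrite /eball/= subrr enorm0. Qed.

Lemma eballS (x : 'rV[R]_k) (delta delta' : R) : delta <= delta' ->
  eball x delta `<=` eball x delta'.
Proof. by move=> dd y /= h; exact: lt_le_trans dd. Qed.

End assembly_tools.

(** * The moment bound for the least squares estimate *)

Theorem theorem2p2 (R : realType) (d : measure_display)
  (Omega : measurableType d) (P : probability Omega R) (k : nat) (q : R)
  (G : nat -> set (set Omega)) (eps y : nat -> Omega -> R)
  (Theta1 : set 'rV[R]_k) (theta0 : 'rV[R]_k)
  (g : nat -> 'rV[R]_k -> Omega -> R)
  (thetahat : nat -> Omega -> 'rV[R]_k)
  (delta1 gamma C5 : R)
  (q_ge1 : 1 <= q)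
  (model : forall t w, (0 < t)%N -> y t w = g t theta0 w + eps t w)
  (G_incr : increasing_sigma_fields G)
  (eps_md : martingale_difference P G eps)
  (eps_cond2 : exists2 V : nat -> Omega -> \bar R,
     forall t, (0 < t)%N ->
       is_condexp P (G t.-1) (fun w => (eps t w ^+ 2)%:E) (V t) &
     {ae P, forall w,
       (ereal_sup [set V t w | t in [set t | (0 < t)%N]] < +oo)%E})
  (Theta1_compact : compact Theta1)
  (theta0_in : Theta1 theta0)
  (g_meas : forall t theta, (0 < t)%N -> Theta1 theta ->
     measurable_wrt (G t.-1) (g t theta))
  (g_cont : forall t w, (0 < t)%N -> {within Theta1, continuous (g t ^~ w)})
  (thetahat_meas : forall n (i : 'I_k), (0 < n)%N ->
     measurable_fun setT (fun w => thetahat n w 0 i))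
  (thetahat_in : forall n w, (0 < n)%N -> Theta1 (thetahat n w))
  (thetahat_min : forall n w theta, (0 < n)%N -> Theta1 theta ->
     least_squares y g n (thetahat n w) w <= least_squares y g n theta w)
  (delta1_gt0 : 0 < delta1)
  (ball_sub : eball theta0 delta1 `<=` Theta1)
  (g_C2 : forall t w theta, (0 < t)%N -> eball theta0 delta1 theta ->
     [/\ differentiable (g t ^~ w) theta,
         differentiable (grad (g t ^~ w)) theta &
         {for theta, continuous (hess (g t ^~ w))}])
  (gamma_gt : Num.max q 2 < gamma)
  (C5_gt0 : 0 < C5)
  (eps_condgamma : exists2 V : nat -> Omega -> \bar R,
     forall t, (0 < t)%N ->
       is_condexp P (G t.-1) (fun w => (`|eps t w| `^ gamma)%:E) (V t) &
     {ae P, forall w,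
       (ereal_sup [set V t w | t in [set t | (0 < t)%N]] < C5%:E)%E})
  (cond_i_regular :
     regular P (eball theta0 delta1)
       (fun t theta w => grad (g t ^~ w) theta) (fun t => G t.-1))
  (cond_i_moments : exists2 q1 : R, q < q1 &
     [/\ eO (fun n => \big[maxe/0%E]_(i < k) \big[maxe/0%E]_(j < k)
             \int[P]_w ereal_sup
               [set (`|(Num.sqrt n%:R)^-1 *
                       \sum_(1 <= t < n.+1)
                         eps t w * hess (g t ^~ w) theta i j| `^ q1)%:E
               | theta in eball theta0 delta1])%E (fun=> 1),
         eO (fun n => \big[maxe/0%E]_(i < k) \big[maxe/0%E]_(j < k)
             \big[maxe/0%E]_(1 <= t < n.+1)
             \int[P]_w ereal_sup
               [set (`|hess (g t ^~ w) theta i j| `^ (4 * q1))%:E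
               | theta in eball theta0 delta1])%E (fun=> 1) &
         eO (fun n => \big[maxe/0%E]_(1 <= t < n.+1)
             \int[P]_w ereal_sup
               [set (enorm (grad (g t ^~ w) theta) `^ (4 * q1))%:E
               | theta in eball theta0 delta1])%E (fun=> 1)])
  (cond_ii : forall delta2 : R, 0 < delta2 ->
     Theta1 `\` eball theta0 delta2 !=set0 ->
     regular P (Theta1 `\` eball theta0 delta2)
       (fun t theta w => const_mx (g t theta w - g t theta0 w) : 'rV[R]_1)
       (fun t => G t.-1) /\
     exists nu q2 : R,
       [/\ 0 < nu, nu <= 2^-1, q / (2 * nu) < q2 &
           eO (fun n => \int[P]_w ereal_sup
                [set (`|n%:R^-1 *
                        \sum_(1 <= t < n.+1)
                          eps t w * (g t theta w - g t theta0 w)| `^ q2)%:E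
                | theta in Theta1 `\` eball theta0 delta2])%E
              (fun n => n%:R `^ (- (nu * q2)))])
  (cond_iii : exists2 Mbar : R, 0 < Mbar &
     [/\ eO (fun n => P [set w | (Mbar%:E < ereal_sup
               [set lambda_min_inv
                  (n%:R^-1 *:
                     \sum_(1 <= t < n.+1)
                       (grad (g t ^~ w) theta)^T *m grad (g t ^~ w) theta)
               | theta in eball theta0 delta1])%E])
            (fun n => n%:R `^ (- q)),
         eO (fun n => P [set w | (Mbar%:E < ereal_sup
               [set (n%:R^-1 *
                     \sum_(1 <= t < n.+1) enorm (grad (g t ^~ w) theta) ^+ 2)%:E
               | theta in eball theta0 delta1])%E])
            (fun n => n%:R `^ (- q)) &
         eO (fun n => \big[maxe/0%E]_(i < k) \big[maxe/0%E]_(j < k)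
             P [set w | (Mbar%:E < ereal_sup
               [set (n%:R^-1 *
                     \sum_(1 <= t < n.+1) hess (g t ^~ w) theta i j ^+ 2)%:E
               | theta in eball theta0 delta1])%E])
            (fun n => n%:R `^ (- q))]) :
  eO (fun n => 'E_P[fun w =>
        (enorm (Num.sqrt n%:R *: (thetahat n w - theta0)) `^ q)%R]%E) (fun=> 1).
Proof.
have q0 : 0 < q by exact: lt_le_trans q_ge1.
case: (posnP k) => [k0|k0].
  exists 0; apply: nearW => n; rewrite mul0r unlock integral0_eq ?abse0// => w
      _.
  rewrite /enorm big1 ?sqrtr0 ?powR0 ?gt_eqF// => i _.
  by have := ltn_ord i; rewrite {2}k0.
have [sG incG] := G_incr.
have [q1 qq1 [hH _ hG]] := cond_i_moments.
have [Mb Mb0 [hb1 _ hb3]] := cond_iii.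
have [delta [d0 dd1 d1 dsmall]] := exists_radius k0 delta1_gt0 Mb0.
have dS := @eballS _ _ theta0 _ _ dd1.
have c0 := eball_center theta0 delta1_gt0.
have dg1 t w z : (0 < t)%N -> eball theta0 delta1 z -> differentiable (g t ^~
    w) z.
  by move=> t0 yb; have [] := g_C2 t w z t0 yb.
have dg2 t w z : (0 < t)%N -> eball theta0 delta1 z -> differentiable (grad (g
    t ^~ w)) z.
  by move=> t0 yb; have [] := g_C2 t w z t0 yb.
have ch t w i j z : (0 < t)%N -> eball theta0 delta1 z ->
    hess (g t ^~ w) x i j @[x --> z] --> hess (g t ^~ w) z i j.
  move=> t0 yb; have [_ _ c] := g_C2 t w z t0 yb.
  exact: (cvg_comp _ _ c (@coord_continuous _ _ _ i j (hess (g t ^~ w) z))).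
have cgr t w i z : (0 < t)%N -> eball theta0 delta1 z ->
    grad (g t ^~ w) x 0 i @[x --> z] --> grad (g t ^~ w) z 0 i.
  move=> t0 yb; have c := differentiable_continuous (dg2 t w z t0 yb).
  exact: (cvg_comp _ _ c (@coord_continuous _ _ _ 0 i (grad (g t ^~ w) z))).
have mg t z : (0 < t)%N -> eball theta0 delta1 z -> measurable_fun setT (g t z).
  by move=> t0 yb; apply: (measurable_wrt_fun (sG t.-1)); apply: g_meas => //;
      exact: ball_sub.
have mgr t z i : (0 < t)%N -> eball theta0 delta1 z ->
    measurable_fun setT (fun w => grad (g t ^~ w) z 0 i).
  by move=> t0; apply: measurable_grad => [x|w x]; [exact: mg|exact: dg1].
have mhe t z i j : (0 < t)%N -> eball theta0 delta1 z ->
    measurable_fun setT (fun w => hess (g t ^~ w) z i j).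
  by move=> t0; apply: measurable_hess => [x|w x|w x]; [exact: mg|exact:
      dg1|exact: dg2].
have me t : (0 < t)%N -> measurable_fun setT (eps t).
  by move=> t0; have [et _ _] := eps_md t t0; exact: measurable_wrt_fun (sG t)
      et.
(* the basic inequality of least squares *)
have ls n w : (0 < n)%N ->
    \sum_(1 <= t < n.+1) (g t (thetahat n w) w - g t theta0 w) ^+ 2 <=
    2 * \sum_(1 <= t < n.+1) eps t w * (g t (thetahat n w) w - g t theta0 w).
  move=> n0; have := thetahat_min n w theta0 n0 theta0_in.
  rewrite /least_squares -subr_le0 -sumrB => h.
  rewrite mulr_sumr -subr_le0 -sumrB; apply: le_trans h; rewrite le_eqVlt;
      apply/orP; left; apply/eqP.
  by apply: eq_big_nat => t /andP[t0 _]; rewrite model//; ring.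
have mhat n : (0 < n)%N -> measurable_fun setT (fun w => enorm (thetahat n w -
    theta0)).
  move=> n0; apply: (measurableT_comp (continuous_measurable_fun
      (@sqrt_continuous R))).
  apply: measurable_sum => i; apply: measurable_funX.
  under eq_fun do rewrite !mxE.
  by apply: measurable_funD => //; exact: thetahat_meas.
have mfar n : (0 < n)%N -> measurable [set w | ~ eball theta0 delta (thetahat n
    w)].
  move=> n0; have := mhat n n0 measurableT _ (measurable_itv `[delta, +oo[);
      rewrite setTI.
  congr measurable; apply/seteqP; split=> w /=; rewrite in_itv/= andbT leNgt;
      by move/negP.
have [Cf [Cf0 hfar]] := far_probability q0 d0 G_incr Theta1_compact theta0_in
  g_meas g_cont mfar thetahat_in ls (cond_ii delta d0).
(* moments of the score at the true parameter *)
pose p := Num.max q 2.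
have qp : q <= p by rewrite le_max lexx.
have p2 : 2 <= p by rewrite le_max lexx orbT.
have pg : p <= gamma by exact: ltW.
have p4 : p <= 4 * q1 by rewrite ge_max; apply/andP; split; lra.
have p0 : 0 <= p by exact: le_trans p2.
have hgam t A : (0 < t)%N -> G t.-1 A ->
    (\int[P]_(w in A) (`|eps t w| `^ gamma)%:E <= C5%:E * P A)%E.
  move=> t0 GA; have [V VE VC] := eps_condgamma.
  apply: (condexp_le (sG t.-1) (VE t t0) (ltW C5_gt0) _ GA).
  apply: filterS VC => w /ltW; apply: le_trans; apply: ereal_sup_ubound.
  by exists t.
have [Cg [Ng _ HNg]] := hG.
have xmom i t : (0 < t)%N ->
    (\int[P]_w (`|grad (g t ^~ w) theta0 0 i| `^ p)%:E <= (1 + `|Cg|)%:E)%E.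
  move=> t0.
  have mx r : measurable_fun setT (fun w => `|grad (g t ^~ w) theta0 0 i| `^ r).
    apply: (measurableT_comp (measurable_powR r)).
    by apply: measurableT_comp => //; exact: mgr.
  apply: (@le_trans _ _ (\int[P]_w (1 + `|grad (g t ^~ w) theta0 0 i| `^ (4 *
      q1))%:E)%E).
    apply: ge0_le_integral_any => w; rewrite lee_fin ?powR_ge0//.
    exact: powR_le1D.
  rewrite ge0_integralD_real// ?integral_cst_EFin// probability_setT mule1
      EFinD leeD2l//.
  apply: (@le_trans _ _ (\int[P]_w ereal_sup
      [set (enorm (grad (g t ^~ w) theta) `^ (4 * q1))%:E | theta in eball
          theta0 delta1])%E).
    apply: ge0_le_integral_any => w; first by rewrite lee_fin powR_ge0.
    apply: le_trans (_ : ((enorm (grad (g t ^~ w) theta0) `^ (4 * q1))%:E <=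
        _)%E).
      rewrite lee_fin; apply: ge0_ler_powR; rewrite ?nnegrE ?enorm_ge0
          ?coord_le_enorm//.
      exact: le_trans p4.
    by apply: ereal_sup_ubound; exists theta0.
  have := HNg (maxn Ng t) (leq_maxl _ _); rewrite mulr1 => h.
  apply: (@le_trans _ _ Cg%:E); last by rewrite lee_fin ler_norm.
  apply: le_trans h; apply: le_trans (lee_abs _).
  apply: (@le_bigmax_seq _ _ _ _ 0%E t xpredT (fun t => \int[P]_w ereal_sup
      [set (enorm (grad (g t ^~ w) theta) `^ (4 * q1))%:E | theta in eball
          theta0 delta1])%E) => //.
  by rewrite mem_index_iota t0 ltnS leq_maxr.
have hW i : exists K : R, forall n, (0 < n)%N ->
    (\int[P]_w (`|(Num.sqrt n%:R)^-1 *
       \sum_(1 <= t < n.+1) eps t w * grad (g t ^~ w) theta0 0 i| `^ p)%:E <=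
           K%:E)%E.
  apply: (martingale_moment p2 pg G_incr eps_md (ltW C5_gt0) hgam _ (xmom i))
      => t t0.
  apply/(measurable_wrtP _ (sG t.-1)).
  apply: (@measurable_grad _ (g_sigma_algebraType (G t.-1)) _ _ (g t) theta0
      delta1) => // [x xb|w x].
    by apply/(measurable_wrtP _ (sG t.-1)); apply: g_meas => //; exact:
        ball_sub.
  exact: dg1.
have [KW hKW] := choice hW.
pose wb := \sum_(i < k) `|KW i|.
have KWwb i : KW i <= wb.
  apply: (le_trans (ler_norm _)); rewrite /wb (bigD1 i)//= lerDl.
  by apply: sumr_ge0.
(* moments of the second order term *)
pose Hs n i j theta w := (Num.sqrt n%:R)^-1 *
  \sum_(1 <= t < n.+1) eps t w * hess (g t ^~ w) theta i j.
pose S n i j w := ereal_sup [set (`|Hs n i j theta w| `^ q1)%:E | theta in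
    eball theta0 delta1].
have q10 : 0 < q1 by exact: lt_trans qq1.
have mS n i j : measurable_fun setT (S n i j).
  apply: measurable_ereal_sup => [theta tb|w theta r tb rF].
    apply: (measurableT_comp (measurable_powR q1)); apply: measurableT_comp =>
        //.
    apply: measurable_funM => //; apply: measurable_sum_nat => t /andP[t0 _].
    by apply: measurable_funM; [exact: me|exact: mhe].
  have c : {for theta, continuous (fun x => Hs n i j x w)}.
    apply: (@cvgM _ _ _ (nbhs_filter theta) (cst _)); first exact: cvg_cst.
    apply: (@cvg_big_sum _ _ _ (nbhs_filter theta)) => t; rewrite
        mem_index_iota => /andP[t0 _].
    by apply: (@cvgM _ _ _ (nbhs_filter theta) (cst _)); [exact: cvg_cst|exact:
        ch].
  by apply: filterS (lower_semicontinuous_powR_norm q10 c rF) => x h _.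
have S0 n i j w : (0 <= S n i j w)%E.
  apply: le_trans (_ : ((`|Hs n i j theta0 w| `^ q1)%:E <= _)%E).
    by rewrite lee_fin powR_ge0.
  by apply: ereal_sup_ubound; exists theta0.
have [Ch [Nh _ HNh]] := hH.
have IS n i j : (Nh <= n)%N -> (\int[P]_w S n i j w <= Ch%:E)%E.
  move=> /HNh; rewrite mulr1; apply: le_trans; apply: le_trans (lee_abs _).
  apply: le_trans (le_bigmax _ _ i).
  exact: (le_bigmax _ (fun j => \int[P]_w S n i j w)%E j).
(* the events excluded by the conditions on the gradients and the Hessians *)
pose bad1 n := [set w | (Mb%:E < ereal_sup
  [set lambda_min_inv (gram n (fun t => grad (g t ^~ w) theta))
  | theta in eball theta0 delta1])%E].
pose bad3 n (ij : 'I_k * 'I_k) := [set w | (Mb%:E < ereal_sup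
  [set (n%:R^-1 * \sum_(1 <= t < n.+1) hess (g t ^~ w) theta ij.1 ij.2 ^+ 2)%:E
  | theta in eball theta0 delta1])%E].
have mbad1 n : measurable (bad1 n).
  apply: (@measurable_gt_sup_lambda_min_inv _ _ _ _ _ n
    (fun w theta t => grad (g t ^~ w) theta)) => // [theta t i t0 tb|theta t i
        w t0 tb].
    exact: mgr.
  exact: cgr.
have mbad3 n ij : measurable (bad3 n ij).
  rewrite -[bad3 n ij]setTI; apply: emeasurable_fun_o_infty => //.
  apply: measurable_ereal_sup => [theta tb|w theta r tb rF].
    apply: measurable_funM => //; apply: measurable_sum_nat => t /andP[t0 _].
    by apply: measurable_funX; exact: mhe.
  have c : n%:R^-1 * \sum_(1 <= t < n.+1) hess (g t ^~ w) x ij.1 ij.2 ^+ 2 @[x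
      --> theta] -->
      n%:R^-1 * \sum_(1 <= t < n.+1) hess (g t ^~ w) theta ij.1 ij.2 ^+ 2.
    apply: (@cvgM _ _ _ (nbhs_filter theta) (cst _)); first exact: cvg_cst.
    apply: (@cvg_big_sum _ _ _ (nbhs_filter theta)) => t; rewrite
        mem_index_iota => /andP[t0 _].
    have cc := ch t w ij.1 ij.2 theta t0 tb.
    exact: (cvgM cc cc).
  exact: (cvg_within_filter (eball theta0 delta1) c) (lt_nbhsr rF).
have [Cb1 [Nb1 _ Hb1]] := hb1.
have [Cb3 [Nb3 _ Hb3]] := hb3.
pose B n := [set w | ~ eball theta0 delta (thetahat n w)] `|`
  (bad1 n `|` [set w | exists2 ij, ij \in enum {: 'I_k * 'I_k} & bad3 n ij w]).
pose sz : R := (size (enum {: 'I_k * 'I_k}))%:R.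
have PB n : (0 < n)%N -> (Nb1 <= n)%N -> (Nb3 <= n)%N ->
    (P [set w | ~ eball theta0 delta (thetahat n w)] <=
      (Cf * n%:R `^ (- (q / 2)))%:E)%E ->
    measurable (B n) /\
    (P (B n) <= ((Cf + `|Cb1| + sz * `|Cb3|) * n%:R `^ (- (q / 2)))%:E)%E.
  move=> n0 n1 n3 Pf.
  have nq : n%:R `^ (- q) <= n%:R `^ (- (q / 2)) :> R.
    by rewrite ler_powR ?ler1n// lerN2 ler_pdivrMr// ler_peMr ?(ltW q0)// ler1n.
  have P1 : (P (bad1 n) <= (`|Cb1| * n%:R `^ (- (q / 2)))%:E)%E.
    apply: le_trans (lee_abs _) _; apply: (le_trans (Hb1 n n1)); rewrite
        lee_fin.
    by rewrite ler_mul_norm// powR_ge0.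
  have P3 ij : (P (bad3 n ij) <= (`|Cb3| * n%:R `^ (- (q / 2)))%:E)%E.
    apply: (@le_trans _ _ (Cb3 * n%:R `^ (- q))%:E).
      apply: le_trans (Hb3 n n3); apply: le_trans (lee_abs _).
      apply: le_trans (le_bigmax _ _ ij.1).
      exact: (le_bigmax _ (fun j => P (bad3 n (ij.1, j))) ij.2).
    by rewrite lee_fin ler_mul_norm// powR_ge0.
  have [mU PU] := probability_finite_union (P := P) (s := enum {: 'I_k * 'I_k})
    (fun ij _ => mbad3 n ij) (fun ij _ => P3 ij).
  split; first by apply: measurableU; [exact: mfar|exact: measurableU].
  apply: (le_trans (measureU2 P (mfar n n0) (measurableU _ _ (mbad1 n) mU))).
  rewrite !mulrDl -addrA EFinD; apply: leeD => //.
  apply: (le_trans (measureU2 P (mbad1 n) mU)).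
  by rewrite EFinD; apply: leeD => //; rewrite -mulrA.
have [b Tb] := compact_coord_bound Theta1_compact.
pose Dm : R := k%:R * (2 * b%:R).
have Dm0 : 0 <= Dm by rewrite !mulr_ge0.
have hatb n w : (0 < n)%N -> enorm (thetahat n w - theta0) <= Dm.
  move=> n0; apply: (le_trans (enorm_le_sum _)).
  apply: (@le_trans _ _ (\sum_(i < k) (2 * b%:R))); last first.
    by rewrite /Dm sumr_const card_ord [in leRHS]mulr_natl.
  apply: ler_sum => i _; rewrite !mxE; apply: (le_trans (ler_normB _ _)).
  by rewrite mulrDl mul1r; apply: lerD; apply: Tb => //; exact: thetahat_in.
clearbody Dm.
pose kap := (8 * Mb) `^ q * 2 `^ q * (k%:R `^ q * k%:R `^ q).
have kap0 : 0 <= kap by rewrite !mulr_ge0 ?powR_ge0.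
exists (Dm `^ q * (Cf + `|Cb1| + sz * `|Cb3|) +
  kap * (k%:R * (1 + wb) + k%:R * (k%:R * (1 + Ch)))).
near=> n.
have n0 : (0 < n)%N by near: n; exists 1%N.
have nb1 : (Nb1 <= n)%N by near: n; exists Nb1.
have nb3 : (Nb3 <= n)%N by near: n; exists Nb3.
have nh : (Nh <= n)%N by near: n; exists Nh.
have Pfar : (P [set w | ~ eball theta0 delta (thetahat n w)] <=
      (Cf * n%:R `^ (- (q / 2)))%:E)%E by near: n.
have [mB PBn] := PB n n0 nb1 nb3 Pfar.
have nR : 0 < n%:R :> R by rewrite ltr0n.
set r := Num.sqrt n%:R.
have r0 : 0 < r by rewrite sqrtr_gt0.
have rq : r `^ q = n%:R `^ (q / 2).
  by rewrite /r -powR12_sqrt ?(ltW nR)// -powRrM mulrC.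
rewrite unlock mulr1 gee0_abs; last first.
  by apply: integral_ge0 => w _; rewrite lee_fin powR_ge0.
have -> : Dm `^ q * (Cf + `|Cb1| + sz * `|Cb3|) =
   (r * Dm) `^ q * ((Cf + `|Cb1| + sz * `|Cb3|) * n%:R `^ (- (q / 2))).
  rewrite powRM ?(ltW r0)// rq powRN.
  have np : n%:R `^ (q / 2) != 0 :> R by rewrite gt_eqF// powR_gt0.
  move: (n%:R `^ (q / 2)) np (_ + _) => a a0 c; by field.
apply: (@integral_split_bound _ _ _ _ _ _ (B n) _ _ _ _ _
  (fun i w => `|(Num.sqrt n%:R)^-1 *
       \sum_(1 <= t < n.+1) eps t w * grad (g t ^~ w) theta0 0 i| `^ p)
  (fun i j w => S n i j w)) => //.
- by move=> w; exact: powR_ge0.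
- exact: powR_ge0.
- move=> i; apply: (measurableT_comp (measurable_powR p)); apply:
    measurableT_comp => //.
  apply: measurable_funM => //; apply: measurable_sum_nat => t /andP[t0 _].
  by apply: measurable_funM; [exact: me|exact: mgr].
- move=> w _; rewrite enormZ (ger0_norm (ltW r0)).
  apply: ge0_ler_powR; rewrite ?nnegrE ?mulr_ge0 ?enorm_ge0 ?(ltW r0) ?(ltW
      q0)//.
  by rewrite ler_wpM2l ?(ltW r0)// hatb.
- move=> w /not_orP[/contrapT nf /not_orP[nb1w nb3w]].
  have hE : thetahat n w = theta0 + (thetahat n w - theta0) by rewrite addrC
      subrK.
  have gram0 u : enorm u ^+ 2 <= Mb * quad_form (gram n (fun t => grad (g t ^~
      w) theta0)) u.
    rewrite leNgt; apply/negP => lt; apply: nb1w.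
    apply/(gt_sup_lambda_min_invP _ _ _ k0 Mb0); exists u, theta0; split=> //.
    by rewrite subr_gt0 -ltr_pdivrMl ?invr_gt0// invrK.
  have hess0 z i j : eball theta0 delta z ->
      n%:R^-1 * \sum_(1 <= t < n.+1) hess (g t ^~ w) z i j ^+ 2 <= Mb.
    move=> yb; rewrite leNgt; apply/negP => lt; apply: nb3w.
    exists (i, j); first by rewrite mem_enum.
    apply: (@lt_le_trans _ _ (n%:R^-1 * \sum_(1 <= t < n.+1) hess (g t ^~ w) z
        i j ^+ 2)%:E).
      by rewrite lte_fin.
    by apply: ereal_sup_ubound; exists z => //; exact: dS.
  have [|||||z yb near] := @least_squares_near _ _ (fun t => g t ^~ w) (eps ^~
      w)
    theta0 (thetahat n w - theta0) n delta Mb n0 Mb0 _ dsmall.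
  - exact: nf.
  - by move=> t z t0 yb; split; [apply: dg1|apply: dg2] => //; exact: dS.
  - by rewrite -hE; exact: ls.
  - by rewrite -quad_form_gram; exact: gram0.
  - exact: hess0.
  rewrite enormZ (ger0_norm (ltW r0)).
  have Sle i j : ((`|Hs n i j z w| `^ q1)%:E <= S n i j w)%E.
    by apply: ereal_sup_ubound; exists z => //; exact: dS.
  apply: (@le_trans _ _ (kap * (\sum_(i < k) (1 + `|r^-1 *
       \sum_(1 <= t < n.+1) eps t w * grad (g t ^~ w) theta0 0 i| `^ p) +
     \sum_(i < k) \sum_(j < k) (1 + `|Hs n i j z w| `^ q1)))%:E).
    rewrite lee_fin; apply: (near_power_bound k0 q0 qp (ltW qq1) _ _ (ltW d0)
        d1 near).
      by rewrite mulr_ge0// ltW.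
    by rewrite mulr_ge0 ?enorm_ge0// ltW.
  rewrite EFinM EFinD lee_wpmul2l ?lee_fin//; apply: leeD; first by rewrite
      -sumEFin.
  rewrite -sumEFin; apply: lee_sum => i _; rewrite -sumEFin; apply: lee_sum =>
      j _.
  by rewrite EFinD leeD2l.
- move=> i; apply: (le_trans (hKW i n n0)); rewrite lee_fin; exact: KWwb.
- by move=> i j; exact: IS.
Unshelve. all: by end_near.
Qed.
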